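(* Let $T=[0,1]$. For $j=1,2$ let $\psi_j=(\sigma_{1,j}^2,\sigma_{2,j}^2,\rho_j,\theta_j)^\top$ be a parameter with $\sigma_{1,j},\sigma_{2,j}>0$, $|\rho_j|<1$ and $\theta_j>0$, and let $P_{\psi_j}$ be the distribution of the zero-mean bivariate Gaussian process $Z=\{(Z_1(s),Z_2(s))^\top : s\in T\}$ under the covariance parameter $\psi_j$. Then the two measures $P_{\psi_1}$ and $P_{\psi_2}$ are equivalent on the $\sigma$-algebra generated by $\{Z(s) : s\in T\}$ if and only if $$\sigma_{i,1}^2\theta_1=\sigma_{i,2}^2\theta_2\ \text{ for } i=1,2,\qquad\text{and}\qquad \rho_1=\rho_2,$$ and they are orthogonal otherwise.
   Context: For a parameter $\psi=(\sigma_1^2,\sigma_2^2,\rho,\theta)^\top$ with $\sigma_1,\sigma_2>0$, $|\rho|<1$, $\theta>0$, the process $Z(s)=(Z_1(s),Z_2(s))^\top$, $s\in T$, is, under $P_\psi$, a stationary zero-mean bivariate Gaussian process with covariance $$\mathrm{Cov}_\psi(Z_i(s),Z_j(t))=\sigma_i\sigma_j\bigl(\rho+(1-\rho)\mathbf 1_{i=j}\bigr)e^{-\theta|s-t|},\qquad i,j\in\{1,2\},\ s,t\in T.$$ Two measures are equivalent if they are mutually absolutely continuous, and orthogonal if they are mutually singular. In $\sigma_{i,j}^2$ the first index $i$ refers to the component $Z_i$ and the second index $j$ to the parameter $\psi_j$. *)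

(* Defs.v *)
From HB Require Import structures.
From mathcomp Require Import all_boot all_order all_algebra.
From mathcomp Require Import all_classical all_reals all_analysis.

Set Implicit Arguments.
Unset Strict Implicit.
Unset Printing Implicit Defensive.

Import Order.TTheory GRing.Theory Num.Theory.
Import numFieldNormedType.Exports.

Local Open Scope classical_set_scope.
Local Open Scope ring_scope.

Definition measures_equivalent d (T : measurableType d) (R : realType)
    (m1 m2 : set T -> \bar R) : Prop :=
  m1 `<< m2 /\ m2 `<< m1.

Definition measures_orthogonal d (T : measurableType d) (R : realType)
    (m1 m2 : set T -> \bar R) : Prop :=
  exists A : set T, [/\ measurable A, m1 A = 0%E & m2 (~` A) = 0%E].

(* [g_sigma_algebraType G] has the same carrier as [Omega] but its measurable sets
   are those of <<s G >>, so this is [P] restricted to <<s G >>. *)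
Definition restrict_sigma (Omega : pointedType) (R : realType) (G : set (set Omega))
    (P : set Omega -> \bar R) : set (g_sigma_algebraType G) -> \bar R := P.

(* [normal_prob m 0] is the uniform distribution on [0, 1], not the point mass
   at [m], hence the case distinction. *)
Definition gaussian_law (R : realType) (m s : R) : set R -> \bar R :=
  if s == 0 then \d_m else normal_prob m s.

Definition gaussian_variable d (Omega : measurableType d) (R : realType)
    (P : probability Omega R) (X : Omega -> R) : Prop :=
  exists m s : R, 0 <= s /\
    forall A : set R, measurable A -> P (X @^-1` A) = gaussian_law m s A.

Section BivariateProcess.
Context d (Omega : measurableType d) (R : realType).
(* The values of [Z] at times outside [T] play no role. *)
Variables (T : set R) (Z : R -> {mfun Omega >-> 2.-tuple R}).

Definition component (i : 'I_2) (s : R) : Omega -> R := fun w => tnth (Z s w) i.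

Definition process_generators : set (set Omega) :=
  \bigcup_(s in T) g_sigma_algebra_preimage (Z s).

Variable P : probability Omega R.

Definition gaussian_process : Prop :=
  forall (n : nat) (a : 'I_n -> R) (i : 'I_n -> 'I_2) (s : 'I_n -> R),
    (forall k, T (s k)) ->
    gaussian_variable P (fun w => \sum_(k < n) a k * component (i k) (s k) w).

End BivariateProcess.

Record parameter (R : realType) := MkParameter {
  sigma : 'I_2 -> R;
  rho : R;
  theta : R }.

Definition admissible (R : realType) (psi : parameter R) : Prop :=
  [/\ forall i, 0 < sigma psi i, `|rho psi| < 1 & 0 < theta psi].

Definition cov_fun (R : realType) (psi : parameter R) (i j : 'I_2) (s t : R) : R :=
  sigma psi i * sigma psi j * (rho psi + (1 - rho psi) * (i == j)%:R)
  * expR (- theta psi * `|s - t|).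

(* Stationarity follows from the zero mean and the form of the covariance. *)
Definition bivariate_law d (Omega : measurableType d) (R : realType) (T : set R)
    (Z : R -> {mfun Omega >-> 2.-tuple R}) (psi : parameter R)
    (P : probability Omega R) : Prop :=
  [/\ gaussian_process T Z P,
      forall i s, T s -> ('E_P[component Z i s] = 0)%E
    & forall i j s t, T s -> T t ->
        covariance P (component Z i s) (component Z j t)
          = (cov_fun psi i j s t)%:E].

(* Main.v *)
(* Non-equivalence: the quadratic variation of [b0 Z_1 + b1 Z_2] over the mesh
   [1/n] has mean-square distance O(1/n) to [2 c theta], where [c] is the variance
   of the combination.  Unless all the [c theta] agree, that is, unless the
   [sigma_i^2 theta] and [rho] agree, Borel-Cantelli along [n = 2^k] separates the
   two laws.

   Equivalence: if they agree, then [r = rho sigma_2 / sigma_1] is the same for both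
   laws, and under both of them [Z_1] and [Z_2 - r Z_1] are independent
   Ornstein-Uhlenbeck processes.  Along a finite grid the log-likelihood ratio [l] is
   a sum of Gaussian one-step terms whose means under [P1] are of the order of the
   step, so that [E_1 l <= K] with [K] independent of the grid.  Since
   [E_1 expR (- l) = 1], every event [A] depending on finitely many times satisfies
   [P1 A <= expR m * P2 A + (K + 1) / m] for all [m > 0].  Approximating an event of
   the generated sigma-algebra by such events and letting [m] tend to infinity shows
   that [P2]-null events are [P1]-null.  The one-step formula only needs that an
   innovation orthogonal to the past is independent of it, which follows from the
   uniqueness of characteristic functions. *)

Require Import Defs.
From HB Require Import structures.
From mathcomp Require Import all_boot all_order all_algebra.
From mathcomp Require Import all_classical all_reals all_analysis.
From mathcomp Require Import measurable_realfun ring lra.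

Set Implicit Arguments.
Unset Strict Implicit.
Unset Printing Implicit Defensive.

Import Order.TTheory GRing.Theory Num.Theory.
Import numFieldNormedType.Exports.

Local Open Scope classical_set_scope.
Local Open Scope ring_scope.

(** * Densities and integrability *)

(** [gaussian_process] speaks only of the one-dimensional laws of linear combinations, and no joint
    Gaussian law is ever written down. Independence is therefore reached through cosines of linear
    combinations: their expectations depend on the variance alone, and events on the past are
    inserted one at a time.

    That the one-step terms are of the order of the step [D] rests on the equality of the products
    [c * theta]. The one-step variances [c * (1 - exp (-2 theta D))] then share the leading term
    [2 c theta D], so their relative difference is O(D), and it enters squared. The two regression
    coefficients also differ by O(D); this is squared and divided by a variance of order [D], which
    leaves O(D). The steps of a grid in [[0, 1]] sum to at most 1, whence a constant that does not
    depend on the grid. *)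

Section density.
Context d (T : measurableType d) (R : realType).
Variables (mu nu : {measure set T -> \bar R}) (f : T -> R).
Hypothesis mf : measurable_fun setT f.
Hypothesis f0 : forall x, 0 <= f x.
Hypothesis nuE : forall A, measurable A -> nu A = (\int[mu]_(x in A) (f x)%:E)%E.

Let density_indic (A : set T) : measurable A ->
  (\int[nu]_x (\1_A x)%:E = \int[mu]_x ((\1_A x) * f x)%:E)%E.
Proof.
move=> mA; rewrite integral_indic// setIT nuE// integral_mkcond.
by apply: eq_integral => x _; rewrite patchE indicE; case: ifP => _; rewrite (mul1r, mul0r).
Qed.

Import HBNNSimple.

Let density_nnsfun (h : {nnsfun T >-> R}) :
  (\int[nu]_x (h x)%:E = \int[mu]_x (h x * f x)%:E)%E.
Proof.
have hE x : (h x)%:E = (\sum_(r <- finmap.enum_fset (fset_set (range h))) (r * \1_(h @^-1` [set r]) x)%:E)%E.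
  by rewrite fimfunE fsbig_finite//= sumEFin.
have t0 r x : (0 <= (r * \1_(h @^-1` [set r]) x)%:E)%E by rewrite EFinM nnfun_muleindic_ge0.
have mt r : measurable_fun setT (fun x => (r * \1_(h @^-1` [set r]) x)%:E).
  by apply/measurable_EFinP; exact: measurable_funM.
under eq_integral do rewrite hE.
under [RHS]eq_integral do rewrite EFinM hE ge0_sume_distrl//.
rewrite !ge0_integral_sum//; last 2 first.
- by move=> r; apply: emeasurable_funM => //; exact/measurable_EFinP.
- by move=> r x _; rewrite mule_ge0// lee_fin.
apply: eq_bigr => r _; have [r0|r0] := leP 0 r; last first.
  by rewrite !integral0_eq// => x _; rewrite preimage_nnfun0// indic0 mulr0 ?mul0e.
under [RHS]eq_integral do rewrite -EFinM -mulrA EFinM.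
under eq_integral do rewrite EFinM.
rewrite !ge0_integralZl_EFin ?density_indic//.
- by move=> x _; rewrite lee_fin mulr_ge0.
- by apply/measurable_EFinP; exact: measurable_funM.
- exact/measurable_EFinP.
Qed.

(** The density enters only through the values of [nu] on measurable sets, so that [normal_prob] and
    measures obtained from an existence statement are treated alike. *)
Lemma ge0_integral_density (g : T -> \bar R) :
    measurable_fun setT g -> (forall x, 0 <= g x)%E ->
  (\int[nu]_x g x = \int[mu]_x (g x * (f x)%:E))%E.
Proof.
move=> mg g0; pose f_ := nnsfun_approx measurableT mg.
transitivity (limn (fun n => \int[nu]_x (f_ n x)%:E))%E.
  rewrite -monotone_convergence//=.
  - apply: eq_integral => x /[!inE] xD; apply/esym/cvg_lim => //=.
    exact: cvg_nnsfun_approx.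
  - by move=> n; apply: measurableT_comp => //; exact: measurable_funTS.
  - by move=> n x _; rewrite lee_fin.
  - by move=> x _ a b ab; rewrite lee_fin//; exact/lefP/nd_nnsfun_approx.
rewrite (_ : \int[mu]_x _ =
    limn (fun n => \int[mu]_x (f_ n x * f x)%:E))%E; last first.
  rewrite -monotone_convergence//=.
  - apply: eq_integral => x /[!inE] xD; apply/esym/cvg_lim => //.
    under eq_fun do rewrite EFinM muleC.
    rewrite muleC; apply: cvgeZl => //.
    exact: cvg_nnsfun_approx.
  - by move=> n; apply/measurable_EFinP/measurable_funM => //; exact: measurable_funTS.
  - by move=> n x _; rewrite lee_fin mulr_ge0.
  - by move=> x _ a b ab; rewrite lee_fin ler_wpM2r//; exact/lefP/nd_nnsfun_approx.
by congr (limn _); apply/funext => n; rewrite density_nnsfun.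
Qed.

Lemma integrable_density (g : T -> R) : measurable_fun setT g ->
  mu.-integrable setT (EFin \o (fun x => g x * f x)) ->
  nu.-integrable setT (EFin \o g).
Proof.
move=> mg /integrableP[_ ifi]; apply/integrableP; split; first exact/measurable_EFinP.
rewrite ge0_integral_density//.
  apply: le_lt_trans ifi; rewrite le_eqVlt; apply/orP; left; apply/eqP.
  by apply: eq_integral => x _; rewrite /= normrM EFinM [X in _ = (_ * X%:E)%E]ger0_norm.
by apply/measurableT_comp => //; exact/measurable_EFinP.
Qed.

Lemma Rintegral_density (g : T -> R) : measurable_fun setT g ->
  (\int[nu]_x g x = \int[mu]_x (g x * f x))%R.
Proof.
move=> mg; rewrite /Rintegral; congr fine.
rewrite integralE [RHS]integralE; congr (_ - _)%E.
  rewrite ge0_integral_density//; last exact/measurable_funepos/measurable_EFinP.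
  apply: eq_integral => x _; rewrite !funeposE/= -!EFin_max -EFinM; congr EFin.
  by rewrite maxr_pMl// mul0r.
rewrite ge0_integral_density//; last exact/measurable_funeneg/measurable_EFinP.
apply: eq_integral => x _; rewrite !funenegE/= -!EFin_max -EFinM; congr EFin.
by rewrite maxr_pMl// mul0r mulNr.
Qed.

End density.

(** An existence statement keeps the packaged measure opaque: later proofs see only its values. *)
Lemma density_measure_exists d (T : measurableType d) (R : realType)
    (mu : {measure set T -> \bar R}) (f : T -> R) :
  measurable_fun setT f -> (forall x, 0 <= f x) ->
  exists nu : {measure set T -> \bar R},
    forall A, measurable A -> nu A = (\int[mu]_(x in A) (f x)%:E)%E.
Proof.
move=> mf f0; pose m (A : set T) := (\int[mu]_(x in A) (f x)%:E)%E.
have m0 : m set0 = 0%E by rewrite /m integral_set0.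
have mge0 A : (0 <= m A)%E by apply: integral_ge0 => x _; rewrite lee_fin.
have msa : semi_sigma_additive m.
  by apply: semi_sigma_additive_nng_induced => //; exact/measurable_EFinP.
pose mix := @isMeasure.Build _ _ _ m m0 mge0 msa.
pose nu : {measure set T -> \bar R} := HB.pack m mix.
by exists nu.
Qed.

Section integrable_EFin.
Context d (T : measurableType d) (R : realType).
Variables (mu : {measure set T -> \bar R}) (D : set T).
Hypothesis mD : measurable D.
Implicit Types f g : T -> R.

(** This and the next two restate library facts with the real combination under a single [EFin], the
    shape in which integrands occur below. *)
Lemma integrableZl_EFin (k : R) f : mu.-integrable D (EFin \o f) ->
  mu.-integrable D (EFin \o (fun x => k * f x)).
Proof. exact: integrableZl. Qed.

Lemma integrableD_EFin f g : mu.-integrable D (EFin \o f) ->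
  mu.-integrable D (EFin \o g) -> mu.-integrable D (EFin \o (fun x => f x + g x)).
Proof. exact: integrableD. Qed.

Lemma integrableB_EFin f g : mu.-integrable D (EFin \o f) ->
  mu.-integrable D (EFin \o g) -> mu.-integrable D (EFin \o (fun x => f x - g x)).
Proof. exact: integrableB. Qed.

Lemma integrable_sum_EFin I (r : seq I) (F : I -> T -> R) :
    (forall i, mu.-integrable D (EFin \o F i)) ->
  mu.-integrable D (EFin \o (fun x => \sum_(i <- r) F i x)).
Proof.
move=> iF; elim: r => [|i r IH].
  apply: (eq_integrable mD _ _ _ (integrable0 _ _)) => // x _.
  by rewrite /= big_nil.
apply: (eq_integrable mD _ _ _ (integrableD_EFin (iF i) IH)) => // x _.
by rewrite /= big_cons.
Qed.

Lemma Rintegral_sum I (r : seq I) (F : I -> T -> R) :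
    (forall i, mu.-integrable D (EFin \o F i)) ->
  (\int[mu]_(x in D) (\sum_(i <- r) F i x) = \sum_(i <- r) \int[mu]_(x in D) F i x)%R.
Proof.
move=> iF; elim: r => [|i r IH].
  rewrite big_nil (@eq_Rintegral _ _ _ _ _ (cst 0)) ?Rintegral_cst ?mul0r// => x _.
  by rewrite big_nil.
rewrite big_cons -IH -RintegralD//; last exact: integrable_sum_EFin.
by apply: eq_Rintegral => x _; rewrite big_cons.
Qed.

Lemma le_integrable_EFin f g : measurable_fun D f ->
    (forall x, `|f x| <= g x) -> mu.-integrable D (EFin \o g) ->
  mu.-integrable D (EFin \o f).
Proof.
move=> mf fg; apply: le_integrable => //; first exact/measurable_EFinP.
by move=> x _; rewrite /= lee_fin (le_trans (fg x))// ler_norm.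
Qed.

End integrable_EFin.

Section line_integrals.
Context {R : realType}.
Notation mu := (@lebesgue_measure R).

(** Over [[-(n+1), n+1]] the integral is a difference of boundary values of [F], which the bound on
    [x * F x] makes O(1/n); dominated convergence passes to the whole line. *)
Lemma Rintegral_derive_eq0 (F f : R -> R) (K : R) :
    (forall x : R, is_derive x 1 F (f x)) -> continuous f ->
    mu.-integrable setT (EFin \o f) -> (forall x, `|x * F x| <= K) ->
  (\int[mu]_x f x)%R = 0.
Proof.
move=> dF cf intf FK.
pose D n : set R := `[- n.+1%:R, n.+1%:R]%classic.
pose fn n x := (f x * \1_(D n) x)%:E.
have mD n : measurable (D n) by exact: measurable_itv.
have mf : measurable_fun setT f by exact: continuous_measurable_fun.
have DE n : (\int[mu]_x fn n x = (F n.+1%:R - F (- n.+1%:R))%:E)%E.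
  transitivity (\int[mu]_(x in D n) (f x)%:E)%E.
    rewrite [RHS]integral_mkcond; apply: eq_integral => x _.
    by rewrite patchE /fn indicE; case: ifP => _; rewrite ?mulr1// mulr0.
  rewrite (@continuous_FTC2 _ f F).
  - by rewrite EFinB.
  - by rewrite -subr_gt0 opprK.
  - exact: continuous_subspaceT.
  - split.
    + by move=> x _; have [] := dF x.
    + apply: cvg_at_right_filter; apply: differentiable_continuous.
      by apply/derivable1_diffP; have [] := dF (- n.+1%:R).
    + apply: cvg_at_left_filter; apply: differentiable_continuous.
      by apply/derivable1_diffP; have [] := dF (n.+1%:R).
  - by move=> x _; rewrite derive1E; have [_ ->] := dF x.
have [_ _ cv] : [/\ mu.-integrable setT (EFin \o f),
    (fun n => \int[mu]_x (`|fn n x - (f x)%:E|))%E @ \oo --> 0%E &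
    (fun n => \int[mu]_x fn n x)%E @ \oo --> (\int[mu]_x (f x)%:E)%E].
  apply: (@dominated_convergence _ _ _ mu setT measurableT fn (EFin \o f)
    (EFin \o (fun x => `|f x|))).
  - move=> n; apply/measurable_EFinP/measurable_funM => //.
    by apply: measurable_indic; exact: mD.
  - exact/measurable_EFinP.
  - apply: aeW => x _; apply: cvg_near_cst; near=> n.
    rewrite /fn indicE mem_set ?mulr1//.
    have : `|x| <= n.+1%:R.
      have : (Num.truncn `|x| <= n)%N by near: n; exact: nbhs_infty_ge.
      move=> xn; apply: le_trans (ltW (truncnS_gt _)) _ => //.
      by rewrite ler_nat ltnS.
    by rewrite ler_norml => xn; rewrite /D/= in_itv.
  - exact: (integrable_norm intf).
  - apply: aeW => x n _; rewrite /fn /= lee_fin normrM ler_piMr//.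
    by rewrite indicE ger0_norm//; case: (_ \in _).
have cv0 : (fun n => \int[mu]_x fn n x)%E @ \oo --> 0%E.
  have -> : (fun n => \int[mu]_x fn n x)%E = (fun n => (F n.+1%:R - F (- n.+1%:R))%:E).
    by apply/funext => n; rewrite DE.
  apply/cvg_EFin; first exact: nearW.
  apply: (@squeeze_cvgr _ _ _ _ (fun n => - (2 * K * n.+1%:R^-1))
     (fun n => 2 * K * n.+1%:R^-1)).
  - apply: nearW => n; rewrite -ler_norml.
    rewrite ler_pdivlMr//.
    apply: (@le_trans _ _ (`|n.+1%:R * F n.+1%:R| + `|- n.+1%:R * F (- n.+1%:R)|)).
      rewrite !normrM normrN -mulrDr mulrC ger0_norm// ler_wpM2l//.
      by rewrite -[X in _ <= _ + X]normrN ler_normD.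
    by rewrite mulr2n mulrDl !mul1r lerD.
  - rewrite -oppr0; apply: cvgN; rewrite -(mulr0 (2 * K)); apply: cvgMr.
    exact: cvg_harmonic.
  - rewrite -(mulr0 (2 * K)); apply: cvgMr; exact: cvg_harmonic.
rewrite /Rintegral; rewrite (_ : (\int[mu]_x (f x)%:E = 0)%E)//.
by rewrite -(cvg_lim _ cv)// -(cvg_lim _ cv0).
Unshelve. all: by end_near. Qed.

Lemma lebesgue_measure_shift (m : R) (A : set R) : measurable A ->
  mu ((fun x => x + m) @^-1` A) = mu A.
Proof.
move=> mA; have mg : measurable_fun setT (fun x : measurableTypeR R => (x + m : measurableTypeR R)).
  by apply: measurable_funD => //.
pose g : {mfun measurableTypeR R >-> measurableTypeR R} := HB.pack
   (fun x : measurableTypeR R => (x + m : measurableTypeR R)) (isMeasurableFun.Build _ _ _ _ _ mg).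
rewrite [RHS](lebesgue_measure_unique (mu := pushforward mu g))//.
move=> _ [[a b]] _ <-; rewrite /= /pushforward.
have -> : (g @^-1` `]a, b]%classic) = `]a - m, b - m]%classic.
  by apply/seteqP; split => x /=; rewrite !in_itv/= ltrBlDr lerBrDr.
by rewrite !lebesgue_measure_itv/= !lte_fin ltrD2r -!EFinB opprD opprK addrACA addNr addr0.
Qed.

End line_integrals.

(** * Moments and characteristic function of a normal law *)

Section normal_integrals.
Context {R : realType}.
Notation mu := (@lebesgue_measure R).
Variable s : R.
Hypothesis s0 : 0 < s.
Local Notation phi := (normal_pdf 0 s).

Let sn0 : s != 0. Proof. by rewrite gt_eqF. Qed.

Lemma normal_pdf0E (x : R) :
  phi x = normal_peak s * expR (- x ^+ 2 / (s ^+ 2 *+ 2)).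
Proof. by rewrite (normal_pdfE _ sn0) /normal_fun subr0. Qed.

Lemma is_derive_normal_pdf0 (x : R) :
  is_derive x 1 phi (- (x / s ^+ 2) * phi x).
Proof.
have -> : phi = (fun x => normal_peak s * expR (- x ^+ 2 / (s ^+ 2 *+ 2))).
  by apply/funext => y; rewrite normal_pdf0E.
have d1 : is_derive x 1 (fun y : R => - y ^+ 2 / (s ^+ 2 *+ 2)) (- (x / s ^+ 2)).
  apply: is_derive_eq.
  by rewrite scaler0 add0r /GRing.scale/=; field.
have d2 := @is_derive1_comp _ expR (fun y : R => - y ^+ 2 / (s ^+ 2 *+ 2)) x _ _
  (is_derive_expR (- x ^+ 2 / (s ^+ 2 *+ 2))) d1.
have d3 := is_deriveZ (normal_peak s) d2.
apply: is_derive_eq d3 _.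
by rewrite /GRing.scale/= -/(normal_peak s); ring.
Qed.

(* With [u = 3 x^2 / (8 s^2)], [128/9 s^4 u^2 = 2 x^4] and [1 + u^2/2 <= expR u]
   turns the density of variance [s^2] into that of variance [(2 s)^2]. *)
Lemma normal_pdf0_moment4_bound :
  exists C, forall x, (1 + x ^+ 4) * phi x <= C * normal_pdf 0 (2 * s) x.
Proof.
have s2n0 : 2 * s != 0 by rewrite mulf_neq0.
exists ((1 + 128 / 9 * s ^+ 4) * normal_peak s / normal_peak (2 * s)) => x.
have p2 := normal_peak_gt0 s2n0; have p1 := normal_peak_gt0 sn0.
rewrite normal_pdf0E (normal_pdfE _ s2n0) /normal_fun subr0.
rewrite [leRHS](_ : _ = (1 + 128 / 9 * s ^+ 4) * expR (- x ^+ 2 / ((2 * s) ^+ 2 *+ 2)) * normal_peak s); last first.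
  by field; rewrite gt_eqF.
rewrite [leLHS](_ : _ = (1 + x ^+ 4) * expR (- x ^+ 2 / (s ^+ 2 *+ 2)) * normal_peak s); last by ring.
rewrite ler_pM2r//.
pose u := 3 * x ^+ 2 / (8 * s ^+ 2).
have u0 : 0 <= u by apply: divr_ge0; apply: mulr_ge0 => //; exact: sqr_ge0.
rewrite [X in _ * expR X <= _](_ : _ = - u + - x ^+ 2 / ((2 * s) ^+ 2 *+ 2)); last first.
  by rewrite /u; field.
rewrite expRD mulrA ler_wpM2r ?expR_ge0// expRN ler_pdivrMr ?expR_gt0//.
apply: (@le_trans _ _ ((1 + 128 / 9 * s ^+ 4) * (1 + u ^+ 2 / 2))); last first.
  rewrite ler_wpM2l//; last by have := expR_ge1Dxn 1 u0.
  by rewrite addr_ge0// mulr_ge0// exprn_ge0// ltW.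
rewrite [leRHS](_ : _ = 1 + x ^+ 4 + (128 / 9 * s ^+ 4 + u ^+ 2 / 2)); last first.
  by rewrite /u; field.
by rewrite lerDl addr_ge0// ?divr_ge0 ?sqr_ge0// mulr_ge0// exprn_ge0// ltW.
Qed.

(** Growth of degree 4 covers everything integrated later: moments up to the fourth and cosines. *)
Lemma integrable_mul_normal_pdf0 (f : R -> R) K : measurable_fun setT f ->
    (forall x, `|f x| <= K * (1 + x ^+ 4)) ->
  mu.-integrable setT (EFin \o (fun x => f x * phi x)).
Proof.
move=> mf fK; have [C hC] := normal_pdf0_moment4_bound.
have K0 : 0 <= K.
  by have := le_trans (normr_ge0 _) (fK 0); rewrite expr0n/= addr0 mulr1.
have i2 : mu.-integrable setT (EFin \o (fun x => K * C * normal_pdf 0 (2 * s) x)).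
  by apply: integrableZl_EFin => //; exact: integrable_normal_pdf.
apply: le_integrable i2 => //.
  apply/measurable_EFinP/measurable_funM => //; exact: measurable_normal_pdf.
move=> x _; rewrite /= lee_fin normrM [X in _ * X]ger0_norm ?normal_pdf_ge0//.
apply: (@le_trans _ _ (K * (1 + x ^+ 4) * phi x)).
  by rewrite ler_wpM2r// normal_pdf_ge0.
by rewrite -!mulrA (le_trans _ (ler_norm _))// ler_wpM2l.
Qed.

(** Supplies the boundary hypothesis of [Rintegral_derive_eq0] for the integration by parts: the
    polynomial is absorbed by the wider normal density, which is bounded by its peak. *)
Lemma normal_pdf0_boundary (f : R -> R) K :
    (forall x, `|x * f x| <= K * (1 + x ^+ 4)) ->
  exists K', forall x, `|x * (f x * phi x)| <= K'.
Proof.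
move=> fK; have [C hC] := normal_pdf0_moment4_bound.
have s2n0 : 2 * s != 0 by rewrite mulf_neq0.
have K0 : 0 <= K.
  by have := le_trans (normr_ge0 _) (fK 0); rewrite expr0n/= addr0 mulr1.
have C0 : 0 <= C.
  have h := hC 0; rewrite leNgt; apply/negP => C0.
  have : 0 <= C * normal_pdf 0 (2 * s) 0.
    by apply: le_trans h; rewrite expr0n/= addr0 mul1r normal_pdf_ge0.
  rewrite nmulr_rge0// leNgt => /negP; apply.
  by rewrite (normal_pdfE _ s2n0) mulr_gt0 ?expR_gt0 ?normal_peak_gt0.
exists (K * (C * normal_peak (2 * s))) => x.
rewrite mulrA normrM [X in _ * X]ger0_norm ?normal_pdf_ge0//.
apply: (@le_trans _ _ (K * (1 + x ^+ 4) * phi x)).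
  by rewrite ler_wpM2r// normal_pdf_ge0.
rewrite -mulrA ler_wpM2l// (le_trans (hC _))// ler_wpM2l//.
exact: normal_pdf_ub.
Qed.

(* Stein's identity. *)
Lemma Rintegral_normal_pdf0_by_parts (g g' : R -> R) (K : R) :
    (forall x : R, is_derive x 1 g (g' x)) -> continuous g' ->
    (forall x, `|x * g x| <= K * (1 + x ^+ 4)) ->
    (forall x, `|g' x| <= K * (1 + x ^+ 4)) ->
  (\int[mu]_x (x * g x * phi x) = s ^+ 2 * \int[mu]_x (g' x * phi x))%R.
Proof.
move=> dg cg' gK g'K.
have cg : continuous g.
  move=> x; apply: differentiable_continuous; apply/derivable1_diffP.
  by have [] := dg x.
have cphi : continuous phi by exact: continuous_normal_pdf.
have mxg : measurable_fun setT (fun x : R => x * g x).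
  by apply: measurable_funM => //; exact: continuous_measurable_fun.
have mg' : measurable_fun setT g' by exact: continuous_measurable_fun.
have i1 := integrable_mul_normal_pdf0 mxg gK.
have i2 := integrable_mul_normal_pdf0 mg' g'K.
have [K' hK'] := normal_pdf0_boundary gK.
(* The integrand is the derivative of [g * phi], because the logarithmic derivative of [phi] is
   [- x / s ^+ 2]. *)
have : (\int[mu]_x (g' x * phi x - s ^- 2 * (x * g x * phi x)))%R = 0.
  apply: (@Rintegral_derive_eq0 _ (fun x => g x * phi x) _ K') => //.
  - move=> x; have := is_deriveM (dg x) (is_derive_normal_pdf0 x).
    by move/is_derive_eq; apply; rewrite /GRing.scale/=; field.
  - move=> x; apply: cvgB; first by apply: cvgM; [exact: cg'|exact: cphi].
    apply: cvgMr; apply: cvgM; last exact: cphi.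
    by apply: cvgM; [exact: cvg_id|exact: cg].
  - by apply: integrableB_EFin => //; exact: integrableZl_EFin.
rewrite RintegralB//; last first.
  exact: integrableZl_EFin.
rewrite RintegralZl// => /eqP; rewrite subr_eq0 => /eqP ->.
by rewrite mulrA mulfV ?mul1r// expf_neq0.
Qed.

End normal_integrals.

(** * Change of variables along a law *)

Section law_transfer.
Context d d' (T : measurableType d) (S : measurableType d') (R : realType).
Variables (P : {measure set T -> \bar R}) (Q : {measure set S -> \bar R}) (X : T -> S).
Hypothesis mX : measurable_fun setT X.
Hypothesis lawX : forall A, measurable A -> P (X @^-1` A) = Q A.

(** The law is known only by its values on measurable sets, so that [Q] may be a Dirac mass, a
    normal law, Lebesgue measure or a product measure. *)
Lemma ge0_integral_law (f : S -> \bar R) : measurable_fun setT f ->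
    (forall x, 0 <= f x)%E ->
  (\int[P]_x f (X x) = \int[Q]_x f x)%E.
Proof.
move=> mf f0.
pose g : {mfun T >-> S} := HB.pack X (isMeasurableFun.Build _ _ _ _ _ mX).
rewrite [RHS](@eq_measure_integral _ _ _ setT (pushforward P g)); last first.
  by move=> A mA _; rewrite -lawX.
rewrite [RHS]ge0_integral_pushforward ?preimage_setT//.
Qed.

Lemma integrable_law (f : S -> R) : measurable_fun setT f ->
  Q.-integrable setT (EFin \o f) -> P.-integrable setT (EFin \o (fun x => f (X x))).
Proof.
move=> mf /integrableP[_ ifi]; apply/integrableP; split.
  by apply/measurable_EFinP; exact: (measurableT_comp mf).
rewrite (ge0_integral_law (f := fun x => `|(f x)%:E|%E))//.
by apply: measurableT_comp => //; exact/measurable_EFinP.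
Qed.

Lemma Rintegral_law (f : S -> R) : measurable_fun setT f ->
  (\int[P]_x f (X x) = \int[Q]_x f x)%R.
Proof.
move=> mf; rewrite /Rintegral; congr fine.
rewrite integralE [RHS]integralE; congr (_ - _)%E.
  rewrite -(@ge0_integral_law (fun x => (EFin \o f)^\+ x)%E)//.
    by apply: eq_integral => x _; rewrite !funeposE.
  exact/measurable_funepos/measurable_EFinP.
rewrite -(@ge0_integral_law (fun x => (EFin \o f)^\- x)%E)//.
  by apply: eq_integral => x _; rewrite !funenegE.
exact/measurable_funeneg/measurable_EFinP.
Qed.

End law_transfer.

Section normal_prob_moments.
Context {R : realType}.
Notation mu := (@lebesgue_measure R).

Lemma normr_le1DX4 (x : R) : `|x| <= 1 + x ^+ 4.
Proof.
have -> : x ^+ 4 = `|x| ^+ 4.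
  by rewrite -normrX ger0_norm ?exprn_even_ge0.
have := sqr_ge0 (`|x| ^+ 2); have := sqr_ge0 (`|x| - 1); have := sqr_ge0 (`|x| ^+ 2 - 1); have := normr_ge0 x.
nra.
Qed.

Lemma sqr_le1DX4 (x : R) : x ^+ 2 <= 1 + x ^+ 4.
Proof. have := sqr_ge0 (x ^+ 2); have := sqr_ge0 (x ^+ 2 - 1); nra. Qed.

Lemma measurable_cos_affine (t c : R) : measurable_fun setT (fun x : R => cos (t * x + c)).
Proof.
apply: measurableT_comp; first by apply: continuous_measurable_fun; exact: continuous_cos.
by apply: measurable_funD => //; apply: measurable_funM => //.
Qed.

Lemma measurable_sin_affine (t c : R) : measurable_fun setT (fun x : R => sin (t * x + c)).
Proof.
apply: measurableT_comp; first by apply: continuous_measurable_fun; exact: continuous_sin.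
by apply: measurable_funD => //; apply: measurable_funM => //.
Qed.

Lemma normal_prob_shift (m s : R) (A : set R) : s != 0 -> measurable A ->
  normal_prob m s A = normal_prob 0 s ((fun x => x + m) @^-1` A).
Proof.
move=> s0 mA.
have mg : measurable_fun setT (fun x : measurableTypeR R => (x + m : measurableTypeR R)).
  by apply: measurable_funD => //.
have mgA : measurable ((fun x : R => x + m) @^-1` A).
  by rewrite -[X in measurable X]setTI; exact: mg.
rewrite /normal_prob [LHS]integral_mkcond [RHS]integral_mkcond.
have mh : measurable_fun setT ((fun x => (normal_pdf m s x)%:E) \_ A).
  apply/(measurable_restrictT _ mA); apply: measurable_funTS.
  by apply/measurable_EFinP; exact: measurable_normal_pdf.
rewrite -(@ge0_integral_law _ _ _ _ _ mu mu _ mg _ _ mh).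
- apply: eq_integral => x _; rewrite !patchE /=.
  have -> : (x + m \in A) = (x \in (fun x0 : R => x0 + m) @^-1` A).
    by apply/idP/idP; rewrite !inE.
  by case: ifP => // _; rewrite !(normal_pdfE _ s0) /normal_fun subr0 addrK.
- by move=> B mB; exact: lebesgue_measure_shift.
- by move=> x; rewrite patchE; case: ifP => // _; rewrite lee_fin normal_pdf_ge0.
Qed.

Variable s : R.
Hypothesis s0 : 0 < s.
Notation N := (normal_prob (0 : R) s).

Let sn0 : s != 0. Proof. by rewrite gt_eqF. Qed.

Lemma Rintegral_normal_prob0 (f : R -> R) : measurable_fun setT f ->
  (\int[N]_x f x = \int[mu]_x (f x * normal_pdf 0 s x))%R.
Proof.
move=> mf; apply: (@Rintegral_density _ _ _ mu N (normal_pdf 0 s)) => //.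
- exact: measurable_normal_pdf.
- by move=> x; exact: normal_pdf_ge0.
Qed.

Lemma integrable_normal_prob0 (f : R -> R) K : measurable_fun setT f ->
  (forall x, `|f x| <= K * (1 + x ^+ 4)) -> N.-integrable setT (EFin \o f).
Proof.
move=> mf fK; apply: (@integrable_density _ _ _ mu N (normal_pdf 0 s)) => //.
- exact: measurable_normal_pdf.
- by move=> x; exact: normal_pdf_ge0.
- exact: integrable_mul_normal_pdf0 fK.
Qed.

Let mu_pdf : (\int[mu]_x normal_pdf 0 s x)%R = 1.
Proof. by rewrite /Rintegral integral_normal_pdf. Qed.

(** Stein's identity with a constant [g]; the next two moments take [g = x] and [g = x ^+ 3]. *)
Lemma normal_prob0_mean : (\int[N]_x x)%R = 0.
Proof.
rewrite Rintegral_normal_prob0//.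
rewrite (@eq_Rintegral _ _ _ mu _ (fun x => x * cst 1 x * normal_pdf 0 s x)); last first.
  by move=> x _; rewrite mulr1.
rewrite (@Rintegral_normal_pdf0_by_parts _ s s0 (cst 1) (cst 0) 1).
- rewrite (@eq_Rintegral _ _ _ mu _ (cst 0)) ?Rintegral_cst ?mul0r ?mulr0// => x _.
  by rewrite mul0r.
- by move=> x; exact: cvg_cst.
- by move=> x; rewrite mulr1 mul1r normr_le1DX4.
- by move=> x; rewrite normr0 mul1r addr_ge0// exprn_even_ge0.
Qed.

Lemma normal_prob0_moment2 : (\int[N]_x (x ^+ 2))%R = s ^+ 2.
Proof.
rewrite Rintegral_normal_prob0//.
rewrite (@Rintegral_normal_pdf0_by_parts _ s s0 id (cst 1) 1).
- rewrite (@eq_Rintegral _ _ _ mu _ (normal_pdf 0 s)) ?mu_pdf ?mulr1// => x _.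
  by rewrite mul1r.
- by move=> x; exact: cvg_cst.
- by move=> x; rewrite -expr2 mul1r ger0_norm ?sqr_ge0// sqr_le1DX4.
- by move=> x; rewrite normr1 mul1r lerDl exprn_even_ge0.
Qed.

Lemma normal_prob0_moment4 : (\int[N]_x (x ^+ 4))%R = 3 * s ^+ 4.
Proof.
rewrite Rintegral_normal_prob0//.
rewrite (@eq_Rintegral _ _ _ mu _ (fun x => x * (x ^+ 3) * normal_pdf 0 s x)); last first.
  by move=> x _; rewrite -exprS.
have dX3 (x : R) : is_derive x 1 (fun x : R => x ^+ 3) (3 * x ^+ 2).
  by apply: is_derive_eq; rewrite /GRing.scale/=; ring.
rewrite (@Rintegral_normal_pdf0_by_parts _ s s0 (fun x => x ^+ 3) (fun x => 3 * x ^+ 2) 3 dX3).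
- rewrite -(@Rintegral_normal_prob0 (fun x => 3 * x ^+ 2))//; last first.
    exact: measurable_funM.
  rewrite RintegralZl// ?normal_prob0_moment2; first by ring.
  apply: (@integrable_normal_prob0 _ 1) => // x.
  by rewrite mul1r ger0_norm ?sqr_ge0// sqr_le1DX4.
- move=> x; apply: cvgMr; exact: exprn_continuous.
- move=> x; rewrite -exprS ger0_norm ?exprn_even_ge0//.
  by have := @exprn_even_ge0 R 4 x isT; nra.
- move=> x; rewrite normrM ger0_norm// ler_wpM2l//.
  by rewrite ger0_norm ?sqr_ge0// sqr_le1DX4.
Qed.

(** The phase [c] lets one real identity carry both parts of the complex characteristic function:
    [c = 0] gives the cosine and [c = - pi / 2] the sine. *)
Lemma normal_prob0_cos (t c : R) :
  (\int[N]_x (cos (t * x + c)))%R = cos c * expR (- (s ^+ 2 * t ^+ 2 / 2)).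
Proof.
pose C u := (\int[N]_x (cos (u * x + c)))%R.
have icos u : N.-integrable setT (EFin \o (fun x => cos (u * x + c))).
  apply: (@integrable_normal_prob0 _ 1); first exact: measurable_cos_affine.
  by move=> x; rewrite mul1r (le_trans (cos_max _))// lerDl exprn_even_ge0.
(* Stein's identity makes the characteristic function solve [C' = - s^2 u C]. *)
have dC (u : R) : is_derive u 1 C (- (s ^+ 2 * u) * C u).
  have Iu : `]u - 1, u + 1[%classic u by rewrite /= in_itv/= gtrBl ltrDl ltr01.
  have i1 (v : R) : `]u - 1, u + 1[%classic v ->
      N.-integrable setT (EFin \o (fun x => cos (v * x + c))) by move=> _; exact: icos.
  have dv (v x : R) : is_derive v 1 (fun v : R => cos (v * x + c)) (- (x * sin (v * x + c))).
    have d1 : is_derive v 1 (fun v : R => v * x + c) x.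
      by apply: is_derive_eq; rewrite /GRing.scale/=; ring.
    have d2 := @is_derive1_comp _ cos (fun v => v * x + c) v _ _ (is_derive_cos _) d1.
    by apply: is_derive_eq d2 _; ring.
  have d1 (v x : R) : `]u - 1, u + 1[%classic v -> setT x ->
      derivable (fun v : R => cos (v * x + c)) v 1 by move=> _ _; have [] := dv v x.
  (* The derivative of the integrand in the frequency is at most [|x|] whatever the frequency, which
     justifies differentiation under the integral. *)
  have iG : N.-integrable setT (EFin \o (fun x => `|x|)).
    apply: (@integrable_normal_prob0 _ 1) => // x.
    by rewrite normr_id mul1r normr_le1DX4.
  have ub (v x : R) : `]u - 1, u + 1[%classic v -> setT x ->
      `|partial1of2 (fun v x : R => cos (v * x + c)) v x| <= `|x|.
    move=> _ _; rewrite partial1of2E; have [_ ->] := dv v x.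
    by rewrite normrN normrM ler_piMr// sin_max.
  have der := derivable_under_integral measurableT Iu i1 d1 (fun x => normr_ge0 x) iG ub.
  have := differentiation_under_integral measurableT Iu i1 d1 (fun x => normr_ge0 x) iG ub.
  rewrite derive1E => derE.
  apply: DeriveDef => //; rewrite derE.
  rewrite (@eq_Rintegral _ _ _ N _ (fun x => -1 * (x * sin (u * x + c)))); last first.
    by move=> x _; rewrite partial1of2E; have [_ ->] := dv u x; rewrite mulN1r.
  have mxs : measurable_fun setT (fun x : R => x * sin (u * x + c)).
    by apply: measurable_funM => //; exact: measurable_sin_affine.
  have ixs : N.-integrable setT (EFin \o (fun x => x * sin (u * x + c))).
    apply: (@integrable_normal_prob0 _ 1) => // x.
    by rewrite mul1r normrM (le_trans _ (normr_le1DX4 x))// ler_piMr// sin_max.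
  rewrite RintegralZl// Rintegral_normal_prob0//.
  have dsin (x : R) : is_derive x 1 (fun x : R => sin (u * x + c)) (u * cos (u * x + c)).
    have e1 : is_derive x 1 (fun x : R => u * x + c) u.
      by apply: is_derive_eq; rewrite /GRing.scale/=; ring.
    have e2 := @is_derive1_comp _ sin (fun x => u * x + c) x _ _ (is_derive_sin _) e1.
    by apply: is_derive_eq e2 _; ring.
  rewrite (@Rintegral_normal_pdf0_by_parts _ s s0 (fun x => sin (u * x + c))
    (fun x => u * cos (u * x + c)) (1 + `|u|) dsin).
  - have mc : measurable_fun setT (fun x : R => u * cos (u * x + c)).
      by apply: measurable_funM => //; exact: measurable_cos_affine.
    rewrite -(@Rintegral_normal_prob0 (fun x => u * cos (u * x + c)))//.
    by rewrite RintegralZl// /C; ring.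
  - move=> x; apply: cvgMr; apply: continuous_comp; last exact: continuous_cos.
    by apply: cvgD; [apply: cvgMr; exact: cvg_id|exact: cvg_cst].
  - move=> x; rewrite normrM (@le_trans _ _ `|x|)// ?ler_piMr// ?sin_max//.
    rewrite (le_trans (normr_le1DX4 x))// ler_peMl ?lerDl//.
    by rewrite addr_ge0// exprn_even_ge0.
  - move=> x; rewrite normrM (@le_trans _ _ `|u|)// ?ler_piMr// ?cos_max//.
    rewrite (@le_trans _ _ (1 + `|u|))// ?lerDr// ler_peMr// ?addr_ge0//.
    by rewrite lerDl exprn_even_ge0.
(* Multiplying by the integrating factor of the differential equation gives a function with zero
   derivative, whose constant value is [C 0 = cos c]. *)
pose E u := C u * expR (s ^+ 2 * u ^+ 2 / 2).
have dE (u : R) : is_derive u 1 E 0.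
  have d1 : is_derive u 1 (fun u : R => s ^+ 2 * u ^+ 2 / 2) (s ^+ 2 * u).
    by apply: is_derive_eq; rewrite /GRing.scale/=; field.
  have d2 := @is_derive1_comp _ expR (fun u => s ^+ 2 * u ^+ 2 / 2) u _ _ (is_derive_expR _) d1.
  have := is_deriveM (dC u) d2.
  by move/is_derive_eq; apply; rewrite /GRing.scale/=; ring.
have := is_derive_0_is_cst t 0 dE.
rewrite /E expr0n/= mulr0 mul0r expR0 mulr1.
have -> : C 0 = cos c.
  rewrite /C (@eq_Rintegral _ _ _ N _ (cst (cos c))) ?Rintegral_cst//.
    by rewrite [X in fine X](_ : _ = 1%E) ?mulr1//; exact: integral_normal_pdf.
  by move=> x _; rewrite mul0r add0r.
by move=> <-; rewrite -[RHS]mulrA -expRD subrr expR0 mulr1.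
Qed.

End normal_prob_moments.

(** * Uniqueness of characteristic functions *)

Lemma sqr_chebyshev d (T : measurableType d) (R : realType)
    (P : {measure set T -> \bar R}) (f : T -> R) (e : R) :
  measurable_fun setT f -> 0 < e ->
  ((e ^+ 2)%:E * P [set x | (e <= `|f x|)%R] <= \int[P]_x (f x ^+ 2)%:E)%E.
Proof.
move=> mf e0.
have mf2 : measurable_fun setT (EFin \o (fun x => f x ^+ 2)).
  by apply/measurable_EFinP; exact: measurable_funX.
have e2 : 0 < e ^+ 2 by rewrite exprn_gt0.
have := le_integral_abse P measurableT mf2 e2.
rewrite setTI (_ : [set x | _] = [set x | e <= `|f x|]); last first.
  apply/seteqP; split=> x /=; rewrite lee_fin normrX.
    by rewrite ler_sqr ?nnegrE ?(ltW e0).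
  by move=> h; rewrite ler_sqr ?nnegrE ?(ltW e0).
by under eq_integral do rewrite /= ger0_norm ?sqr_ge0//.
Qed.

Section cf_unique.
Context {R : realType}.
Notation mu := (@lebesgue_measure R).
Implicit Types P : {finite_measure set (measurableTypeR R) -> \bar R}.

Let mexp (s : R) : measurable_fun setT (fun z : measurableTypeR R * measurableTypeR R =>
  (expR (- (s ^+ 2 * (z.1 - z.2) ^+ 2 / 2)))%:E).
Proof.
apply/measurable_EFinP/measurableT_comp => //; apply: measurable_funN.
apply: measurable_funM => //; apply: measurable_funM => //.
by apply: measurable_funX; exact: measurable_funB.
Qed.

(* The shift by [1] keeps the cosine nonnegative, so that Tonelli applies and no
   integrability has to be tracked. *)
Let gauss_transform P (s y : R) : 0 < s ->
  (\int[P]_x (1 + expR (- (s ^+ 2 * (x - y) ^+ 2 / 2)))%:E =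
   \int[normal_prob 0 s]_t \int[P]_x (1 + cos (t * x + (- (t * y))))%:E)%E.
Proof.
move=> s0.
have mc : measurable_fun setT (fun z : measurableTypeR R * measurableTypeR R =>
    (1 + cos (z.2 * z.1 + (- (z.2 * y))))%:E).
  apply/measurable_EFinP/measurable_funD => //; apply: measurableT_comp.
    by apply: continuous_measurable_fun; exact: continuous_cos.
  apply: measurable_funD => //; first exact: measurable_funM.
  by apply: measurable_funN; exact: measurable_funM.
have c0 (z : measurableTypeR R * measurableTypeR R) :
    (0 <= (1 + cos (z.2 * z.1 + (- (z.2 * y))))%:E)%E.
  by rewrite lee_fin -lerBlDl sub0r cos_geN1.
rewrite -(@fubini_tonelli _ _ _ _ _ P (normal_prob 0 s) _ mc c0).
apply: eq_integral => x _ /=.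
have ic : (normal_prob 0 s).-integrable setT (EFin \o (fun t : R => cos ((x - y) * t + 0))).
  apply: (@integrable_normal_prob0 _ s s0 _ 1); first exact: measurable_cos_affine.
  by move=> t; rewrite mul1r (le_trans (cos_max _))// lerDl exprn_even_ge0.
have i1 : (normal_prob 0 s).-integrable setT (EFin \o (fun t : R => 1)).
  exact: finite_measure_integrable_cst.
transitivity (\int[normal_prob 0 s]_t (1 + cos ((x - y) * t + 0)))%:E%R.
  rewrite RintegralD// Rintegral_cst// normal_prob0_cos// cos0 !mul1r.
  by rewrite [X in fine X](_ : _ = 1%E)//; exact: integral_normal_pdf.
rewrite /Rintegral fineK; last first.
  by apply: integrable_fin_num => //; exact: integrableD_EFin.
by apply: eq_integral => t _; do 3 f_equal; ring.
Qed.

Variables P Q : {finite_measure set (measurableTypeR R) -> \bar R}.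
Hypothesis PQ : forall t c : R,
  (\int[P]_x (1 + cos (t * x + c))%:E = \int[Q]_x (1 + cos (t * x + c))%:E)%E.

Let PQT : P setT = Q setT.
Proof.
have : ((1 + 1)%:E * P setT = (1 + 1)%:E * Q setT)%E.
  have := PQ 0 0.
  under eq_integral do rewrite mul0r add0r cos0.
  under [RHS]eq_integral do rewrite mul0r add0r cos0.
  by rewrite !integral_cst.
have : P setT \is a fin_num by exact: fin_num_measure.
have : Q setT \is a fin_num by exact: fin_num_measure.
case: (P setT) => // p; case: (Q setT) => // q _ _.
by rewrite -!EFinM => h; congr EFin; have := EFin_inj h; lra.
Qed.

(** Averaging the hypothesis over a normally distributed frequency turns cosines into a Gaussian
    bump centred at [y]. The constant 1 then contributes the total masses, which agree and are
    finite. *)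
Let PQ_gauss (s y : R) : 0 < s ->
  (\int[P]_x (expR (- (s ^+ 2 * (x - y) ^+ 2 / 2)))%:E =
   \int[Q]_x (expR (- (s ^+ 2 * (x - y) ^+ 2 / 2)))%:E)%E.
Proof.
move=> s0.
have me : measurable_fun setT (fun x : measurableTypeR R =>
    (expR (- (s ^+ 2 * (x - y) ^+ 2 / 2)))%:E).
  apply/measurable_EFinP/measurableT_comp => //; apply: measurable_funN.
  apply: measurable_funM => //; apply: measurable_funM => //.
  by apply: measurable_funX; exact: measurable_funB.
have split_ P' : (\int[P']_x (1 + expR (- (s ^+ 2 * (x - y) ^+ 2 / 2)))%:E =
    P' setT + \int[P']_x (expR (- (s ^+ 2 * (x - y) ^+ 2 / 2)))%:E)%E.
  under eq_integral do rewrite EFinD.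
  by rewrite ge0_integralD// integral_cst// mul1e.
have : (\int[P]_x (1 + expR (- (s ^+ 2 * (x - y) ^+ 2 / 2)))%:E =
   \int[Q]_x (1 + expR (- (s ^+ 2 * (x - y) ^+ 2 / 2)))%:E)%E.
  by rewrite !gauss_transform//; apply: eq_integral => t _; exact: PQ.
rewrite !split_ PQT ![(Q setT + _)%E]addeC => /(congr1 (fun z => z - Q setT)%E).
by rewrite !addeK ?fin_num_measure.
Qed.

(** The left side is the convolution of [P'] with the centred normal law of deviation [s]. Its
    density at [y] is a bump integral of frequency scale [s^-1], hence determined by the cosine
    integrals of [P']. *)
Let smoothE P' (s : R) (A : set R) : 0 < s -> measurable A ->
  (\int[P']_x (normal_prob x s A) =
   \int[mu]_(y in A) ((normal_peak s)%:E * \int[P']_x (expR (- (s^-1 ^+ 2 * (x - y) ^+ 2 / 2)))%:E))%E.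
Proof.
move=> s0 mA; have sn0 : s != 0 by rewrite gt_eqF.
have m1 : measurable_fun setT (fun z : measurableTypeR R * measurableTypeR R =>
   ((\1_A z.2)%:E * ((normal_peak s)%:E * (expR (- (s^-1 ^+ 2 * (z.1 - z.2) ^+ 2 / 2)))%:E))%E).
  apply: emeasurable_funM; last by apply: emeasurable_funM => //; exact: mexp.
  by apply/measurable_EFinP; apply: measurableT_comp => //; exact: measurable_indic.
have h0 (z : measurableTypeR R * measurableTypeR R) :
   (0 <= ((\1_A z.2)%:E * ((normal_peak s)%:E * (expR (- (s^-1 ^+ 2 * (z.1 - z.2) ^+ 2 / 2)))%:E)))%E.
  by rewrite !mule_ge0 ?lee_fin ?expR_ge0 ?normal_peak_ge0// indicE.
have := @fubini_tonelli _ _ _ _ _ P' mu _ m1 h0.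
rewrite /= => E.
transitivity (\int[P']_x (\int[mu]_y ((\1_A y)%:E * ((normal_peak s)%:E * (expR (- (s^-1 ^+ 2 * (x - y) ^+ 2 / 2)))%:E))))%E.
  apply: eq_integral => x _; rewrite /normal_prob integral_mkcond.
  apply: eq_integral => y _; rewrite patchE indicE; case: ifP => _; last by rewrite mul0e.
  rewrite mul1e (normal_pdfE _ sn0) /normal_fun -EFinM; congr (_ * expR _)%:E.
  by field.
rewrite E [RHS]integral_mkcond; apply: eq_integral => y _.
have my : measurable_fun setT (fun x : measurableTypeR R => (expR (- (s^-1 ^+ 2 * (x - y) ^+ 2 / 2)))%:E).
  apply/measurable_EFinP/measurableT_comp => //; apply: measurable_funN.
  apply: measurable_funM => //; apply: measurable_funM => //.
  by apply: measurable_funX; exact: measurable_funB.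
rewrite patchE indicE; case: ifP => _.
  under eq_integral do rewrite mul1e.
  by rewrite ge0_integralZl_EFin ?normal_peak_ge0.
by under eq_integral do rewrite mul0e; rewrite integral0.
Qed.

Let PQ_smooth (s : R) (A : set R) : 0 < s -> measurable A ->
  (\int[P]_x (normal_prob x s A) = \int[Q]_x (normal_prob x s A))%E.
Proof.
move=> s0 mA; rewrite !smoothE//; apply: eq_integral => y _.
by rewrite PQ_gauss// invr_gt0.
Qed.

Let measurable_normal_prob (s : R) (A : set R) : 0 < s -> measurable A ->
  measurable_fun setT (fun x : measurableTypeR R => normal_prob x s A).
Proof.
move=> s0 mA; have sn0 : s != 0 by rewrite gt_eqF.
have m1 : measurable_fun setT (fun z : measurableTypeR R * measurableTypeR R =>
   ((\1_A z.2)%:E * ((normal_peak s)%:E * (expR (- (s^-1 ^+ 2 * (z.1 - z.2) ^+ 2 / 2)))%:E))%E).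
  apply: emeasurable_funM; last by apply: emeasurable_funM => //; exact: mexp.
  by apply/measurable_EFinP; apply: measurableT_comp => //; exact: measurable_indic.
have h0 (z : measurableTypeR R * measurableTypeR R) :
   (0 <= ((\1_A z.2)%:E * ((normal_peak s)%:E * (expR (- (s^-1 ^+ 2 * (z.1 - z.2) ^+ 2 / 2)))%:E)))%E.
  by rewrite !mule_ge0 ?lee_fin ?expR_ge0 ?normal_peak_ge0// indicE.
have := @measurable_fun_fubini_tonelli_F _ _ _ _ _ mu _ m1 h0.
apply: eq_measurable_fun => x _ /=; symmetry.
rewrite /normal_prob integral_mkcond.
apply: eq_integral => y _; rewrite patchE indicE; case: ifP => _; last by rewrite mul0e.
rewrite mul1e (normal_pdfE _ sn0) /normal_fun -EFinM; congr (_ * expR _)%:E.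
by rewrite /=; field.
Qed.

Let normal_prob_tail (x s e : R) (B : set R) : 0 < s -> 0 < e -> measurable B ->
  (forall y, B y -> e <= `|y - x|) -> (normal_prob x s B <= (s ^+ 2 / e ^+ 2)%:E)%E.
Proof.
move=> s0 e0 mB Be.
rewrite (normal_prob_shift _ _ mB) ?gt_eqF//.
have ma : measurable_fun setT (fun z : measurableTypeR R => z : R) by [].
have mS : measurable [set z : measurableTypeR R | e <= `|z : R|].
  have := @measurable_fun_le _ _ _ setT (cst e) (fun z : measurableTypeR R => `|z : R|).
  by rewrite setTI; apply => //; exact: normr_measurable.
have mBx : measurable ((fun z : R => z + x) @^-1` B).
  rewrite -[X in measurable X]setTI.
  by have : measurable_fun setT (fun z : R => z + x); [exact: measurable_funD|apply].
apply: (@le_trans _ _ (normal_prob 0 s [set z | e <= `|z|])).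
  apply: le_measure; rewrite ?inE// => z /= /Be; by rewrite addrK.
have i2 : (normal_prob 0 s).-integrable setT (EFin \o (fun z : R => z ^+ 2)).
  apply: (@integrable_normal_prob0 _ s s0 _ 1) => // z.
  by rewrite mul1r ger0_norm ?sqr_ge0// sqr_le1DX4.
have := sqr_chebyshev (normal_prob 0 s) ma e0.
rewrite -(@fineK _ (\int[_]_x _)%E); last exact: integrable_fin_num.
rewrite [fine _](normal_prob0_moment2 s0) -lee_pdivlMl ?exprn_gt0//.
by rewrite -EFinM mulrC.
Qed.

Let h (n : nat) : R := n.+1%:R^-1.
Let h0 n : 0 < h n. Proof. by rewrite invr_gt0. Qed.

(** The ray is widened by [h n], while the standard deviation is only [h n ^+ 2]. By Chebyshev the
    mass lost is at most [h n ^+ 2], even at the end point [x = a]; the limit is the exact indicator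
    and atoms at [a] cause no trouble. *)
Let smooth_cvg (a x : R) :
  normal_prob x (h n ^+ 2) `]-oo, a + h n] @[n --> \oo] --> (\1_`]-oo, a] x)%:E.
Proof.
have hc : h n @[n --> \oo] --> (0 : R) by exact: cvg_harmonic.
have mA n : measurable (`]-oo, a + h n] : set R) by exact: measurable_itv.
have h20 n : 0 < h n ^+ 2 by rewrite exprn_gt0.
rewrite indicE; have [xa|xa] := boolP (x \in _).
  apply: (@squeeze_cvge _ _ _ _ (fun n => (1 - h n ^+ 2)%:E) _ (cst 1%E)); last 2 first.
  - rewrite -[X in _ --> X%:E](subr0 1) -[X in _ --> (_ - X)%:E](mulr0 0).
    apply/cvg_EFin; first exact: nearW.
    by apply: cvgB; [exact: cvg_cst|exact: cvgM].
  - exact: cvg_cst.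
  apply: nearW => n; rewrite probability_le1// andbT.
  rewrite -[X in normal_prob _ _ X]setCK probability_setC; last exact: measurableC.
  rewrite EFinB; apply: leeB => //.
  rewrite [X in (_ <= X%:E)%E](_ : _ = (h n ^+ 2) ^+ 2 / h n ^+ 2); last first.
    by field; rewrite gt_eqF.
  apply: (normal_prob_tail (h20 n) (h0 n) (measurableC (mA n))).
  move=> y /=; rewrite in_itv/= => /negP; rewrite -ltNge => hy.
  have {}hy : a + h n < y by [].
  have {}xa : x <= a by move: xa; rewrite inE/= in_itv/=.
  have d : h n <= y - x by lra.
  by rewrite ger0_norm//; apply: le_trans d; exact: ltW.
have ax : a < x.
  rewrite ltNge; apply: contraNN xa => h1.
  by rewrite inE/= in_itv/=.
apply: (@squeeze_cvge _ _ _ _ (cst 0%E) _ (fun n => (h n * (4 / (x - a) ^+ 2))%:E)); last 2 first.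
- exact: cvg_cst.
- apply/cvg_EFin; first exact: nearW.
  rewrite -[X in _ --> X](mul0r (4 / (x - a) ^+ 2)).
  by apply: cvgM => //; exact: cvg_cst.
have xa2 : 0 < (x - a) / 2 by lra.
near=> n; rewrite measure_ge0/=.
have hn : h n <= (x - a) / 2.
  by near: n; move/cvgr_le : hc; exact.
apply: le_trans (normal_prob_tail (h20 n) xa2 (mA n) _) _.
  move=> y /=; rewrite in_itv/= => yh; have {}yh : y <= a + h n by [].
  have d : (x - a) / 2 <= x - y by lra.
  by rewrite distrC ger0_norm//; apply: le_trans d; exact: ltW.
rewrite lee_fin; have h1 : h n <= 1 by rewrite invf_le1// ler1n.
rewrite [leLHS](_ : _ = h n ^+ 4 * (4 / (x - a) ^+ 2)); last first.
  by field; lra.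
rewrite ler_wpM2r ?divr_ge0 ?sqr_ge0//.
by rewrite -[leRHS]expr1 ler_wiXn2l// ltW.
Unshelve. all: by end_near. Qed.

Let PQ_ray (a : R) : P `]-oo, a]%classic = Q `]-oo, a]%classic.
Proof.
pose A n : set R := `]-oo, a + h n]%classic.
have lim_ (P' : {finite_measure set (measurableTypeR R) -> \bar R}) :
    (\int[P']_x normal_prob x (h n ^+ 2) (A n))%E @[n --> \oo] --> P' `]-oo, a]%classic.
  have h20 n : 0 < h n ^+ 2 by rewrite exprn_gt0.
  have mA n : measurable (A n) by exact: measurable_itv.
  have m1 n := measurable_normal_prob (h20 n) (mA n).
  have m2 : measurable_fun setT (EFin \o (\1_(`]-oo, a]%classic : set (measurableTypeR R)) : measurableTypeR R -> R)).
    by apply/measurable_EFinP; exact: measurable_indic.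
  have m3 : {ae P', forall x, setT x ->
      normal_prob x (h n ^+ 2) (A n) @[n --> \oo] --> (\1_(`]-oo, a]%classic : set (measurableTypeR R)) x)%:E}.
    by apply: aeW => x _; exact: smooth_cvg.
  have i1 : P'.-integrable setT (cst 1%E) by exact: finite_measure_integrable_cst.
  have bnd : {ae P', forall x n, setT x -> (`|normal_prob x (h n ^+ 2) (A n)| <= cst 1 x)%E}.
    apply: aeW => x n _; rewrite gee0_abs//=.
    exact: (probability_le1 (normal_prob x (h n ^+ 2)) (mA n)).
  have [_ _] := dominated_convergence measurableT m1 m2 m3 i1 bnd.
  by rewrite integral_indic// setIT.
apply: cvg_unique (lim_ P) _ => //.
have -> : (fun n => \int[P]_x normal_prob x (h n ^+ 2) (A n))%E =
  (fun n => \int[Q]_x normal_prob x (h n ^+ 2) (A n))%E.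
  by apply/funext => n; apply: PQ_smooth; [rewrite exprn_gt0|exact: measurable_itv].
exact: lim_.
Qed.

Lemma cf_unique A : measurable A -> P A = Q A.
Proof.
pose G := [set B : set R | exists x, B = `]-oo, x]%classic].
(* The Borel sets are generated by the open rays, and each of these is a countable union of closed
   rays. *)
have GE : (@measurable _ (measurableTypeR R)) = <<s G >>.
  rewrite [LHS]RGenInftyO.measurableE eqEsubset; split => B.
    apply: smallest_sub; first exact: smallest_sigma_algebra.
    move=> C [x ->]; have -> : `]-oo, x[%classic = \bigcup_n `]-oo, x - h n]%classic.
      apply/seteqP; split => y /=.
        rewrite in_itv/= => yx; have {}yx : y < x by [].
        have [n _ hn] : \forall n \near \oo, h n < x - y.
          have hc : h n @[n --> \oo] --> (0 : R) by exact: cvg_harmonic.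
          by move/cvgr_lt : hc; apply; rewrite subr_gt0.
        exists n => //=; rewrite in_itv/=.
        by suff : y <= x - h n by []; have : h n < x - y := hn n (leqnn _); lra.
      move=> [n _] /=; rewrite !in_itv/= => yx; have {}yx : y <= x - h n by [].
      by suff : y < x by []; have := h0 n; lra.
    apply: sigma_algebra_bigcup => n; apply: sub_sigma_algebra.
    by exists (x - h n).
  apply: smallest_sub; first exact: smallest_sigma_algebra.
  by move=> C [x ->]; exact: RGenInftyO.measurable_itv_bnd_infty.
move=> mA; apply: (@measure_unique _ _ (measurableTypeR R) G (fun n => `]-oo, n%:R]%classic) GE) => //.
- move=> _ _ [x ->] [y ->]; exists (Num.min x y).
  by apply/seteqP; split => z /=; rewrite !in_itv/= le_min => /andP.
- by move=> n; exists n%:R.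
- apply/seteqP; split => // x _; exists (Num.truncn `|x|).+1 => //=.
  by rewrite in_itv/= (le_trans (ler_norm _))// ltW// truncnS_gt.
- by move=> _ [x ->]; exact: PQ_ray.
- by move=> n; rewrite -ge0_fin_numE// fin_num_measure.
Qed.

End cf_unique.

(** * Gaussian spaces *)

Section gaussian_law0.
Context d (Omega : measurableType d) (R : realType) (P : probability Omega R).
Variables (X : Omega -> R) (s : R).
Hypothesis mX : measurable_fun setT X.
Hypothesis s0 : 0 <= s.
Hypothesis lawX : forall A : set R, measurable A -> P (X @^-1` A) = gaussian_law 0 s A.

(** Variance zero cannot be excluded, since the zero function belongs to every nonempty Gaussian
    space; each moment has a Dirac case. *)
Let s_cases : (s = 0 /\ forall A : set (measurableTypeR R), measurable A -> P (X @^-1` A) = \d_(0 : measurableTypeR R) A) \/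
   (0 < s /\ forall A : set (measurableTypeR R), measurable A -> P (X @^-1` A) = normal_prob 0 s A).
Proof.
move: lawX; rewrite /gaussian_law; have [->|sn0] := eqVneq s 0; first by left.
by right; split=> //; rewrite lt_neqAle eq_sym sn0.
Qed.

Let dirac_Rintegral (f : R -> R) : measurable_fun setT f ->
  (\int[\d_(0 : measurableTypeR R)]_x f x)%R = f 0.
Proof.
move=> mf; rewrite /Rintegral integral_dirac//; last exact/measurable_EFinP.
by rewrite diracE in_setT mul1e.
Qed.

Lemma gaussian_law0_integrable (f : R -> R) K : measurable_fun setT f ->
    (forall x, `|f x| <= K * (1 + x ^+ 4)) ->
  P.-integrable setT (EFin \o (fun w => f (X w))).
Proof.
move=> mf fK; have [[_ e]|[s0' e]] := s_cases.
  apply: (integrable_law (Q := \d_(0 : measurableTypeR R)) mX e mf).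
  apply/integrableP; split; first exact/measurable_EFinP.
  rewrite integral_dirac//; last first.
    by apply: measurableT_comp => //; exact/measurable_EFinP.
  by rewrite diracE in_setT mul1e ltry.
apply: (integrable_law (Q := normal_prob 0 s) mX e mf).
exact: integrable_normal_prob0 fK.
Qed.

Lemma gaussian_law0_moment2 : (\int[P]_w (X w ^+ 2))%R = s ^+ 2.
Proof.
have [[sE e]|[s0' e]] := s_cases.
  rewrite (@Rintegral_law _ _ _ _ _ P (\d_(0 : measurableTypeR R)) X mX e (fun x => x ^+ 2))//.
  by rewrite dirac_Rintegral// sE.
rewrite (@Rintegral_law _ _ _ _ _ P (normal_prob 0 s) X mX e (fun x => x ^+ 2))//.
exact: normal_prob0_moment2.
Qed.

Lemma gaussian_law0_moment4 : (\int[P]_w (X w ^+ 4))%R = 3 * s ^+ 4.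
Proof.
have [[sE e]|[s0' e]] := s_cases.
  rewrite (@Rintegral_law _ _ _ _ _ P (\d_(0 : measurableTypeR R)) X mX e (fun x => x ^+ 4))//.
  by rewrite dirac_Rintegral// sE expr0n/= mulr0.
rewrite (@Rintegral_law _ _ _ _ _ P (normal_prob 0 s) X mX e (fun x => x ^+ 4))//.
exact: normal_prob0_moment4.
Qed.

Lemma gaussian_law0_mean : (\int[P]_w X w)%R = 0.
Proof.
have [[sE e]|[s0' e]] := s_cases.
  by rewrite (@Rintegral_law _ _ _ _ _ P (\d_(0 : measurableTypeR R)) X mX e id)// dirac_Rintegral.
rewrite (@Rintegral_law _ _ _ _ _ P (normal_prob 0 s) X mX e id)//.
exact: normal_prob0_mean.
Qed.

(** Frequency 1 is enough: other frequencies come from scaling inside the Gaussian space. *)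
Lemma gaussian_law0_cos (c : R) :
  (\int[P]_w cos (X w + c))%R = cos c * expR (- (s ^+ 2 / 2)).
Proof.
have m2 : measurable_fun setT (fun x : R => cos (1 * x + c)) by exact: measurable_cos_affine.
transitivity (\int[P]_w cos (1 * X w + c))%R.
  by apply: eq_Rintegral => w _; rewrite mul1r.
have [[sE e]|[s0' e]] := s_cases.
  rewrite (@Rintegral_law _ _ _ _ _ P (\d_(0 : measurableTypeR R)) X mX e (fun x => cos (1 * x + c)))//.
  by rewrite dirac_Rintegral// sE expr0n/= mul0r oppr0 expR0 mulr1 mulr0 add0r.
rewrite (@Rintegral_law _ _ _ _ _ P (normal_prob 0 s) X mX e (fun x => cos (1 * x + c)))//.
by rewrite normal_prob0_cos// expr1n mulr1.
Qed.

End gaussian_law0.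

(** Joint Gaussianity is encoded by closure under linear combinations together with centred
    one-dimensional laws; no joint law is needed. *)
Definition gaussian_space d (Omega : measurableType d) (R : realType)
    (P : probability Omega R) (H : set (Omega -> R)) : Prop :=
  (forall (a b : R) f g, H f -> H g -> H (fun w => a * f w + b * g w)) /\
  (forall f, H f -> measurable_fun setT f /\ exists2 s, 0 <= s &
    forall A : set R, measurable A -> P (f @^-1` A) = gaussian_law 0 s A).

(* The elements of a Gaussian space are centred, whence no product of means. *)
Definition covar d (Omega : measurableType d) (R : realType)
  (P : probability Omega R) (f g : Omega -> R) : R := (\int[P]_w (f w * g w))%R.

Section gaussian_space.
Context d (Omega : measurableType d) (R : realType) (P : probability Omega R).
Variable H : set (Omega -> R).
Hypothesis gH : gaussian_space P H.
Local Notation cov := (covar P).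

Lemma gaussian_space_lin (a b : R) f g : H f -> H g -> H (fun w => a * f w + b * g w).
Proof. by case: gH => h _; exact: h. Qed.

Lemma gaussian_spaceZ (a : R) f : H f -> H (fun w => a * f w).
Proof.
move=> Hf; rewrite [X in H X](_ : _ = fun w => a * f w + 0 * f w).
  exact: gaussian_space_lin.
by apply/funext => w; rewrite mul0r addr0.
Qed.

Lemma gaussian_spaceD f g : H f -> H g -> H (fun w => f w + g w).
Proof.
move=> Hf Hg; rewrite [X in H X](_ : _ = fun w => 1 * f w + 1 * g w).
  exact: gaussian_space_lin.
by apply/funext => w; rewrite !mul1r.
Qed.

Lemma gaussian_space_measurable f : H f -> measurable_fun setT f.
Proof. by case: gH => _ h /h[]. Qed.

Lemma gaussian_space_integrable f (h : R -> R) K : H f -> measurable_fun setT h ->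
    (forall x, `|h x| <= K * (1 + x ^+ 4)) ->
  P.-integrable setT (EFin \o (fun w => h (f w))).
Proof.
case: gH => _ G Hf mh hK; have [mf [s s0 law]] := G f Hf.
exact: (gaussian_law0_integrable mf s0 law mh hK).
Qed.

Lemma gaussian_space_integrable4 f : H f -> P.-integrable setT (EFin \o (fun w => f w ^+ 4)).
Proof.
move=> Hf; apply: (gaussian_space_integrable (K := 1) (h := fun x => x ^+ 4)) => //.
by move=> x; rewrite mul1r ger0_norm ?lerDr// exprn_even_ge0.
Qed.

Lemma gaussian_space_integrable2 f : H f -> P.-integrable setT (EFin \o (fun w => f w ^+ 2)).
Proof.
move=> Hf; apply: (gaussian_space_integrable (K := 1) (h := fun x => x ^+ 2)) => //.
by move=> x; rewrite mul1r ger0_norm ?sqr_ge0// sqr_le1DX4.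
Qed.

Lemma gaussian_space_integrableM f g : H f -> H g ->
  P.-integrable setT (EFin \o (fun w => f w * g w)).
Proof.
move=> Hf Hg.
apply: (@le_integrable_EFin _ _ _ P setT measurableT _ (fun w => f w ^+ 2 + g w ^+ 2)) => //.
- by apply: measurable_funM; exact: gaussian_space_measurable.
- move=> w; have := sqr_ge0 (f w - g w); have := sqr_ge0 (f w + g w).
  have := sqr_ge0 (f w); have := sqr_ge0 (g w).
  by rewrite ler_norml => *; apply/andP; split; nra.
- by apply: integrableD_EFin => //; exact: gaussian_space_integrable2.
Qed.

Lemma gaussian_space_integrable22 f g : H f -> H g ->
  P.-integrable setT (EFin \o (fun w => f w ^+ 2 * g w ^+ 2)).
Proof.
move=> Hf Hg.
apply: (@le_integrable_EFin _ _ _ P setT measurableT _ (fun w => f w ^+ 4 + g w ^+ 4)) => //.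
- apply: measurable_funM; apply: measurable_funX; exact: gaussian_space_measurable.
- move=> w; rewrite ger0_norm; last by apply: mulr_ge0; exact: sqr_ge0.
  have := sqr_ge0 (f w ^+ 2 - g w ^+ 2).
  have := sqr_ge0 (f w ^+ 2); have := sqr_ge0 (g w ^+ 2); nra.
- by apply: integrableD_EFin => //; exact: gaussian_space_integrable4.
Qed.

Lemma covarC f g : cov f g = cov g f.
Proof. by apply: eq_Rintegral => w _; rewrite mulrC. Qed.

Lemma covar_ge0 f : 0 <= cov f f.
Proof. by apply: Rintegral_ge0 => w _; rewrite -expr2 sqr_ge0. Qed.

Lemma covar_linl (a b : R) f g h : H f -> H g -> H h ->
  cov (fun w => a * f w + b * g w) h = a * cov f h + b * cov g h.
Proof.
move=> Hf Hg Hh.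
have i1 := gaussian_space_integrableM Hf Hh.
have i2 := gaussian_space_integrableM Hg Hh.
rewrite /covar -!RintegralZl// -RintegralD//; try exact: integrableZl_EFin.
by apply: eq_Rintegral => w _; ring.
Qed.

Lemma covar_lin2 (a b : R) f g : H f -> H g ->
  cov (fun w => a * f w + b * g w) (fun w => a * f w + b * g w) =
  a ^+ 2 * cov f f + 2 * a * b * cov f g + b ^+ 2 * cov g g.
Proof.
move=> Hf Hg; have Hl := gaussian_space_lin a b Hf Hg.
rewrite covar_linl// !(covarC _ (fun w => _ + _)) !covar_linl// (covarC g f); ring.
Qed.

Lemma gaussian_space_cov f : H f -> exists2 s, 0 <= s & s ^+ 2 = cov f f /\
    forall A : set R, measurable A -> P (f @^-1` A) = gaussian_law 0 s A.
Proof.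
move=> Hf; case: gH => _ G; have [mf [s s0 law]] := G f Hf.
exists s => //; split => //; rewrite -(gaussian_law0_moment2 mf s0 law).
by apply: eq_Rintegral => w _; rewrite expr2.
Qed.

Lemma gaussian_space_law f v : H f -> 0 < v -> cov f f = v ^+ 2 ->
  forall A : set R, measurable A -> P (f @^-1` A) = normal_prob 0 v A.
Proof.
move=> Hf v0 fv; have [s s0 [sv law]] := gaussian_space_cov Hf.
have sE : s = v.
  by apply/eqP; rewrite -(@eqrXn2 _ 2)// ?ltW// sv fv.
by move=> A mA; rewrite law// /gaussian_law sE gt_eqF.
Qed.

Lemma gaussian_space_moment4 f : H f -> (\int[P]_w (f w ^+ 4))%R = 3 * cov f f ^+ 2.
Proof.
move=> Hf; have [s s0 [sv law]] := gaussian_space_cov Hf.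
rewrite (gaussian_law0_moment4 (gaussian_space_measurable Hf) s0 law) -sv.
by rewrite -exprM.
Qed.

Lemma gaussian_space_cos f (c : R) : H f ->
  (\int[P]_w cos (f w + c))%R = cos c * expR (- (cov f f / 2)).
Proof.
move=> Hf; have [s s0 [sv law]] := gaussian_space_cov Hf.
by rewrite (gaussian_law0_cos (gaussian_space_measurable Hf) s0 law) -sv.
Qed.

Lemma gaussian_space_moment22 f g : H f -> H g ->
  (\int[P]_w (f w ^+ 2 * g w ^+ 2))%R = cov f f * cov g g + 2 * cov f g ^+ 2.
Proof.
(* [12 f^2 g^2 = (f + g)^4 + (f - g)^4 - 2 (f^4 + g^4)] *)
move=> Hf Hg.
have Hp := gaussian_space_lin 1 1 Hf Hg.
have Hm := gaussian_space_lin 1 (-1) Hf Hg.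
have i4 := gaussian_space_integrable4.
have ip := i4 _ Hp; have im := i4 _ Hm; have jf := i4 _ Hf; have jg := i4 _ Hg.
transitivity (12^-1 * ((\int[P]_w ((1 * f w + 1 * g w) ^+ 4 + (1 * f w + -1 * g w) ^+ 4)) -
   2 * \int[P]_w (f w ^+ 4 + g w ^+ 4)))%R.
  have i1 := integrableD_EFin measurableT ip im.
  have i2 := integrableD_EFin measurableT jf jg.
  rewrite -(RintegralZl 2 measurableT i2) -RintegralB//; last exact: integrableZl_EFin.
  rewrite -RintegralZl//; last by apply: integrableB_EFin => //; exact: integrableZl_EFin.
  by apply: eq_Rintegral => w _; field.
rewrite !RintegralD// (gaussian_space_moment4 Hp) (gaussian_space_moment4 Hm).
rewrite (gaussian_space_moment4 Hf) (gaussian_space_moment4 Hg).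
by rewrite !covar_lin2//; field.
Qed.

End gaussian_space.

Lemma pushforward_measure_exists d d' (T : measurableType d) (S : measurableType d')
    (R : realType) (nu : {measure set T -> \bar R}) (f : T -> S) :
  measurable_fun setT f ->
  exists mu : {measure set S -> \bar R}, forall B, mu B = nu (f @^-1` B).
Proof.
move=> mf; pose mu := (pushforward nu f : {measure set S -> \bar R}).
by exists (mu mf).
Qed.

(** * Independence of uncorrelated elements of a Gaussian space *)

Section weighted_cf_unique.
Context d (Omega : measurableType d) (R : realType) (P : probability Omega R).

Lemma bounded_integrable (f : Omega -> R) K : measurable_fun setT f ->
  (forall w, `|f w| <= K) -> P.-integrable setT (EFin \o f).
Proof.
move=> mf fK; apply: (@le_integrable_EFin _ _ _ P setT measurableT _ (cst K)) => //.
exact: finite_measure_integrable_cst.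
Qed.

Variables (Y : Omega -> R).
Hypothesis mY : measurable_fun setT Y.

Lemma measurable_cos_comp (u c : R) : measurable_fun setT (fun w => cos (u * Y w + c)).
Proof. exact: (measurableT_comp (measurable_cos_affine u c) mY). Qed.

(* [1 + f] is nonnegative, so that the signed weight [f] is seen through a measure. *)
Lemma weighted_law_exists (f : Omega -> R) : measurable_fun setT f ->
    (forall w, `|f w| <= 1) ->
  exists mu : {finite_measure set (measurableTypeR R) -> \bar R},
    (forall B, measurable B -> mu B = (\int[P]_(w in Y @^-1` B) (1 + f w)%:E)%E) /\
    (forall h, measurable_fun setT h -> (forall x, 0 <= h x)%E ->
       \int[mu]_x h x = \int[P]_w (h (Y w) * (1 + f w)%:E))%E.
Proof.
move=> mf f1.
have f10 w : 0 <= 1 + f w by have := f1 w; rewrite ler_norml => /andP[? _]; lra.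
have mf1 : measurable_fun setT (fun w => 1 + f w) by exact: measurable_funD.
have [nu nuE] := density_measure_exists P mf1 f10.
have mY' : measurable_fun setT (Y : Omega -> measurableTypeR R) by exact: mY.
have mYB (B : set (measurableTypeR R)) : measurable B -> measurable (Y @^-1` B).
  by move=> mB; rewrite -[X in measurable X]setTI; exact: mY.
have [m' m'E] := pushforward_measure_exists nu mY'.
have fin_ : fin_num_fun m'.
  move=> B mB; rewrite m'E nuE; last exact: mYB.
  apply: integrable_fin_num; first exact: mYB.
  apply: (integrableS measurableT) => //; first exact: mYB.
  apply: (@bounded_integrable _ 2) => // w.
  by have := f1 w; rewrite !ler_norml => /andP[? ?]; apply/andP; split; lra.
have m'oo : (m' setT < +oo)%E by rewrite -ge0_fin_numE// fin_.
pose mu : {finite_measure set (measurableTypeR R) -> \bar R} := mfrestr measurableT m'oo.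
have muE B : mu B = nu (Y @^-1` B) by rewrite -m'E /mu /= /mfrestr /mrestr setIT.
exists mu; split=> [B mB|h mh h0].
  by rewrite muE nuE//; exact: mYB.
transitivity (\int[nu]_w h (Y w))%E.
  by symmetry; apply: (@ge0_integral_law _ _ _ _ _ nu mu Y) => // B mB; exact/esym/muE.
rewrite (ge0_integral_density mf1 f10 nuE)//.
exact: (measurableT_comp mh).
Qed.

(** The signed laws of [Y] with weights [f] and [g] are replaced by the finite measures with weights
    [1 + f] and [1 + g], to which [cf_unique] applies; the contribution of 1 is common to both and
    cancels. *)
Lemma weighted_cf_unique (f g : Omega -> R) :
    measurable_fun setT f -> measurable_fun setT g ->
    (forall w, `|f w| <= 1) -> (forall w, `|g w| <= 1) ->
    (forall u c, \int[P]_w (f w * cos (u * Y w + c)) = \int[P]_w (g w * cos (u * Y w + c)))%R ->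
  forall B : set R, measurable B ->
    (\int[P]_(w in Y @^-1` B) f w = \int[P]_(w in Y @^-1` B) g w)%R.
Proof.
move=> mf mg f1 g1 fg B mB.
have mYB : measurable (Y @^-1` B) by rewrite -[X in measurable X]setTI; exact: mY.
have [mu [muE muI]] := weighted_law_exists mf f1.
have [nu [nuE nuI]] := weighted_law_exists mg g1.
have if_ := bounded_integrable mf f1; have ig := bounded_integrable mg g1.
have icst (k : R) : P.-integrable setT (EFin \o cst k) by exact: finite_measure_integrable_cst.
have ic u c : P.-integrable setT (EFin \o (fun w => cos (u * Y w + c))).
  apply: (@bounded_integrable _ 1); first exact: measurable_cos_comp.
  by move=> w; exact: cos_max.
have ifc (h : Omega -> R) u c : measurable_fun setT h -> (forall w, `|h w| <= 1) ->
    P.-integrable setT (EFin \o (fun w => h w * cos (u * Y w + c))).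
  move=> mh h1; apply: (@bounded_integrable _ 1).
    by apply: measurable_funM => //; exact: measurable_cos_comp.
  by move=> w; rewrite normrM mulr_ile1// cos_max.
have expand (h : Omega -> R) u c : measurable_fun setT h -> (forall w, `|h w| <= 1) ->
    (\int[P]_w ((1 + cos (u * Y w + c))%:E * (1 + h w)%:E))%E =
    (1 + \int[P]_w h w + (\int[P]_w cos (u * Y w + c) + \int[P]_w (h w * cos (u * Y w + c))))%:E%R.
  move=> mh h1; have ih := bounded_integrable mh h1; have ihc := ifc h u c mh h1.
  have i1 := integrableD_EFin measurableT (icst 1) ih.
  have i2 := integrableD_EFin measurableT (ic u c) ihc.
  have PT : fine (P setT) = 1 by rewrite probability_setT.
  have c1 : (\int[P]_w cst 1 w)%R = 1 by rewrite Rintegral_cst// mul1r PT.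
  rewrite -[X in _ = (X + _ + _)%:E]c1 -!RintegralD// /Rintegral fineK; last first.
    by apply: integrable_fin_num => //; exact: integrableD_EFin.
  by apply: eq_integral => w _; rewrite -EFinM; congr EFin; rewrite /=; ring.
(* At [u = c = 0] the cosine is 1, so the total weights agree. *)
have int_eq0 : (\int[P]_w f w = \int[P]_w g w)%R.
  have := fg 0 0; under eq_Rintegral do rewrite mul0r add0r cos0 mulr1.
  by under [RHS]eq_Rintegral do rewrite mul0r add0r cos0 mulr1.
have : mu B = nu B.
  apply: cf_unique => // u c.
  have mh : measurable_fun setT (fun x : measurableTypeR R => (1 + cos (u * x + c))%:E).
    apply/measurable_EFinP/measurable_funD => //; exact: measurable_cos_affine.
  have h0 (x : measurableTypeR R) : (0 <= (1 + cos (u * x + c))%:E)%E.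
    by rewrite lee_fin -lerBlDl sub0r cos_geN1.
  rewrite muI// nuI// !expand//; congr (_%:E); congr (_ + _ + (_ + _)) => //.
rewrite muE// nuE// => e.
have sub_ (h : Omega -> R) : P.-integrable setT (EFin \o h) ->
    (\int[P]_(w in Y @^-1` B) h w = fine (\int[P]_(w in Y @^-1` B) (1 + h w)%:E) - \int[P]_(w in Y @^-1` B) 1)%R.
  move=> ih; rewrite -[fine _]/(\int[P]_(w in Y @^-1` B) (1 + h w))%R RintegralD//; last 2 first.
    by apply: (integrableS measurableT) => //; exact: icst.
    by apply: (integrableS measurableT).
  by rewrite addrC addKr.
by rewrite (sub_ f if_) (sub_ g ig) e.
Qed.

End weighted_cf_unique.

Section gaussian_independence.
Context d (Omega : measurableType d) (R : realType) (P : probability Omega R).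
Variables (H : set (Omega -> R)) (gH : gaussian_space P H).
Variables (Y : nat -> Omega -> R) (e : Omega -> R) (n : nat).
Hypothesis HY : forall k, (k < n)%N -> H (Y k).
Hypothesis He : H e.
Hypothesis eY : forall k, (k < n)%N -> covar P (Y k) e = 0.

(** The recursion on the number of constrained variables lets the independence proof insert a single
    event at each induction step. *)
Fixpoint cylinder (Y : nat -> Omega -> R) (m : nat) : set (set Omega) :=
  if m is m'.+1
  then [set A `&` Y m' @^-1` B | A in cylinder Y m' & B in (measurable : set (set R))]
  else [set setT].

Lemma cylinder_measurable m (A : set Omega) :
  (forall k, (k < m)%N -> measurable_fun setT (Y k)) -> cylinder Y m A -> measurable A.
Proof.
elim: m A => [|m IH] A mY /=; first by move->.
move=> [A' cA' [B mB <-]]; apply: measurableI.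
  by apply: IH => // k km; apply: mY; rewrite ltnW.
by rewrite -[X in measurable X]setTI; exact: mY.
Qed.

Lemma cylinder_setI m : setI_closed (cylinder Y m).
Proof.
elim: m => [|m IH] A A' /=; first by move=> -> ->; rewrite setTI.
move=> [C cC [B mB <-]] [C' cC' [B' mB' <-]].
exists (C `&` C'); first exact: IH.
by exists (B `&` B'); [exact: measurableI|rewrite preimage_setI setIACA].
Qed.

Lemma cylinder_setT m : cylinder Y m setT.
Proof.
elim: m => //= m IH; exists setT => //; exists setT => //.
by rewrite preimage_setT setTI.
Qed.

Let mH f : H f -> measurable_fun setT f.
Proof. exact: (gaussian_space_measurable gH). Qed.

(* Inserting one more event [Y m \in B] is tested against [cos (u * Y m + c')]; by
   product-to-sum this only shifts the element [U] of the Gaussian space. *)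
Let cos_decouple m (A : set Omega) : (m <= n)%N -> cylinder Y m A ->
  forall U (t c : R), H U -> covar P U e = 0 ->
  (\int[P]_(w in A) cos (U w + t * e w + c) =
   expR (- (t ^+ 2 * covar P e e / 2)) * \int[P]_(w in A) cos (U w + c))%R.
Proof.
elim: m A => [|m IH] A mn /=.
  move=> -> U t c HU Ue.
  have Hl := gaussian_space_lin gH 1 t HU He.
  have := gaussian_space_cos gH c Hl; rewrite (covar_lin2 gH)// Ue.
  under eq_Rintegral do rewrite mul1r.
  move=> ->; rewrite (gaussian_space_cos gH)// mulrCA -expRD.
  by congr (_ * expR _); ring.
move=> [A' cA' [B mB <-]] U t c HU Ue.
set K := expR _.
(* Keeps the weight [g] below bounded by 1, as [weighted_cf_unique] requires. *)
have K1 : K <= 1.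
  by rewrite /K expR_le1 oppr_le0 divr_ge0// mulr_ge0 ?sqr_ge0// covar_ge0.
have K0 : 0 <= K by exact: expR_ge0.
have mY : measurable_fun setT (Y m) by apply: mH; exact: HY.
have mA' : measurable A'.
  by apply: (@cylinder_measurable m) => // k km; apply: mH; apply: HY; exact: ltn_trans mn.
have mYB : measurable (Y m @^-1` B) by rewrite -[X in measurable X]setTI; exact: mY.
have mcos V (c' : R) : H V -> measurable_fun setT (fun w => cos (V w + c')).
  move=> HV; have := measurable_cos_comp (mH HV) 1 c'.
  by apply: eq_measurable_fun => w _; rewrite mul1r.
have HUe : H (fun w => U w + t * e w).
  by apply: (gaussian_spaceD gH) => //; exact: (gaussian_spaceZ gH).
have icos V (c' : R) : H V -> P.-integrable setT (EFin \o (fun w => cos (V w + c'))).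
  move=> HV; apply: (@bounded_integrable _ _ _ _ _ 1); first exact: mcos.
  by move=> w; exact: cos_max.
(* The two integrals to be compared are those of [f] and [g] over the event on [Y m]; it suffices
   that both weights have the same cosine integrals along [Y m]. *)
pose f w := \1_A' w * cos (U w + t * e w + c).
pose g w := K * (\1_A' w * cos (U w + c)).
have restr (h : Omega -> R) D : measurable D -> (\int[P]_(w in A' `&` D) h w =
    \int[P]_(w in D) (\1_A' w * h w))%R.
  move=> mD; rewrite setIC Rintegral_mkcondr; apply: eq_Rintegral => w _.
  by rewrite patchE indicE; case: ifP => _; rewrite (mul1r, mul0r).
rewrite !restr//.
have mf : measurable_fun setT f by apply: measurable_funM => //; exact: (mcos _ _ HUe).
have mg : measurable_fun setT g.
  by apply: measurable_funM => //; apply: measurable_funM => //; exact: mcos.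
have A1 w : `|(\1_A' w : R)| <= 1 by rewrite indicE; case: (_ \in _); rewrite ?normr1 ?normr0.
have f1 w : `|f w| <= 1 by rewrite normrM mulr_ile1// cos_max.
have g1 w : `|g w| <= 1.
  have h1 : `|\1_A' w * cos (U w + c)| <= 1 by rewrite normrM mulr_ile1// cos_max.
  by rewrite normrM ger0_norm//; exact: mulr_ile1.
have key u c' : (\int[P]_w (f w * cos (u * Y m w + c')) = \int[P]_w (g w * cos (u * Y m w + c')))%R.
  have HuY (v : R) : H (fun w => U w + v * Y m w).
    by apply: (gaussian_spaceD gH) => //; apply: (gaussian_spaceZ gH) => //; exact: HY.
  have euY (v : R) : covar P (fun w => U w + v * Y m w) e = 0.
    have := covar_linl gH 1 v HU (HY mn) He; rewrite Ue eY// !mulr0 addr0 => <-.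
    by apply: eq_Rintegral => w _; rewrite mul1r.
  have half (V : Omega -> R) (c1 : R) : H V ->
     (\int[P]_w ((\1_A' w * cos (V w + c1)) * cos (u * Y m w + c')) =
     2^-1 * (\int[P]_(w in A') cos (V w + u * Y m w + (c1 + c')) +
             \int[P]_(w in A') cos (V w + - u * Y m w + (c1 - c'))))%R.
    move=> HV.
    have i (v c2 : R) : P.-integrable setT (EFin \o (fun w => cos (V w + v * Y m w + c2))).
      apply: icos; apply: (gaussian_spaceD gH) => //; apply: (gaussian_spaceZ gH) => //; exact: HY.
    have j (v c2 : R) : P.-integrable A' (EFin \o (fun w => cos (V w + v * Y m w + c2))).
      by apply: (integrableS measurableT).
    rewrite -RintegralD// -RintegralZl//; last exact: integrableD_EFin.
    rewrite [RHS]Rintegral_mkcond; apply: eq_Rintegral => w _.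
    rewrite patchE indicE; case: ifP => _; last by rewrite !mul0r.
    rewrite mul1r.
    have -> : V w + u * Y m w + (c1 + c') = (V w + c1) + (u * Y m w + c') by ring.
    have -> : V w + - u * Y m w + (c1 - c') = (V w + c1) - (u * Y m w + c') by ring.
    by rewrite (cosB (V w + c1)) (cosD (V w + c1) (u * Y m w + c')); field.
  have -> : (\int[P]_w (g w * cos (u * Y m w + c')) =
     K * \int[P]_w ((\1_A' w * cos (U w + c)) * cos (u * Y m w + c')))%R.
    rewrite -RintegralZl//.
      by apply: eq_Rintegral => w _; rewrite /g; ring.
    apply: (@bounded_integrable _ _ _ _ _ 1).
      apply: measurable_funM; last exact: measurable_cos_comp.
      by apply: measurable_funM => //; exact: mcos.
    by move=> w; rewrite !normrM !mulr_ile1// ?mulr_ge0// cos_max.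
  rewrite (half _ _ HUe) (half _ _ HU).
  have swap v c2 : (\int[P]_(w in A') cos (U w + t * e w + v * Y m w + c2) =
      K * \int[P]_(w in A') cos (U w + v * Y m w + c2))%R.
    rewrite -(IH A' (ltnW mn) cA' (fun w => U w + v * Y m w) t c2 (HuY v) (euY v)).
    by apply: eq_Rintegral => w _; congr cos; ring.
  by rewrite !swap; ring.
rewrite (weighted_cf_unique mY mf mg f1 g1 key mB).
rewrite -RintegralZl//.
apply: (integrableS measurableT) => //.
apply: (@bounded_integrable _ _ _ _ _ 1); first by apply: measurable_funM => //; exact: mcos.
by move=> w; rewrite normrM mulr_ile1// cos_max.
Qed.

(** On the event [A], the cosines of [e] integrate as if [\1_A] were the constant [P A]. Uniqueness
    of characteristic functions turns this into the product formula. *)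
Lemma gaussian_independent (A : set Omega) (B : set R) : cylinder Y n A -> measurable B ->
  P (A `&` e @^-1` B) = (P A * P (e @^-1` B))%E.
Proof.
move=> cA mB.
have mA : measurable A.
  by apply: (@cylinder_measurable n) => // k kn; apply: mH; exact: HY.
have me := mH He.
have meB : measurable (e @^-1` B) by rewrite -[X in measurable X]setTI; exact: me.
have PA1 : `|fine (P A)| <= 1.
  by rewrite ger0_norm ?fine_ge0// -lee_fin fineK ?fin_num_measure// probability_le1.
have m1 : measurable_fun setT (\1_A : Omega -> R) by exact: measurable_indic.
have A1 w : `|(\1_A w : R)| <= 1 by rewrite indicE; case: (_ \in _); rewrite ?normr1 ?normr0.
(* The zero element of the space, taken as [U] in [cos_decouple]. *)
have H0 : H (fun w => 0 * e w) by exact: (gaussian_spaceZ gH).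
have key u c : (\int[P]_w (\1_A w * cos (u * e w + c)) =
    \int[P]_w (cst (fine (P A)) w * cos (u * e w + c)))%R.
  have ic : P.-integrable setT (EFin \o (fun w => cos (u * e w + c))).
    apply: (@bounded_integrable _ _ _ _ _ 1); first exact: measurable_cos_comp.
    by move=> w; exact: cos_max.
  transitivity (\int[P]_(w in A) cos (0 * e w + u * e w + c))%R.
    rewrite [RHS]Rintegral_mkcond; apply: eq_Rintegral => w _.
    rewrite patchE indicE; case: ifP => _; last by rewrite mul0r.
    by rewrite mul1r mul0r add0r.
  rewrite (cos_decouple (leqnn n) cA)//; last first.
    by rewrite /covar (@eq_Rintegral _ _ _ _ _ (cst 0)) ?Rintegral_cst ?mul0r// => w _; rewrite mul0r mul0r.
  rewrite (@eq_Rintegral _ _ _ _ _ (cst (cos c))); last by move=> w _; rewrite mul0r add0r.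
  rewrite Rintegral_cst// RintegralZl//.
  have Hue := gaussian_spaceZ gH u He.
  rewrite (gaussian_space_cos gH c Hue).
  have -> : covar P (fun w => u * e w) (fun w => u * e w) = u ^+ 2 * covar P e e.
    have i1 := gaussian_space_integrableM gH He He.
    rewrite /covar -RintegralZl//; by apply: eq_Rintegral => w _; ring.
  ring.
have := weighted_cf_unique me m1 _ A1 (fun=> PA1) key mB.
move/(_ (measurable_cst _)).
rewrite Rintegral_cst// /Rintegral integral_indic// => e1.
have mI : measurable (A `&` e @^-1` B) by exact: measurableI.
by rewrite -(fineK (fin_num_measure P _ mI)) e1 EFinM !fineK ?fin_num_measure.
Qed.

End gaussian_independence.

(** * Likelihood ratios *)

(** Innovations are centred, whereas a likelihood ratio compares two densities at the same point
    [y]; the shift by the conditional mean leads from one to the other. *)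
Lemma ge0_integral_normal_shift (R : realType) (m v : R) (h : R -> \bar R) : 0 < v ->
    measurable_fun setT h -> (forall y, 0 <= h y)%E ->
  (\int[normal_prob 0 v]_z h (z + m)%R =
   \int[@lebesgue_measure R]_y (h y * (normal_pdf m v y)%:E))%E.
Proof.
move=> v0 mh h0; have vn0 : v != 0 by rewrite gt_eqF.
have mg : measurable_fun setT (fun x : measurableTypeR R => (x + m : measurableTypeR R)).
  by apply: measurable_funD.
have mhm : measurable_fun setT (fun x : measurableTypeR R => h (x + m)%R).
  exact: (measurableT_comp mh mg).
rewrite (@ge0_integral_density _ _ _ (@lebesgue_measure R) (normal_prob 0 v) (normal_pdf 0 v))//.
- rewrite -(@ge0_integral_law _ _ _ _ _ (@lebesgue_measure R) (@lebesgue_measure R) _ mg _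
    (fun y => h y * (normal_pdf m v y)%:E)%E).
  + apply: eq_integral => x _; congr (_ * _%:E)%E.
    by rewrite !(normal_pdfE _ vn0) /normal_fun subr0 addrK.
  + by move=> A mA; exact: lebesgue_measure_shift.
  + apply: emeasurable_funM => //; apply/measurable_EFinP; exact: measurable_normal_pdf.
  + by move=> y; rewrite mule_ge0// lee_fin normal_pdf_ge0.
- exact: measurable_normal_pdf.
- by move=> x; exact: normal_pdf_ge0.
Qed.

(** The logarithm of the ratio of two normal densities, in terms of the residuals [e1] and [e2]
    because both conditional means depend on the past. *)
Definition gauss_llr (R : realType) (v1 v2 e1 e2 : R) : R :=
  ln v2 - ln v1 - e1 ^+ 2 / (v1 ^+ 2 *+ 2) + e2 ^+ 2 / (v2 ^+ 2 *+ 2).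

Lemma gauss_llrE (R : realType) (v1 v2 m1 m2 y : R) : 0 < v1 -> 0 < v2 ->
  expR (gauss_llr v1 v2 (y - m1) (y - m2)) * normal_pdf m2 v2 y = normal_pdf m1 v1 y.
Proof.
move=> v10 v20; have vn1 : v1 != 0 by rewrite gt_eqF.
have vn2 : v2 != 0 by rewrite gt_eqF.
have peak v : 0 < v -> normal_peak v = v^-1 * (Num.sqrt (pi *+ 2))^-1.
  move=> v0; rewrite /normal_peak -mulrnAr sqrtrM ?sqr_ge0// sqrtr_sqr gtr0_norm//.
  by rewrite invfM.
rewrite !(normal_pdfE _ vn1) !(normal_pdfE _ vn2) /normal_fun !peak//.
have s0 : Num.sqrt (pi *+ 2) != 0 :> R by rewrite gt_eqF// sqrtr_gt0 pmulrn_lgt0// pi_gt0.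
rewrite /gauss_llr !mulNr.
move: ((y - m1) ^+ 2 / _) ((y - m2) ^+ 2 / _) => E1 E2.
have -> : expR (ln v2 - ln v1 - E1 + E2) = v2 / v1 * expR (- E1) * expR E2.
  by rewrite !expRD (expRN (ln v1)) !lnK ?posrE.
have e2 := expRxMexpNx_1 E2.
rewrite [LHS](_ : _ = v1^-1 * (Num.sqrt (pi *+ 2))^-1 * expR (- E1) * (expR E2 * expR (- E2))).
  by rewrite e2 mulr1.
by field; rewrite s0 vn1 vn2.
Qed.

(** * Restriction to a sub-sigma-algebra and disintegration along an independent variable *)

Section sub_sigma_algebra.
Context d (Omega : measurableType d) (R : realType) (P : probability Omega R).
Variable G : set (set Omega).
Hypothesis mG : G `<=` measurable.
Local Notation T := (g_sigma_algebraType G).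

Lemma sub_sigma_measurable (A : set Omega) : <<s G >> A -> measurable A.
Proof. by move: A; apply: smallest_sub => //; exact: sigma_algebra_measurable. Qed.

Lemma measurable_sub_sigma d' (S : measurableType d') (f : Omega -> S) :
  measurable_fun [set: T] (f : T -> S) -> measurable_fun [set: Omega] f.
Proof.
move=> mf _ B mB; rewrite setTI.
apply: sub_sigma_measurable; have := mf measurableT B mB; by rewrite setTI.
Qed.

Let mid : measurable_fun [set: Omega] (id : Omega -> T).
Proof. by apply: measurable_sub_sigma. Qed.

(** Tonelli and the density lemmas have to be applied on [T], which carries the smaller
    sigma-algebra; this moves integrals of functions measurable there between [T] and [Omega]. *)
Lemma sub_sigma_measure_exists : exists Q : {finite_measure set T -> \bar R},
  (forall A : set Omega, Q A = P A) /\
  forall f : Omega -> \bar R, measurable_fun [set: T] (f : T -> \bar R) ->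
    (forall w, 0 <= f w)%E -> (\int[Q]_w f w = \int[P]_w f w)%E.
Proof.
have [m mE] := pushforward_measure_exists P mid.
have moo : (m setT < +oo)%E.
  by rewrite mE preimage_setT; apply: le_lt_trans (probability_le1 P measurableT) (ltry _).
(* Restricting to the whole space changes no value; it equips [m] with the structure of a finite
   measure. *)
pose Q : {finite_measure set T -> \bar R} := mfrestr measurableT moo.
have QE A : Q A = P A by rewrite /Q /= /mfrestr /mrestr setIT mE.
exists Q; split => // f mf f0.
by rewrite -(@ge0_integral_law _ _ _ _ _ P Q (id : Omega -> T) mid (fun A _ => esym (QE A)) f).
Qed.

Hypothesis GI : setI_closed G.
Hypothesis GT : G setT.
Variables (e : Omega -> R) (v : R).
Hypothesis me : measurable_fun setT e.
Hypothesis indep : forall A (B : set R), G A -> measurable B ->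
  P (A `&` e @^-1` B) = (P A * normal_prob 0 v B)%E.

(** For fixed [B] both sides are finite measures in [A] that agree on [G], which is closed under
    intersection. *)
Let indep_sigma A (B : set R) : <<s G >> A -> measurable B ->
  P (A `&` e @^-1` B) = (P A * normal_prob 0 v B)%E.
Proof.
move=> GA mB.
have meB : measurable (e @^-1` B) by rewrite -[X in measurable X]setTI; exact: me.
have fB : normal_prob 0 v B \is a fin_num by exact: fin_num_measure.
have p0 : 0 <= fine (normal_prob 0 v B) by exact: fine_ge0.
pose m1 := mrestr P meB; pose m2 := mscale (NngNum p0) P.
have m12 X : G X -> m1 X = m2 X.
  by move=> GX; rewrite /m1 /m2 /= /mrestr /mscale/= indep// fineK// muleC.
have := @g_sigma_algebra_measure_unique _ _ _ G mG (fun=> setT) (fun=> GT) _ m1 m2 GI m12 _ A GA.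
move=> E; suff : m1 A = m2 A by rewrite /m1 /m2 /= /mrestr /mscale /= fineK// muleC.
apply: E.
- by apply/seteqP; split => // x _; exists 0%N.
- move=> _; rewrite /m1 /= /mrestr setTI.
  exact: le_lt_trans (probability_le1 P meB) (ltry _).
Qed.

(** By independence, the outcome seen through [<<s G >>] and the variable [e] have a product law as
    a pair; Tonelli then integrates [e] out with the past held fixed. *)
Lemma ge0_integral_disintegration (f : Omega -> R -> \bar R) :
    measurable_fun [set: T * R] (fun z => f z.1 z.2) -> (forall w z, 0 <= f w z)%E ->
  measurable_fun [set: T] (fun w => \int[normal_prob 0 v]_z f w z)%E /\
  (\int[P]_w f w (e w) = \int[P]_w \int[normal_prob 0 v]_z f w z)%E.
Proof.
move=> mf f0; have [Q [QE QI]] := sub_sigma_measure_exists.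
have mF := @measurable_fun_fubini_tonelli_F _ _ T (measurableTypeR R) R (normal_prob 0 v) (fun z => f z.1 z.2) mf (fun z => f0 z.1 z.2).
split; first exact: mF.
have mpair : measurable_fun setT ((fun w => (w, e w)) : Omega -> T * measurableTypeR R).
  by apply: measurable_fun_pair.
have [M ME] := pushforward_measure_exists P mpair.
have law (X : set (T * measurableTypeR R)) : measurable X ->
    P ((fun w => (w, e w) : T * measurableTypeR R) @^-1` X) = (Q \x normal_prob 0 v)%E X.
  move=> mX; rewrite -ME -(@product_measure_unique _ _ _ _ _ Q (normal_prob 0 v) M)//.
  move=> A B mA mB; rewrite ME; transitivity (P A * normal_prob 0 v B)%E.
    by rewrite -indep_sigma.
  by congr (_ * _)%E; exact/esym/QE.
have := @ge0_integral_law _ _ _ _ _ P (Q \x normal_prob 0 v)%E _ mpair law _ mf (fun z => f0 z.1 z.2).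
move=> /= ->; rewrite fubini_tonelli1//=; apply: QI; first exact: mF.
by move=> w; apply: integral_ge0 => z _; exact: f0.
Qed.

End sub_sigma_algebra.

Section sub_sigma_density.
Context d (Omega : measurableType d) (R : realType) (P1 P2 : probability Omega R).
Variable G : set (set Omega).
Hypothesis mG : G `<=` measurable.
Local Notation T := (g_sigma_algebraType G).
Variable l : Omega -> R.
Hypothesis ml : measurable_fun [set: T] (l : T -> R).
Hypothesis P1l : forall A, <<s G >> A -> P1 A = (\int[P2]_(w in A) (expR (l w))%:E)%E.

Lemma ge0_integral_sub_sigma_density (g : Omega -> \bar R) : measurable_fun [set: T] (g : T -> \bar R) ->
  (forall w, 0 <= g w)%E -> (\int[P1]_w g w = \int[P2]_w (g w * (expR (l w))%:E))%E.
Proof.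
move=> mg g0.
have [Q1 [Q1E Q1I]] := sub_sigma_measure_exists P1 mG.
have [Q2 [Q2E Q2I]] := sub_sigma_measure_exists P2 mG.
have mel : measurable_fun [set: T] (fun w => expR (l w)) by exact: measurableT_comp.
rewrite -Q1I// (@ge0_integral_density _ T R Q2 Q1 (fun w => expR (l w)))//.
- rewrite Q2I//.
    by apply: emeasurable_funM => //; exact/measurable_EFinP.
  by move=> w; rewrite mule_ge0// lee_fin expR_ge0.
- move=> A mA; transitivity (P1 A); first exact: Q1E.
  rewrite P1l// [LHS]integral_mkcond [RHS]integral_mkcond Q2I//.
    by apply/(measurable_restrictT _ mA)/measurable_funTS/measurable_EFinP.
  by move=> w; rewrite patchE; case: ifP => // _; rewrite lee_fin expR_ge0.
Qed.

(* Markov's inequality for [l + expR (- l)], which is nonnegative, exceeds [m]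
   where [l] does, and has expectation at most [K + 1] under [P1]. *)
Lemma sub_sigma_density_le (K m : R) (A : set Omega) :
    P1.-integrable setT (EFin \o l) -> (\int[P1]_w l w <= K)%R -> 0 < m ->
    <<s G >> A ->
  (P1 A <= (expR m)%:E * P2 A + ((K + 1) / m)%:E)%E.
Proof.
move=> il lK m0 GA.
have mAO : measurable A by exact: (sub_sigma_measurable mG).
have mlO := measurable_sub_sigma mG ml.
have mel : measurable_fun [set: T] (fun w => expR (- l w)).
  by apply: measurableT_comp => //; exact: measurable_funN.
have melO := measurable_sub_sigma mG mel.
have E1 : (\int[P1]_w (expR (- l w))%:E = 1)%E.
  rewrite ge0_integral_sub_sigma_density.
  - under eq_integral do rewrite -EFinM mulrC expRxMexpNx_1.
    by rewrite integral_cst// mul1e; exact: probability_setT.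
  - exact/measurable_EFinP.
  - by move=> w; rewrite lee_fin expR_ge0.
have iel : P1.-integrable setT (EFin \o (fun w => expR (- l w))).
  apply/integrableP; split; first exact/measurable_EFinP.
  under eq_integral do rewrite /= ger0_norm ?expR_ge0//.
  by rewrite E1 ltry.
have E2 : (\int[P1]_w (\1_A w * expR (- l w))%:E = P2 A)%E.
  rewrite ge0_integral_sub_sigma_density.
  - under eq_integral do rewrite -EFinM -mulrA [expR _ * _]mulrC expRxMexpNx_1 mulr1.
    by rewrite integral_indic// setIT.
  - by apply/measurable_EFinP/measurable_funM => //; exact: measurable_indic.
  - by move=> w; rewrite lee_fin mulr_ge0 ?expR_ge0// indicE.
have lel0 w : 0 <= l w + expR (- l w).
  by have := expR_ge1Dx (- l w); lra.
have isum := integrableD_EFin measurableT il iel.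
have E3 : (\int[P1]_w ((l w + expR (- l w)) / m)%:E <= ((K + 1) / m)%:E)%E.
  have -> : (\int[P1]_w ((l w + expR (- l w)) / m)%:E =
      (\int[P1]_w ((l w + expR (- l w)) / m))%R%:E)%E.
    rewrite /Rintegral fineK//; apply: integrable_fin_num => //.
    apply: (eq_integrable measurableT _ _ _ (integrableZl_EFin measurableT m^-1 isum)) => w _ /=.
    by rewrite mulrC.
  rewrite lee_fin RintegralZr// ler_wpM2r ?invr_ge0 ?(ltW m0)//.
  by rewrite RintegralD// lerD// /Rintegral E1.
have m1 : measurable_fun setT (fun w => (expR m * (\1_A w * expR (- l w)))%:E).
  by apply/measurable_EFinP/measurable_funM => //; exact: measurable_funM.
have m2 : measurable_fun setT (fun w => ((l w + expR (- l w)) / m)%:E).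
  by apply/measurable_EFinP/measurable_funM => //; exact: measurable_funD.
have p1 w : (0 <= (expR m * (\1_A w * expR (- l w)))%:E)%E.
  by rewrite lee_fin !mulr_ge0 ?expR_ge0// indicE.
have p2 w : (0 <= ((l w + expR (- l w)) / m)%:E)%E.
  by rewrite lee_fin divr_ge0// ltW.
rewrite -[leLHS](_ : (\int[P1]_w (\1_A w)%:E)%E = _); last by rewrite integral_indic// setIT.
apply: (@le_trans _ _ (\int[P1]_w ((expR m * (\1_A w * expR (- l w)))%:E + ((l w + expR (- l w)) / m)%:E))%E).
  apply: ge0_le_integral => //.
  - exact/measurable_EFinP.
  - exact: emeasurable_funD.
  move=> w _; rewrite -EFinD lee_fin indicE; case: (w \in A) => /=; last first.
    by rewrite mul0r mulr0 add0r divr_ge0// ltW.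
  (* Where [l w <= m] the first term is already at least 1; elsewhere the Markov term is. *)
  rewrite mul1r -expRD; have [lm|lm] := leP (l w) m.
    apply: (@le_trans _ _ (expR (m + - l w))); first by rewrite -[leLHS]expR0 ler_expR; lra.
    by rewrite lerDl divr_ge0// ltW.
  apply: (@le_trans _ _ ((l w + expR (- l w)) / m)); last by rewrite lerDr expR_ge0.
  rewrite ler_pdivlMr// mul1r; have := expR_ge0 (- l w); lra.
rewrite ge0_integralD//; apply: leeD => //.
under eq_integral do rewrite EFinM.
rewrite ge0_integralZl_EFin ?expR_ge0//.
- by rewrite E2.
- by apply/measurable_EFinP; exact: measurable_funM.
Qed.

End sub_sigma_density.

Section likelihood_step.
Context d (Omega : measurableType d) (R : realType) (P1 P2 : probability Omega R).
Variable G : set (set Omega).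
Hypothesis mG : G `<=` measurable.
Hypothesis GI : setI_closed G.
Hypothesis GT : G setT.
Local Notation T := (g_sigma_algebraType G).
Variables (l m1 m2 Y : Omega -> R) (v1 v2 : R).
Hypothesis ml : measurable_fun [set: T] (l : T -> R).
Hypothesis mm1 : measurable_fun [set: T] (m1 : T -> R).
Hypothesis mm2 : measurable_fun [set: T] (m2 : T -> R).
Hypothesis mY : measurable_fun [set: Omega] Y.
Hypothesis v10 : 0 < v1.
Hypothesis v20 : 0 < v2.
Hypothesis indep1 : forall A (B : set R), G A -> measurable B ->
  P1 (A `&` (fun w => Y w - m1 w) @^-1` B) = (P1 A * normal_prob 0 v1 B)%E.
Hypothesis indep2 : forall A (B : set R), G A -> measurable B ->
  P2 (A `&` (fun w => Y w - m2 w) @^-1` B) = (P2 A * normal_prob 0 v2 B)%E.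
Hypothesis P1l : forall A, <<s G >> A -> P1 A = (\int[P2]_(w in A) (expR (l w))%:E)%E.

Let P1_density := @ge0_integral_sub_sigma_density _ _ _ P1 P2 _ mG l ml P1l.

(** Under each law the innovation is integrated out first. In the variable [y], the value of [Y],
    both inner integrals become Lebesgue integrals, and the factor [gauss_llr] converts the second
    density into the first. What remains concerns the past, where [l] is already the log-density. *)
Lemma likelihood_step A (B : set R) : G A -> measurable B ->
  P1 (A `&` Y @^-1` B) =
  (\int[P2]_(w in A `&` Y @^-1` B)
     (expR (l w + gauss_llr v1 v2 (Y w - m1 w) (Y w - m2 w)))%:E)%E.
Proof.
move=> GA mB.
have mA : measurable (A : set T) by exact: sub_sigma_algebra.
have mAO : measurable A by exact: mG.
have mYB : measurable (Y @^-1` B) by rewrite -[X in measurable X]setTI; exact: mY.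
have mAY : measurable (A `&` Y @^-1` B) by exact: measurableI.
have mm1O := measurable_sub_sigma mG mm1; have mm2O := measurable_sub_sigma mG mm2.
have me1 : measurable_fun setT (fun w => Y w - m1 w) by exact: measurable_funB.
have me2 : measurable_fun setT (fun w => Y w - m2 w) by exact: measurable_funB.
have m1A : measurable_fun [set: T * R] (fun z : T * R => \1_A z.1 : R).
  by apply: (measurableT_comp (f := \1_A : T -> R)) => //; exact: measurable_indic.
have mshift (m : Omega -> R) : measurable_fun [set: T] (m : T -> R) ->
    measurable_fun [set: T * R] (fun z : T * R => z.2 + m z.1).
  by move=> mm; apply: measurable_funD => //; exact: (measurableT_comp mm).
have m1B (m : Omega -> R) : measurable_fun [set: T] (m : T -> R) ->
    measurable_fun [set: T * R] (fun z : T * R => \1_B (z.2 + m z.1) : R).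
  move=> mm; apply: (measurableT_comp (f := \1_B : R -> R)); first exact: measurable_indic.
  exact: mshift.
(* Here [z] stands for the innovation, so that [z + m1 w] is the value of [Y]; likewise with [m2] in
   [f2]. *)
pose f1 (w : Omega) (z : R) : \bar R := (\1_A w * \1_B (z + m1 w))%:E.
have mf1 : measurable_fun [set: T * R] (fun z : T * R => f1 z.1 z.2).
  by apply/measurable_EFinP/measurable_funM => //; exact: m1B.
have f10 w z : (0 <= f1 w z)%E by rewrite lee_fin mulr_ge0.
pose f2 (w : Omega) (z : R) : \bar R := (\1_A w * expR (l w) * (\1_B (z + m2 w) *
  expR (gauss_llr v1 v2 (z + m2 w - m1 w) (z + m2 w - m2 w))))%:E.
have mf2 : measurable_fun [set: T * R] (fun z : T * R => f2 z.1 z.2).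
  apply/measurable_EFinP/measurable_funM.
    apply: measurable_funM => //.
    by apply: (measurableT_comp (f := fun w : T => expR (l w))) => //; exact: measurableT_comp.
  apply: measurable_funM; first exact: m1B.
  apply: measurableT_comp => //; rewrite /gauss_llr.
  apply: measurable_funD; first apply: measurable_funB => //.
    apply: measurable_funM => //; apply: measurable_funX; apply: measurable_funB.
      exact: mshift.
    exact: (measurableT_comp mm1).
  apply: measurable_funM => //; apply: measurable_funX; apply: measurable_funB.
    exact: mshift.
  exact: (measurableT_comp mm2).
have f20 w z : (0 <= f2 w z)%E by rewrite lee_fin !mulr_ge0// expR_ge0.
have [mF1 E1] := ge0_integral_disintegration mG GI GT me1 indep1 mf1 f10.
have [mF2 E2] := ge0_integral_disintegration mG GI GT me2 indep2 mf2 f20.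
transitivity (\int[P1]_w f1 w (Y w - m1 w)%R)%E.
  transitivity (\int[P1]_w (\1_(A `&` Y @^-1` B) w)%:E)%E.
    by rewrite integral_indic// setIT.
  apply: eq_integral => w _; rewrite /f1 subrK !indicE in_setI.
  by rewrite (_ : (w \in Y @^-1` B) = (Y w \in B)) -?mulnb ?natrM.
have F10 w : (0 <= \int[normal_prob 0 v1]_z f1 w z)%E.
  by apply: integral_ge0 => z _; exact: f10.
rewrite E1 (P1_density mF1 F10).
transitivity (\int[P2]_w f2 w (Y w - m2 w)%R)%E; last first.
  rewrite [RHS]integral_mkcond; apply: eq_integral => w _.
  rewrite patchE in_setI (_ : (w \in Y @^-1` B) = (Y w \in B))//.
  rewrite /f2 subrK !indicE; case: (w \in A) => /=; last by rewrite !mul0r.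
  case: (Y w \in B); last by rewrite mul0r mulr0.
  by rewrite !mul1r expRD.
rewrite E2; apply: eq_integral => w _.
have -> : (\int[normal_prob 0 v2]_z f2 w z =
   (\1_A w * expR (l w))%:E * \int[@lebesgue_measure R]_y (\1_B y * normal_pdf (m1 w) v1 y)%:E)%E.
  under eq_integral do rewrite /f2 EFinM.
  have mh : measurable_fun setT (fun y : R => (\1_B y * expR (gauss_llr v1 v2 (y - m1 w) (y - m2 w)))%:E).
    apply/measurable_EFinP/measurable_funM; first exact: measurable_indic.
    apply: measurableT_comp => //; rewrite /gauss_llr.
    apply: measurable_funD; first apply: measurable_funB => //.
      by apply: measurable_funM => //; apply: measurable_funX; apply: measurable_funB.
    by apply: measurable_funM => //; apply: measurable_funX; apply: measurable_funB.
  have h0 y : (0 <= (\1_B y * expR (gauss_llr v1 v2 (y - m1 w) (y - m2 w)))%:E)%E.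
    by rewrite lee_fin mulr_ge0// expR_ge0.
  have mz : measurable_fun setT (fun z : R => z + m2 w) by exact: measurable_funD.
  have mhz := measurableT_comp mh mz.
  rewrite ge0_integralZl_EFin ?mulr_ge0 ?expR_ge0//.
  congr (_ * _)%E; rewrite (ge0_integral_normal_shift (m2 w) v20 mh h0).
  by apply: eq_integral => y _; rewrite -EFinM -mulrA gauss_llrE.
have m1B' : measurable_fun setT (fun y : R => (\1_B y)%:E : \bar R).
  by apply/measurable_EFinP; exact: measurable_indic.
have -> : (\int[normal_prob 0 v1]_z f1 w z =
   (\1_A w)%:E * \int[@lebesgue_measure R]_y (\1_B y * normal_pdf (m1 w) v1 y)%:E)%E.
  under eq_integral do rewrite /f1 EFinM.
  have mz : measurable_fun setT (fun z : R => z + m1 w) by exact: measurable_funD.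
  have m1z := measurableT_comp m1B' mz.
  rewrite ge0_integralZl_EFin//.
  congr (_ * _)%E; rewrite (ge0_integral_normal_shift (m1 w) v10 m1B')//.
by rewrite EFinM muleAC.
Qed.

End likelihood_step.

Lemma sub_sigma_measurable_fun_le (Omega : pointedType) d' (S : measurableType d')
    (G G' : set (set Omega)) (f : Omega -> S) :
    <<s G >> `<=` <<s G' >> ->
  measurable_fun [set: g_sigma_algebraType G] (f : g_sigma_algebraType G -> S) ->
  measurable_fun [set: g_sigma_algebraType G'] (f : g_sigma_algebraType G' -> S).
Proof.
move=> GG' mf _ B mB; rewrite setTI; apply: GG'.
by have := mf measurableT B mB; rewrite setTI.
Qed.

Lemma cylinder_subset d (T : measurableType d) (R : realType) (Y : nat -> T -> R) m n :
  (m <= n)%N -> cylinder Y m `<=` cylinder Y n.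
Proof.
elim: n => [|n IH]; first by rewrite leqn0 => /eqP ->.
rewrite leq_eqVlt ltnS => /predU1P[->//|/IH mn] A /mn cA.
by exists A => //; exists setT => //; rewrite preimage_setT setIT.
Qed.

Lemma cylinder_measurable_fun d (T : measurableType d) (R : realType) (Y : nat -> T -> R) j n :
  (j < n)%N ->
  measurable_fun [set: g_sigma_algebraType (cylinder Y n)] (Y j : g_sigma_algebraType (cylinder Y n) -> R).
Proof.
move=> jn _ B mB; rewrite setTI; apply: sub_sigma_algebra.
apply: (cylinder_subset jn); exists setT; first exact: cylinder_setT.
by exists B => //; rewrite setTI.
Qed.

(** * Likelihood ratio along a chain of regressions *)

Section likelihood_chain.
Context d (Omega : measurableType d) (R : realType) (P1 P2 : probability Omega R).
Variables (H : set (Omega -> R)).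
Hypothesis gH1 : gaussian_space P1 H.
Hypothesis gH2 : gaussian_space P2 H.
Variables (Y X : nat -> Omega -> R) (a1 a2 v1 v2 : nat -> R) (N : nat).
Hypothesis HY : forall k, (k < N)%N -> H (Y k).
Hypothesis HX : forall k, (k < N)%N -> H (X k).
Hypothesis mX : forall k, (k < N)%N ->
  measurable_fun [set: g_sigma_algebraType (cylinder Y k)] (X k : g_sigma_algebraType (cylinder Y k) -> R).
Hypothesis v10 : forall k, (k < N)%N -> 0 < v1 k.
Hypothesis v20 : forall k, (k < N)%N -> 0 < v2 k.
Let e1 k w := Y k w - a1 k * X k w.
Let e2 k w := Y k w - a2 k * X k w.
Hypothesis ortho1 : forall k j, (k < N)%N -> (j < k)%N -> covar P1 (Y j) (e1 k) = 0.
Hypothesis ortho2 : forall k j, (k < N)%N -> (j < k)%N -> covar P2 (Y j) (e2 k) = 0.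
Hypothesis var1 : forall k, (k < N)%N -> covar P1 (e1 k) (e1 k) = v1 k ^+ 2.
Hypothesis var2 : forall k, (k < N)%N -> covar P2 (e2 k) (e2 k) = v2 k ^+ 2.

Let llr k w := gauss_llr (v1 k) (v2 k) (e1 k w) (e2 k w).
Let L n w := \sum_(0 <= k < n) llr k w.

Let cyl_sub n : <<s cylinder Y n >> `<=` <<s cylinder Y n.+1 >>.
Proof. by apply: sub_smallest2r; [exact: smallest_sigma_algebra|exact/cylinder_subset]. Qed.

Let mYn n : measurable_fun [set: g_sigma_algebraType (cylinder Y n.+1)]
  (Y n : g_sigma_algebraType (cylinder Y n.+1) -> R).
Proof. exact: cylinder_measurable_fun. Qed.

Let mcyl n : (n <= N)%N -> cylinder Y n `<=` measurable.
Proof.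
move=> nN A; apply: cylinder_measurable => k kn.
by apply: (gaussian_space_measurable gH1); apply: HY; exact: leq_trans nN.
Qed.

Let He a n : (n < N)%N -> H (fun w => Y n w - a * X n w).
Proof.
move=> nN; have := gaussian_space_lin gH1 1 (- a) (HY nN) (HX nN).
by congr H; apply/funext => w; rewrite mul1r mulNr.
Qed.

Let indep (P : probability Omega R) (gH : gaussian_space P H) a v n : (n < N)%N -> 0 < v ->
  (forall j, (j < n)%N -> covar P (Y j) (fun w => Y n w - a * X n w) = 0) ->
  covar P (fun w => Y n w - a * X n w) (fun w => Y n w - a * X n w) = v ^+ 2 ->
  forall A (B : set R), cylinder Y n A -> measurable B ->
  P (A `&` (fun w => Y n w - a * X n w) @^-1` B) = (P A * normal_prob 0 v B)%E.
Proof.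
move=> nN v0 ort var A B cA mB.
rewrite (gaussian_independent gH _ (He a nN) ort cA mB).
  by rewrite (gaussian_space_law gH (He a nN) v0 var).
by move=> k kn; apply: HY; exact: ltn_trans nN.
Qed.

(** Each [Y n] is regressed on one predictor [X n] measurable in the past, with a coefficient
    depending on the law. Orthogonality to the past makes the residual independent of it, so
    [likelihood_step] gives the density on the cylinders of length [n.+1], and uniqueness of
    measures extends it to what they generate. *)
Lemma likelihood_chain n : (n <= N)%N ->
  measurable_fun [set: g_sigma_algebraType (cylinder Y n)] (L n : g_sigma_algebraType (cylinder Y n) -> R) /\
  forall A, <<s cylinder Y n >> A -> P1 A = (\int[P2]_(w in A) (expR (L n w))%:E)%E.
Proof.
elim: n => [_|n IH nN].
  have L0 : L 0 = cst 0 by apply/funext => w; rewrite /L big_nil.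
  rewrite L0; split; first exact: measurable_cst.
  move=> A GA.
  have mA : measurable A by apply: (sub_sigma_measurable _ GA); exact: mcyl.
  rewrite (eq_integral (cst 1%E)); last by move=> w _; rewrite /= expR0.
  rewrite integral_cst// mul1e.
  apply: (@g_sigma_algebra_measure_unique _ _ _ (cylinder Y 0) _ (fun=> setT)) => //.
  - exact: mcyl.
  - by apply/seteqP; split => // x _; exists 0%N.
  - by move=> ? ? -> ->; rewrite setTI.
  - by move=> ? ->; rewrite [LHS]probability_setT [RHS]probability_setT.
  - by move=> _; exact: le_lt_trans (probability_le1 P1 measurableT) (ltry _).
have [mL PL] := IH (ltnW nN).
have mG := mcyl (ltnW nN).
have mXn := mX nN.
have mm1 : measurable_fun [set: g_sigma_algebraType (cylinder Y n)]
  ((fun w => a1 n * X n w) : g_sigma_algebraType (cylinder Y n) -> R) by exact: measurable_funM.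
have mm2 : measurable_fun [set: g_sigma_algebraType (cylinder Y n)]
  ((fun w => a2 n * X n w) : g_sigma_algebraType (cylinder Y n) -> R) by exact: measurable_funM.
have mYO := gaussian_space_measurable gH1 (HY nN).
have ind1 := indep gH1 nN (v10 nN) (fun j => ortho1 nN) (var1 nN).
have ind2 := indep gH2 nN (v20 nN) (fun j => ortho2 nN) (var2 nN).
have step := @likelihood_step _ _ _ P1 P2 (cylinder Y n) mG (@cylinder_setI _ _ _ Y n)
   (@cylinder_setT _ _ _ Y n) (L n) _ _ (Y n) _ _ mL mm1 mm2 mYO (v10 nN) (v20 nN) ind1 ind2 PL.
have LS w : L n.+1 w = L n w + llr n w by rewrite /L big_nat_recr.
have mLS : measurable_fun [set: g_sigma_algebraType (cylinder Y n.+1)]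
    (L n.+1 : g_sigma_algebraType (cylinder Y n.+1) -> R).
  rewrite (_ : L n.+1 = fun w => L n w + llr n w); last exact/funext.
  have mXS := sub_sigma_measurable_fun_le (@cyl_sub n) mXn.
  have mm (a : R) : measurable_fun [set: g_sigma_algebraType (cylinder Y n.+1)]
      ((fun w => Y n w - a * X n w) : g_sigma_algebraType (cylinder Y n.+1) -> R).
    by apply: measurable_funB => //; exact: measurable_funM.
  apply: measurable_funD; first exact: (sub_sigma_measurable_fun_le (@cyl_sub n) mL).
  rewrite /llr /gauss_llr.
  apply: measurable_funD; first apply: measurable_funB => //.
    by apply: measurable_funM => //; apply: measurable_funX; exact: mm.
  by apply: measurable_funM => //; apply: measurable_funX; exact: mm.
split => // A GA.
have mGS := mcyl nN.
have mLO := measurable_sub_sigma mGS mLS.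
have meO : measurable_fun setT (fun w => expR (L n.+1 w)) by exact: measurableT_comp.
(* The right-hand side as a measure, so that it can be compared with [P1] on cylinders. *)
have [nu nuE] := density_measure_exists P2 meO (fun w => expR_ge0 _).
have mA : measurable A by apply: (sub_sigma_measurable _ GA).
rewrite -nuE//.
apply: (@g_sigma_algebra_measure_unique _ _ _ (cylinder Y n.+1) _ (fun=> setT)) => //.
- by move=> _; exact: cylinder_setT.
- by apply/seteqP; split => // x _; exists 0%N.
- exact: cylinder_setI.
- move=> _ [C cC [B mB <-]]; apply: etrans (step C B cC mB) _; rewrite nuE.
    by apply: eq_integral => w _; rewrite LS.
  by apply: mGS; exists C => //; exists B.
- by move=> _; exact: le_lt_trans (probability_le1 P1 measurableT) (ltry _).
Qed.

Variable K : nat -> R.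
Hypothesis KL : forall k, (k < N)%N ->
  ln (v2 k) - ln (v1 k) - 2^-1 + covar P1 (e2 k) (e2 k) / (v2 k ^+ 2 *+ 2) <= K k.

(** The expectation under [P1] of the log-ratio is the left side of [KL]: there [2^-1] is the
    variance of [e1 k] divided by [2 * v1 k ^+ 2]. *)
Let llr_KL k : (k < N)%N -> P1.-integrable setT (EFin \o llr k) /\ (\int[P1]_w llr k w <= K k)%R.
Proof.
move=> kN; have ie1 := gaussian_space_integrable2 gH1 (He (a1 k) kN).
have ie2 := gaussian_space_integrable2 gH1 (He (a2 k) kN).
have ic : P1.-integrable setT (EFin \o cst (ln (v2 k) - ln (v1 k))) by exact: finite_measure_integrable_cst.
have je1 := integrableZl_EFin measurableT (v1 k ^+ 2 *+ 2)^-1 ie1.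
have je2 := integrableZl_EFin measurableT (v2 k ^+ 2 *+ 2)^-1 ie2.
have i12 := integrableB_EFin measurableT ic je1.
have i123 := integrableD_EFin measurableT i12 je2.
have llrE : llr k = fun w => cst (ln (v2 k) - ln (v1 k)) w - (v1 k ^+ 2 *+ 2)^-1 * (Y k w - a1 k * X k w) ^+ 2
    + (v2 k ^+ 2 *+ 2)^-1 * (Y k w - a2 k * X k w) ^+ 2.
  by apply/funext => w; rewrite /llr /gauss_llr /e1 /e2 /=; congr (_ - _ + _); rewrite mulrC.
rewrite llrE; split; first exact: i123.
rewrite RintegralD// RintegralB// !RintegralZl// Rintegral_cst//.
have -> : fine (P1 setT) = 1 by rewrite probability_setT.
apply: le_trans (KL kN); rewrite mulr1.
have c1 : (\int[P1]_w (Y k w - a1 k * X k w) ^+ 2)%R = v1 k ^+ 2.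
  by rewrite -var1//; apply: eq_Rintegral => w _; rewrite expr2.
have c2 : (\int[P1]_w (Y k w - a2 k * X k w) ^+ 2)%R = covar P1 (e2 k) (e2 k).
  by apply: eq_Rintegral => w _; rewrite expr2.
rewrite c1 c2 le_eqVlt; apply/orP; left; apply/eqP.
have vn : v1 k != 0 by rewrite gt_eqF// v10.
by congr (_ - _ + _); [field|rewrite mulrC].
Qed.

Lemma likelihood_chain_le (m : R) A : 0 < m -> <<s cylinder Y N >> A ->
  (P1 A <= (expR m)%:E * P2 A + ((\sum_(0 <= k < N) K k + 1) / m)%:E)%E.
Proof.
move=> m0 GA; have [mL PL] := likelihood_chain (leqnn N).
have LK n : (n <= N)%N -> P1.-integrable setT (EFin \o L n) /\
    (\int[P1]_w L n w <= \sum_(0 <= k < n) K k)%R.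
  elim: n => [_|n IH nN].
    have -> : L 0 = cst 0 by apply/funext => w; rewrite /L big_nil.
    by rewrite Rintegral_cst// mul0r big_nil; split => //; exact: integrable0.
  have [i1 h1] := IH (ltnW nN); have [i2 h2] := llr_KL nN.
  have -> : L n.+1 = fun w => L n w + llr n w.
    by apply/funext => w; rewrite /L big_nat_recr.
  split; first exact: integrableD_EFin.
  by rewrite RintegralD// big_nat_recr//= lerD.
have [iL LKN] := LK N (leqnn N).
exact: (sub_sigma_density_le (mcyl (leqnn N)) mL PL).
Qed.

End likelihood_chain.

(** * Approximation by an algebra *)

Section algebra_approximation.
Context d (Omega : measurableType d) (R : realType) (P1 P2 : probability Omega R).
Variable Alg : set (set Omega).
Hypothesis mAlg : Alg `<=` measurable.
Hypothesis Alg0 : Alg set0.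
Hypothesis AlgC : forall A, Alg A -> Alg (~` A).
Hypothesis AlgU : forall A B, Alg A -> Alg B -> Alg (A `|` B).

Let dist (P : probability Omega R) A B := (P (A `\` B) + P (B `\` A))%E.

(** A single event of the algebra must be close under both laws, because the bound to be transported
    compares [P1 B] with [P2 B] for the same [B]. *)
Let approx : set (set Omega) := [set A | measurable A /\ forall e : R, 0 < e ->
  exists B, [/\ Alg B, (dist P1 A B <= e%:E)%E & (dist P2 A B <= e%:E)%E]].

Let distU P A A' B B' : measurable A -> measurable A' -> measurable B -> measurable B' ->
  (dist P (A `|` A') (B `|` B') <= dist P A B + dist P A' B')%E.
Proof.
move=> mA mA' mB mB'; rewrite /dist addeACA; apply: leeD.
  apply: le_trans (measureU2 P (measurableD mA mB) (measurableD mA' mB')).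
  apply: le_measure; rewrite ?inE; [|by apply: measurableU; exact: measurableD|].
    by apply: measurableD; exact: measurableU.
  by move=> x [[Ax|A'x] /not_orP[nB nB']]; [left|right].
apply: le_trans (measureU2 P (measurableD mB mA) (measurableD mB' mA')).
apply: le_measure; rewrite ?inE; [|by apply: measurableU; exact: measurableD|].
  by apply: measurableD; exact: measurableU.
by move=> x [[Bx|B'x] /not_orP[nA nA']]; [left|right].
Qed.

Let approxU A A' : approx A -> approx A' -> approx (A `|` A').
Proof.
move=> [mA aA] [mA' aA']; split; first exact: measurableU.
move=> e e0; have e20 : 0 < e / 2 by rewrite divr_gt0.
have [B [AB d1 d2]] := aA _ e20; have [B' [AB' d1' d2']] := aA' _ e20.
have mB := mAlg AB; have mB' := mAlg AB'.
exists (B `|` B'); split; first exact: AlgU.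
  apply: le_trans (distU _ _ _ _ _) _ => //.
  by rewrite [e]splitr EFinD; exact: leeD.
apply: le_trans (distU _ _ _ _ _) _ => //.
by rewrite [e]splitr EFinD; exact: leeD.
Qed.

Let approx_sub : Alg `<=` approx.
Proof.
move=> A AA; split; first exact: mAlg.
move=> e e0; exists A; split => //.
  by rewrite /dist setDv !measure0 adde0 lee_fin ltW.
by rewrite /dist setDv !measure0 adde0 lee_fin ltW.
Qed.

Let approx_sigma : sigma_algebra setT approx.
Proof.
split.
- exact: approx_sub.
- move=> A [mA aA]; rewrite setTD; split; first exact: measurableC.
  move=> e e0; have [B [AB d1 d2]] := aA e e0.
  exists (~` B); split; first exact: AlgC.
    by rewrite /dist !setDE !setCK setIC addeC [X in (P1 X + _)%E]setIC -!setDE.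
  by rewrite /dist !setDE !setCK setIC addeC [X in (P2 X + _)%E]setIC -!setDE.
- move=> F aF; have mF n : measurable (F n) by have [] := aF n.
  have mU : measurable (\bigcup_n F n) by exact: bigcupT_measurable.
  (* Half of [e] pays for truncating the union at a rank that suits both laws, the other half for
     approximating the finite union. *)
  split => // e e0; have e20 : 0 < e / 2 by rewrite divr_gt0.
  pose FN N := \big[setU/set0]_(i < N) F i.
  have aFN N : approx (FN N).
    elim: N => [|N IH]; first by rewrite /FN big_ord0; exact: approx_sub.
    by rewrite /FN big_ord_recr/=; apply: approxU.
  have mFN N : measurable (FN N) by have [] := aFN N.
  have FNU N : FN N `<=` \bigcup_n F n.
    by rewrite /FN -bigcup_mkord => x [i _ Fi]; exists i.
  have cvgP (P : probability Omega R) : \forall N \near \oo, (P (\bigcup_n F n `\` FN N) <= (e / 2)%:E)%E.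
    have cv : P (\bigcup_n F n `\` FN N) @[N --> \oo] --> 0%E.
      have := @nonincreasing_cvg_mu _ _ _ P (fun N => \bigcup_n F n `\` FN N).
      have -> : \bigcap_N (\bigcup_n F n `\` FN N) = set0.
        apply/seteqP; split => // x capx.
        have [n _ Fnx] := (capx 0%N I).1.
        by have [_] := capx n.+1 I; apply; rewrite /FN -bigcup_mkord; exists n => /=.
      rewrite measure0; apply => //.
      + by rewrite (le_lt_trans (probability_le1 P _))// ?ltry//; exact: measurableD.
      + by move=> N; exact: measurableD.
      + move=> n m nm; apply/subsetPset; apply: setDS.
        rewrite /FN -!bigcup_mkord; apply: bigcup_subset => i /=.
        by move/leq_trans; apply.
    have /fine_cvgP[fc] := cv.
    move=> /cvgrPdist_le/(_ _ e20) near1.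
    near=> N.
    have fN : P (\bigcup_n F n `\` FN N) \is a fin_num by near: N.
    rewrite -(fineK fN) lee_fin.
    have : `|0 - (fine \o (fun N => P (\bigcup_n F n `\` FN N))) N| <= e / 2 by near: N.
    by rewrite sub0r normrN ger0_norm// fine_ge0.
  have [N [h1 h2]] : exists N, (P1 (\bigcup_n F n `\` FN N) <= (e / 2)%:E)%E /\
      (P2 (\bigcup_n F n `\` FN N) <= (e / 2)%:E)%E.
    have [N1 _ k1] := cvgP P1; have [N2 _ k2] := cvgP P2.
    by exists (maxn N1 N2); split; [apply: k1|apply: k2]; rewrite /= (leq_maxl, leq_maxr).
  have [_ /(_ _ e20)[B [AB d1 d2]]] := aFN N.
  have mB := mAlg AB.
  have le_ (P : probability Omega R) : (P (\bigcup_n F n `\` FN N) <= (e / 2)%:E)%E ->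
      (dist P (FN N) B <= (e / 2)%:E)%E -> (dist P (\bigcup_n F n) B <= e%:E)%E.
    move=> p1 p2; rewrite [e]splitr EFinD; apply: le_trans (leeD p1 p2).
    rewrite /dist addeA; apply: leeD.
      apply: le_trans (measureU2 P (measurableD mU (mFN N)) (measurableD (mFN N) mB)).
      apply: le_measure; rewrite ?inE; [exact: measurableD| |].
        by apply: measurableU; exact: measurableD.
      move=> x [Fx nBx]; have [Nx|nNx] := pselect (FN N x); first by right.
      by left.
    apply: le_measure; rewrite ?inE; [exact: measurableD|exact: measurableD|].
    by apply: setDS; exact: FNU.
  by exists B; split => //; exact: le_.
Unshelve. all: by end_near. Qed.

Lemma null_of_algebra_bound (C : R) :
    (forall m A, 0 < m -> Alg A -> (P1 A <= (expR m)%:E * P2 A + (C / m)%:E)%E) ->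
  forall A, <<s Alg >> A -> P2 A = 0%E -> P1 A = 0%E.
Proof.
move=> bound A GA P2A.
have [mA aA] : approx A by move: A GA {P2A}; apply: smallest_sub.
apply/eqP; rewrite eq_le measure_ge0 andbT; apply/lee_addgt0Pr => h h0.
rewrite add0e.
(* First [m] is chosen so that [C / m <= h / 2], with [|C| + 1] keeping it positive; then [e], which
   depends on [m], so that [(expR m + 1) * e = h / 2]. *)
pose m := 2 * (`|C| + 1) / h.
have m0 : 0 < m by rewrite /m divr_gt0// mulr_gt0// ltr_wpDl.
pose e := h / 2 / (expR m + 1).
have e0 : 0 < e by rewrite /e !divr_gt0.
have [B [AB d1 d2]] := aA e e0.
have mB := mAlg AB.
have le_ (P : probability Omega R) X Y : measurable X -> measurable Y ->
    (P X <= P Y + P (X `\` Y))%E.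
  move=> mX mY; apply: le_trans (measureU2 P mY (measurableD mX mY)).
  apply: le_measure; rewrite ?inE//; first by apply: measurableU => //; exact: measurableD.
  by move=> x Xx; have [Yx|nYx] := pselect (Y x); [left|right].
have P2B : (P2 B <= e%:E)%E.
  apply: le_trans d2; apply: le_trans (le_ P2 B A mB mA) _.
  by rewrite P2A add0e /dist; apply: leeDr; exact: measure_ge0.
apply: le_trans (le_ P1 A B mA mB) _.
have P1AB : (P1 (A `\` B) <= e%:E)%E by apply: le_trans d1; rewrite /dist; apply: leeDl; exact: measure_ge0.
apply: (@le_trans _ _ ((expR m)%:E * e%:E + (C / m)%:E + e%:E)%E).
  apply: leeD => //; apply: le_trans (bound m B m0 AB) _.
  by rewrite leeD2r// lee_pmul2l ?lte_fin ?expR_gt0.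
rewrite -EFinM -!EFinD lee_fin.
have -> : expR m * e + C / m + e = h / 2 + C / m.
  have <- : (expR m + 1) * e = h / 2 by rewrite /e mulrC divfK ?gt_eqF.
  ring.
have : C / m <= h / 2.
  rewrite ler_pdivrMr// (_ : h / 2 * m = `|C| + 1); last by rewrite /m; field; rewrite gt_eqF.
  by rewrite (le_trans (ler_norm C))// lerDl.
lra.
Qed.

End algebra_approximation.

(** * Quadratic variation *)

(** Borel-Cantelli is used twice: a point outside the upper limit of [F] lies in all but finitely
    many complements, hence in their upper limit. *)
Lemma lim_sup_orthogonal d (Omega : measurableType d) (R : realType)
    (P1 P2 : probability Omega R) (F : (set Omega)^nat) (C : R) : 0 <= C ->
    (forall n, measurable (F n)) ->
    (forall n, P1 (F n) <= (C / (2 ^ n.+1)%:R)%:E)%E ->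
    (forall n, P2 (~` F n) <= (C / (2 ^ n.+1)%:R)%:E)%E ->
  P1 (lim_sup_set F) = 0%E /\ P2 (~` lim_sup_set F) = 0%E.
Proof.
move=> C0 mF F1 F2.
have BC (P : probability Omega R) (E : (set Omega)^nat) : (forall n, measurable (E n)) ->
    (forall n, P (E n) <= (C / (2 ^ n.+1)%:R)%:E)%E -> P (lim_sup_set E) = 0%E.
  move=> mE PE; apply: lim_sup_set_cvg0 => //.
  apply: (@le_lt_trans _ _ (\sum_(n <oo) (C / (2 ^ n.+1)%:R)%:E)%E).
    by apply: lee_nneseries => [i _ _|i _]; [exact: measure_ge0|exact: PE].
  exact: le_lt_trans (epsilon_trick0 xpredT C0) (ltry _).
split; first exact: BC.
have mFC n : measurable (~` F n) by exact: measurableC.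
have mlim (E : (set Omega)^nat) : (forall n, measurable (E n)) -> measurable (lim_sup_set E).
  move=> mE; apply: bigcapT_measurable => k; exact: bigcup_measurable.
apply/eqP; rewrite eq_le measure_ge0 andbT -(BC P2 _ mFC F2).
apply: le_measure; rewrite ?inE; [exact/measurableC/mlim|exact: mlim|].
move=> x nx n _; apply: contrapT => h; apply: nx => k _.
exists (maxn n k); first by rewrite /= leq_maxr.
by apply: contrapT => nF; apply: h; exists (maxn n k) => //=; rewrite leq_maxl.
Qed.

Section quadratic_variation.
Context d (Omega : measurableType d) (R : realType) (P : probability Omega R).
Variables (H : set (Omega -> R)) (gH : gaussian_space P H).

(** Squared bias plus variance: by [gaussian_space_moment22], the covariance of two squares is twice
    the squared covariance. *)
Lemma gaussian_sum_sqr_deviation (D : nat -> Omega -> R) (q : R) n :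
    (forall k, H (D k)) ->
  P.-integrable setT (EFin \o (fun w => (\sum_(0 <= k < n) D k w ^+ 2 - q) ^+ 2)) /\
  (\int[P]_w (\sum_(0 <= k < n) D k w ^+ 2 - q) ^+ 2)%R =
  (\sum_(0 <= k < n) covar P (D k) (D k) - q) ^+ 2 +
  2 * \sum_(0 <= k < n) \sum_(0 <= l < n) covar P (D k) (D l) ^+ 2.
Proof.
move=> HD.
have i22 k l := gaussian_space_integrable22 gH (HD k) (HD l).
have i2 k := gaussian_space_integrable2 gH (HD k).
have iS k : P.-integrable setT (EFin \o (fun w => \sum_(0 <= l < n) D k w ^+ 2 * D l w ^+ 2)).
  by apply: integrable_sum_EFin => // l; exact: i22.
have iSS : P.-integrable setT (EFin \o (fun w => \sum_(0 <= k < n) \sum_(0 <= l < n) D k w ^+ 2 * D l w ^+ 2)).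
  by apply: integrable_sum_EFin => // k; exact: iS.
have iS2 : P.-integrable setT (EFin \o (fun w => \sum_(0 <= k < n) D k w ^+ 2)).
  by apply: integrable_sum_EFin => // k; exact: i2.
have iZ := integrableZl_EFin measurableT (2 * q) iS2.
have ic : P.-integrable setT (EFin \o cst (q ^+ 2)) by exact: finite_measure_integrable_cst.
have E : (fun w => (\sum_(0 <= k < n) D k w ^+ 2 - q) ^+ 2) =
   (fun w => (\sum_(0 <= k < n) \sum_(0 <= l < n) D k w ^+ 2 * D l w ^+ 2) -
      2 * q * (\sum_(0 <= k < n) D k w ^+ 2) + cst (q ^+ 2) w).
  apply/funext => w.
  have -> : \sum_(0 <= k < n) \sum_(0 <= l < n) D k w ^+ 2 * D l w ^+ 2 = (\sum_(0 <= k < n) D k w ^+ 2) ^+ 2.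
    by rewrite expr2 mulr_suml; apply: eq_bigr => k _; rewrite mulr_sumr.
  by rewrite /=; ring.
rewrite E; have iB := integrableB_EFin measurableT iSS iZ.
split; first exact: integrableD_EFin.
rewrite RintegralD// RintegralB// RintegralZl// Rintegral_cst//.
have -> : fine (P setT) = 1 by rewrite probability_setT.
rewrite !Rintegral_sum//.
have e2 k : (\int[P]_w (D k w ^+ 2))%R = covar P (D k) (D k).
  by apply: eq_Rintegral => w _; rewrite expr2.
have -> : \sum_(0 <= k < n) (\int[P]_w (D k w ^+ 2))%R = \sum_(0 <= k < n) covar P (D k) (D k).
  by apply: eq_bigr.
have -> : \sum_(0 <= k < n) (\int[P]_w (\sum_(0 <= l < n) D k w ^+ 2 * D l w ^+ 2))%R =
    (\sum_(0 <= k < n) covar P (D k) (D k)) ^+ 2 +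
    2 * \sum_(0 <= k < n) \sum_(0 <= l < n) covar P (D k) (D l) ^+ 2.
  rewrite expr2 mulr_suml mulr_sumr -big_split/=; apply: eq_bigr => k _.
  rewrite Rintegral_sum//.
  rewrite mulr_sumr mulr_sumr -big_split/=; apply: eq_bigr => l _.
  exact: (gaussian_space_moment22 gH).
by ring.
Qed.

Variables (x : R -> Omega -> R) (c th : R).
Hypothesis Hx : forall s, H (x s).
Hypothesis c0 : 0 <= c.
Hypothesis th0 : 0 < th.
Hypothesis xcov : forall s t, 0 <= s <= 1 -> 0 <= t <= 1 ->
  covar P (x s) (x t) = c * expR (- th * `|s - t|).

Definition quad_var (y : R -> Omega -> R) n w : R :=
  \sum_(0 <= k < n) (y (k.+1%:R / n%:R) w - y (k%:R / n%:R) w) ^+ 2.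

(** With [v = expR (- th / n)] and [u] the decay factor over the gap between the two intervals, the
    covariance is exactly [- c * u * (1 - v) ^+ 2], which is O(1/n^2). *)
Let incr_cov n k l : (k < n)%N -> (l < n)%N -> (k < l)%N ->
  `|covar P (fun w => x (k.+1%:R / n%:R) w - x (k%:R / n%:R) w)
            (fun w => x (l.+1%:R / n%:R) w - x (l%:R / n%:R) w)| <= c * th ^+ 2 / n%:R ^+ 2.
Proof.
move=> kn ln kl.
have n0 : (0 : R) < n%:R by rewrite ltr0n (leq_ltn_trans _ kn).
have i01 (i : nat) : (i <= n)%N -> 0 <= (i%:R / n%:R : R) <= 1.
  by move=> iN; apply/andP; split; [exact: divr_ge0|rewrite ler_pdivrMr// mul1r ler_nat].
have sub_ (y z g : Omega -> R) : H y -> H z -> H g ->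
   covar P (fun w => y w - z w) g = covar P y g - covar P z g.
  move=> Hy Hz Hg; have := covar_linl gH 1 (-1) Hy Hz Hg.
  rewrite mul1r mulN1r => <-; congr (covar P _ g).
  by apply/funext => w; rewrite mul1r mulN1r.
have Hd i : H (fun w => x (i.+1%:R / n%:R) w - x (i%:R / n%:R) w).
  have := gaussian_space_lin gH 1 (-1) (Hx (i.+1%:R / n%:R)) (Hx (i%:R / n%:R)).
  by congr H; apply/funext => w; rewrite mul1r mulN1r.
rewrite sub_// !(covarC _ (x _)) !sub_//.
have k1 := i01 _ kn; have k0 := i01 _ (ltnW kn).
have l1 := i01 _ ln; have l0 := i01 _ (ltnW ln).
rewrite !xcov//.
pose hh : R := th / n%:R.
have hh0 : 0 <= hh by rewrite divr_ge0// ltW.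
have dist_ (i j : nat) : (i <= j)%N -> - th * `|j%:R / n%:R - i%:R / n%:R| = - ((j - i)%:R * hh).
  move=> ij; rewrite ger0_norm; last by rewrite subr_ge0 ler_pM2r ?invr_gt0// ler_nat.
  by rewrite /hh natrB//; field; rewrite gt_eqF.
have kl0 := ltnW kl; have kl1 := leqW kl0.
rewrite !dist_//.
rewrite (_ : (l.+1 - k.+1 = (l - k.+1).+1)%N); last by rewrite subSS subnSK.
rewrite (_ : (l - k = (l - k.+1).+1)%N); last by rewrite subnSK.
rewrite (_ : (l.+1 - k = (l - k.+1).+2)%N); last by rewrite subSn ?subnSK// ltnW.
move: (l - k.+1)%N => m.
have eS j : expR (- (j.+1%:R * hh)) = expR (- (j%:R * hh)) * expR (- hh).
  by rewrite -expRD -natr1; congr expR; ring.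
rewrite !eS; set u := expR (- (m%:R * hh)); set v := expR (- hh).
have -> : c * (u * v) - c * u - (c * (u * v * v) - c * (u * v)) = - (c * (u * (1 - v) ^+ 2)) by ring.
have u0 : 0 <= u by exact: expR_ge0.
have u1 : u <= 1 by rewrite /u expR_le1 oppr_le0 mulr_ge0.
have v1 : 0 <= 1 - v by rewrite subr_ge0 /v expR_le1 oppr_le0.
have vh : 1 - v <= hh by have := expR_ge1Dx (- hh); rewrite -/v; lra.
rewrite normrN ger0_norm; last by rewrite !mulr_ge0// exprn_ge0.
rewrite -mulrA ler_wpM2l//.
have -> : th ^+ 2 / n%:R ^+ 2 = 1 * hh ^+ 2 by rewrite /hh expr_div_n mul1r.
by rewrite ler_pM// ?exprn_ge0// lerXn2r// ?nnegrE// (le_trans v1).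
Qed.

Let incr_var n k : (k < n)%N ->
  covar P (fun w => x (k.+1%:R / n%:R) w - x (k%:R / n%:R) w)
          (fun w => x (k.+1%:R / n%:R) w - x (k%:R / n%:R) w) = 2 * c * (1 - expR (- (th / n%:R))).
Proof.
move=> kn.
have n0 : (0 : R) < n%:R by rewrite ltr0n (leq_ltn_trans _ kn).
have i01 (i : nat) : (i <= n)%N -> 0 <= (i%:R / n%:R : R) <= 1.
  by move=> iN; apply/andP; split; [exact: divr_ge0|rewrite ler_pdivrMr// mul1r ler_nat].
have := covar_lin2 gH 1 (-1) (Hx (k.+1%:R / n%:R)) (Hx (k%:R / n%:R)).
rewrite !xcov ?i01 ?(ltnW kn)// !subrr normr0 mulr0 expR0.
have -> : - th * `|k.+1%:R / n%:R - k%:R / n%:R| = - (th / n%:R).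
  rewrite -mulrBl -natr1 addrC addKr ger0_norm ?divr_ge0//.
  by rewrite mul1r mulNr.
move=> h; transitivity (1 ^+ 2 * (c * 1) + 2 * 1 * -1 * (c * expR (- (th / n%:R))) + (-1) ^+ 2 * (c * 1)).
  rewrite -h; congr (covar P _ _); apply/funext => w; by rewrite mul1r mulN1r.
by ring.
Qed.

(** With [hh = th / n], the squared bias is at most [(2 c th hh)^2], which yields 4 of the
    coefficient 6. Twice the sum of the squared covariances has [n] diagonal terms [(2 c hh)^2],
    giving the 8, and [n^2] terms [(c hh^2)^2], giving the remaining 2. *)
Lemma quad_var_sqr_deviation n : (0 < n)%N ->
  P.-integrable setT (EFin \o (fun w => (quad_var x n w - 2 * c * th) ^+ 2)) /\
  (\int[P]_w (quad_var x n w - 2 * c * th) ^+ 2 <=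
   (6 * c ^+ 2 * th ^+ 4 + 8 * c ^+ 2 * th ^+ 2) / n%:R)%R.
Proof.
move=> n0.
have n0R : (0 : R) < n%:R by rewrite ltr0n.
have n1R : (1 : R) <= n%:R by rewrite ler1n.
have Hd i : H (fun w => x (i.+1%:R / n%:R) w - x (i%:R / n%:R) w).
  have := gaussian_space_lin gH 1 (-1) (Hx (i.+1%:R / n%:R)) (Hx (i%:R / n%:R)).
  by congr H; apply/funext => w; rewrite mul1r mulN1r.
have [i e] := gaussian_sum_sqr_deviation (2 * c * th) n Hd.
split; first exact: i.
rewrite /quad_var e.
set D := fun i w => x (i.+1%:R / n%:R) w - x (i%:R / n%:R) w.
pose hh : R := th / n%:R.
have hh0 : 0 < hh by rewrite divr_gt0.
set v := expR (- hh).
have v1 : 1 - v <= hh by have := expR_ge1Dx (- hh); rewrite -/v; lra.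
(* From [expR (- hh) <= (1 + hh)^-1]. This second-order bound is what makes the bias O(1/n). *)
have v2 : hh - hh ^+ 2 <= 1 - v.
  have : v <= (1 + hh)^-1.
    rewrite /v expRN lef_pV2 ?posrE ?expR_gt0 ?addr_gt0//; exact: expR_ge1Dx.
  have : (1 + hh)^-1 <= 1 - hh + hh ^+ 2.
    rewrite -[leLHS]mul1r ler_pdivrMr ?addr_gt0//.
    rewrite (_ : (1 - hh + hh ^+ 2) * (1 + hh) = 1 + hh ^+ 3); last by ring.
    by rewrite lerDl exprn_ge0// ltW.
  lra.
have v0 : 0 <= 1 - v by rewrite subr_ge0 /v expR_le1 oppr_le0 ltW.
have hn : hh * n%:R = th by rewrite /hh divfK// gt_eqF.
have -> : \sum_(0 <= k < n) covar P (D k) (D k) = n%:R * (2 * c * (1 - v)).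
  rewrite (eq_big_nat _ _ (F2 := fun=> 2 * c * (1 - v))); last first.
    by move=> k /andP[_ kn]; exact: incr_var.
  by rewrite sumr_const_nat subn0 [RHS]mulr_natl.
(* The diagonal is charged the off-diagonal bound as well, so that the summand has one form for all
   pairs. *)
have offdiag : \sum_(0 <= k < n) \sum_(0 <= l < n) covar P (D k) (D l) ^+ 2 <=
   \sum_(0 <= k < n) \sum_(0 <= l < n) ((k == l)%:R * (2 * c * hh) ^+ 2 + (c * hh ^+ 2) ^+ 2).
  rewrite big_nat [leRHS]big_nat; apply: ler_sum => k /andP[_ kn].
  rewrite big_nat [leRHS]big_nat; apply: ler_sum => l /andP[_ ln].
  have chh : c * th ^+ 2 / n%:R ^+ 2 = c * hh ^+ 2 by rewrite /hh; field; rewrite gt_eqF.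
  have ch0 : 0 <= c * hh ^+ 2 by rewrite mulr_ge0// exprn_ge0// ltW.
  have offd (a : R) : `|a| <= c * hh ^+ 2 -> a ^+ 2 <= (c * hh ^+ 2) ^+ 2.
    by move=> h; rewrite -[a ^+ 2]ger0_norm ?sqr_ge0// normrX lerXn2r ?nnegrE.
  have [kl|lk|->] := ltngtP k l.
  - by rewrite mul0r add0r; apply: offd; rewrite -chh; exact: incr_cov.
  - by rewrite mul0r add0r; apply: offd; rewrite covarC -chh; exact: incr_cov.
  - rewrite mul1r incr_var//; apply: (@le_trans _ _ ((2 * c * hh) ^+ 2)); last first.
      by rewrite lerDl sqr_ge0.
    rewrite lerXn2r ?nnegrE ?ler_wpM2l// ?mulr_ge0//; exact: ltW.
have sumE : \sum_(0 <= k < n) \sum_(0 <= l < n) ((k == l)%:R * (2 * c * hh) ^+ 2 + (c * hh ^+ 2) ^+ 2) =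
   n%:R * ((2 * c * hh) ^+ 2 + n%:R * (c * hh ^+ 2) ^+ 2).
  rewrite (eq_big_nat _ _ (F2 := fun=> (2 * c * hh) ^+ 2 + n%:R * (c * hh ^+ 2) ^+ 2)); last first.
    move=> k /andP[_ kn]; rewrite big_split/= sumr_const_nat subn0 -[X in _ + X]mulr_natl; congr (_ + _).
    rewrite -mulr_suml (_ : \sum_(0 <= l < n) (k == l)%:R = 1) ?mul1r//.
    rewrite big_mkord (bigD1 (Ordinal kn))//= eqxx big1 ?addr0// => l.
    by rewrite -val_eqE/= eq_sym => /negbTE ->.
  by rewrite sumr_const_nat subn0 [RHS]mulr_natl.
rewrite sumE in offdiag.
apply: (@le_trans _ _ ((2 * c * th * hh) ^+ 2 + 2 * (n%:R * ((2 * c * hh) ^+ 2 + n%:R * (c * hh ^+ 2) ^+ 2)))).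
  apply: lerD; last by rewrite ler_wpM2l.
  have -> : n%:R * (2 * c * (1 - v)) - 2 * c * th = - (2 * c * (n%:R * (hh - (1 - v)))).
    by rewrite -hn; ring.
  have bb : n%:R * (hh - (1 - v)) <= th * hh.
    by rewrite -hn (mulrC hh) -mulrA ler_wpM2l// -expr2; lra.
  have b0 : 0 <= n%:R * (hh - (1 - v)) by rewrite mulr_ge0// subr_ge0.
  have c20 : 0 <= 2 * c by rewrite mulr_ge0.
  rewrite sqrrN -[X in _ <= X ^+ 2]mulrA lerXn2r ?nnegrE//.
  - exact: mulr_ge0.
  - by rewrite mulr_ge0// (le_trans b0).
  - exact: ler_wpM2l.
have -> : (2 * c * th * hh) ^+ 2 + 2 * (n%:R * ((2 * c * hh) ^+ 2 + n%:R * (c * hh ^+ 2) ^+ 2)) =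
   (8 * c ^+ 2 * th ^+ 2) / n%:R + (6 * c ^+ 2 * th ^+ 4) / n%:R ^+ 2.
  by rewrite /hh; field; rewrite gt_eqF.
rewrite addrC [leRHS]mulrDl; apply: lerD => //; apply: ler_wpM2l.
  by rewrite mulr_ge0 ?exprn_ge0 ?(ltW th0)// mulr_ge0// sqr_ge0.
by rewrite lef_pV2 ?posrE ?exprn_gt0// ler_eXnr.
Qed.

Lemma quad_var_deviation n (e : R) : (0 < n)%N -> 0 < e ->
  (P [set w | (e <= `|quad_var x n w - 2 * c * th|)%R] <=
   ((6 * c ^+ 2 * th ^+ 4 + 8 * c ^+ 2 * th ^+ 2) / e ^+ 2 / n%:R)%:E)%E.
Proof.
move=> n0 e0; have [i le_] := quad_var_sqr_deviation n0.
have mq : measurable_fun setT (fun w => quad_var x n w - 2 * c * th).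
  apply: measurable_funB => //; apply: measurable_sum => k.
  by apply: measurable_funX; apply: measurable_funB; exact: (gaussian_space_measurable gH).
have := sqr_chebyshev P mq e0.
rewrite -(fineK (integrable_fin_num measurableT i)) -lee_pdivlMl ?exprn_gt0// => /le_trans; apply.
rewrite -EFinM lee_fin [leRHS]mulrAC mulrC; apply: ler_wpM2r; last exact: le_.
by rewrite invr_ge0 exprn_ge0// ltW.
Qed.

End quadratic_variation.

(** * The bivariate process *)

(** [gaussian_variable] leaves [m] unspecified; identifying it with the expectation is what turns a
    zero mean into a centred law. *)
Lemma gaussian_law_mean d (Omega : measurableType d) (R : realType)
    (P : probability Omega R) (f : Omega -> R) (m s : R) :
  measurable_fun setT f -> 0 <= s ->
  (forall A : set R, measurable A -> P (f @^-1` A) = gaussian_law m s A) ->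
  (\int[P]_w f w)%R = m.
Proof.
move=> mf s0 law; pose g w := f w - m.
have mg : measurable_fun setT g by exact: measurable_funB.
have lawg (A : set R) : measurable A -> P (g @^-1` A) = gaussian_law 0 s A.
  move=> mA; pose B := (fun x : R => x - m) @^-1` A.
  have mB : measurable B.
    rewrite -[X in measurable X]setTI.
    by have : measurable_fun setT (fun x : R => x - m); [exact: measurable_funB|apply].
  rewrite (_ : g @^-1` A = f @^-1` B)// law// /gaussian_law.
  case: ifPn => [_|sn0].
    rewrite !diracE; suff -> : (m \in B) = (0 \in A) by [].
    by apply/idP/idP; rewrite !inE /B/= subrr.
  rewrite (normal_prob_shift _ sn0 mB).
  by congr (normal_prob 0 s _); apply/funext => x; rewrite /B/= addrK.
have ig : P.-integrable setT (EFin \o g).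
  apply: (gaussian_law0_integrable mg s0 lawg (f := id) (K := 1)) => // x.
  by rewrite mul1r normr_le1DX4.
have ic : P.-integrable setT (EFin \o cst m) by exact: finite_measure_integrable_cst.
transitivity (\int[P]_w (g w + cst m w))%R.
  by apply: eq_Rintegral => w _; rewrite /g subrK.
rewrite RintegralD// (gaussian_law0_mean mg s0 lawg) add0r Rintegral_cst//.
have -> : fine (P setT) = 1 by rewrite probability_setT.
by rewrite mulr1.
Qed.

Section process_span.
Context d (Omega : measurableType d) (R : realType).
Variables (Z : R -> {mfun Omega >-> 2.-tuple R}).

Definition process_span (T : set R) : set (Omega -> R) :=
  [set f | exists n (a : 'I_n -> R) (i : 'I_n -> 'I_2) (s : 'I_n -> R),
    (forall k, T (s k)) /\ f = fun w => \sum_(k < n) a k * component Z (i k) (s k) w].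

Lemma measurable_component i s : measurable_fun setT (component Z i s).
Proof.
rewrite /component; apply: (measurableT_comp (f := fun t : 2.-tuple R => tnth t i)) => //.
exact: measurable_tnth.
Qed.

Lemma process_span_component T i s : T s -> process_span T (component Z i s).
Proof.
move=> Ts; exists 1%N, (fun=> 1), (fun=> i), (fun=> s); split => //.
by apply/funext => w; rewrite big_ord1 mul1r.
Qed.

Lemma process_span_lin T (a b : R) f g : process_span T f -> process_span T g ->
  process_span T (fun w => a * f w + b * g w).
Proof.
move=> [n [u [i [s [Ts ->]]]]] [m [u' [i' [s' [Ts' ->]]]]].
pose pick (V : Type) (x : 'I_n -> V) (y : 'I_m -> V) (k : 'I_(n + m)) :=
  match fintype.split k with inl k => x k | inr k => y k end.
exists (n + m)%N, (pick _ (fun k => a * u k) (fun k => b * u' k)), (pick _ i i'), (pick _ s s').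
split=> [k|]; first by rewrite /pick; case: fintype.split.
apply/funext => w; rewrite big_split_ord/= !mulr_sumr; congr (_ + _); apply: eq_bigr => k _.
  by rewrite /pick (unsplitK (inl k)) mulrA.
by rewrite /pick (unsplitK (inr k)) mulrA.
Qed.

Lemma process_span_measurable T f : process_span T f -> measurable_fun setT f.
Proof.
move=> [n [u [i [s [Ts ->]]]]]; apply: measurable_sum => k.
by apply: measurable_funM => //; exact: measurable_component.
Qed.

Variables (T : set R) (psi : parameter R) (P : probability Omega R).
Hypothesis law : bivariate_law T Z psi P.

(** A vanishing expectation alone does not give integrability; it comes from the law of the one-term
    linear combination. *)
Let comp_integrable i s : T s -> P.-integrable setT (EFin \o component Z i s).
Proof.
move=> Ts; have [gauss EZ _] := law.
have mc := measurable_component i s.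
have := EZ i s Ts; rewrite unlock => E0.
have [m [sd [sd0 lawc]]] := gauss 1%N (fun=> 1) (fun=> i) (fun=> s) (fun=> Ts).
have {}lawc (A : set R) : measurable A -> P (component Z i s @^-1` A) = gaussian_law m sd A.
  move=> mA; rewrite -lawc//; congr (P _); apply/funext => w.
  by rewrite /preimage/= big_ord1 mul1r.
have mE := gaussian_law_mean mc sd0 lawc.
have m0 : m = 0 by rewrite -mE /Rintegral E0.
rewrite m0 in lawc.
apply: (gaussian_law0_integrable mc sd0 lawc (f := id) (K := 1)) => // x.
by rewrite mul1r normr_le1DX4.
Qed.

Lemma process_span_gaussian : gaussian_space P (process_span T).
Proof.
split=> [a b f g|f Hf]; first exact: process_span_lin.
have mf := process_span_measurable Hf; split => //.
have [n [u [i [s [Ts fE]]]]] := Hf.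
have [gauss EZ _] := law.
have [m [sd [sd0 lawf]]] := gauss n u i s Ts.
rewrite -fE in lawf.
exists sd => // A mA; rewrite lawf//.
rewrite -(gaussian_law_mean mf sd0 lawf) fE.
rewrite (_ : (\int[P]_w _)%R = 0)// Rintegral_sum//; last first.
  by move=> k; apply: integrableZl_EFin => //; exact: comp_integrable.
rewrite big1// => k _; rewrite RintegralZl//; last exact: comp_integrable.
by have := EZ (i k) (s k) (Ts k); rewrite unlock /Rintegral => ->; rewrite mulr0.
Qed.

Lemma covar_component i j s t : T s -> T t ->
  covar P (component Z i s) (component Z j t) = cov_fun psi i j s t.
Proof.
move=> Ts Tt; have [_ EZ cov] := law.
have := cov i j s t Ts Tt; rewrite unlock (EZ i s Ts) (EZ j t Tt) /= unlock => e.
rewrite /covar /Rintegral -[RHS]/(fine (_%:E)) -e; congr fine.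
by apply: eq_integral => w _; rewrite !fctE /= !subr0.
Qed.

Definition mix_process (b0 b1 : R) (s : R) : Omega -> R :=
  fun w => b0 * component Z ord0 s w + b1 * component Z ord_max s w.

Definition mix_var (p : parameter R) (b0 b1 : R) : R :=
  b0 ^+ 2 * sigma p ord0 ^+ 2 + 2 * b0 * b1 * (sigma p ord0 * sigma p ord_max * rho p) +
  b1 ^+ 2 * sigma p ord_max ^+ 2.

Lemma mix_process_span b0 b1 s : T s -> process_span T (mix_process b0 b1 s).
Proof. by move=> Ts; apply: process_span_lin; exact: process_span_component. Qed.

Lemma covar_mix_process b0 b1 b0' b1' s t : T s -> T t ->
  covar P (mix_process b0 b1 s) (mix_process b0' b1' t) =
  (b0 * b0' * sigma psi ord0 ^+ 2 + (b0 * b1' + b1 * b0') * (sigma psi ord0 * sigma psi ord_max * rho psi) +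
  b1 * b1' * sigma psi ord_max ^+ 2) * expR (- theta psi * `|s - t|).
Proof.
move=> Ts Tt; have gH := process_span_gaussian.
have Hc i u : T u -> process_span T (component Z i u) by move=> ?; exact: process_span_component.
rewrite /mix_process (covar_linl gH)//; [|exact: Hc|exact: Hc|exact: mix_process_span].
rewrite ![covar P (component Z _ s) _]covarC !(covar_linl gH)//; try exact: Hc.
rewrite !covar_component// /cov_fun/= distrC.
ring.
Qed.

End process_span.

(** * Singularity by quadratic variation *)

Section orthogonality.
Context d (Omega : measurableType d) (R : realType).
Variables (Z : R -> {mfun Omega >-> 2.-tuple R}).
Local Notation T := (`[0, 1]%classic : set R).
Local Notation G := (process_generators T Z).

Lemma process_generators_measurable (D : set R) : process_generators D Z `<=` measurable.
Proof.
by move=> A [s Ts [B mB <-]]; rewrite setTI -[X in measurable X]setTI; exact: measurable_funP.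
Qed.

Lemma process_generators_component (D : set R) i s : D s ->
  measurable_fun [set: g_sigma_algebraType (process_generators D Z)]
    (component Z i s : g_sigma_algebraType (process_generators D Z) -> R).
Proof.
move=> Ts; rewrite /component.
apply: (measurableT_comp (f := fun t : 2.-tuple R => tnth t i)); first exact: measurable_tnth.
move=> _ B mB; apply: sub_sigma_algebra; exists s => //.
by exists B.
Qed.

Variables (psi1 psi2 : parameter R) (P1 P2 : probability Omega R).
Hypothesis hpsi1 : admissible psi1.
Hypothesis hpsi2 : admissible psi2.
Hypothesis hP1 : bivariate_law T Z psi1 P1.
Hypothesis hP2 : bivariate_law T Z psi2 P2.

(* Makes [x s] an element of the Gaussian space at every time [s]. *)
Let clamp (s : R) : R := Num.max 0 (Num.min s 1).

Let clamp01 s : T (clamp s).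
Proof. by rewrite /= in_itv/= /clamp le_max lexx/= ge_max ler01/= ge_min lexx orbT. Qed.

Let clampE s : 0 <= s <= 1 -> clamp s = s.
Proof. by move=> /andP[s0 s1]; rewrite /clamp (min_idPl s1) (max_idPr s0). Qed.

Let dev_bound psi P (hpsi : admissible psi) (hP : bivariate_law T Z psi P) (b0 b1 e : R) :
  0 < e ->
  exists2 C, 0 <= C &
   forall n, (0 < n)%N -> (P [set w | (e <= `|quad_var (fun s => mix_process Z b0 b1 (clamp s)) n w
     - 2 * mix_var psi b0 b1 * theta psi|)%R] <= (C / n%:R)%:E)%E.
Proof.
move=> e0; have gH := process_span_gaussian hP.
have [_ _ th0] := hpsi.
have cE s t : T s -> T t -> covar P (mix_process Z b0 b1 s) (mix_process Z b0 b1 t) =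
    mix_var psi b0 b1 * expR (- theta psi * `|s - t|).
  by move=> Ts Tt; rewrite (covar_mix_process hP)//; congr (_ * _); rewrite /mix_var; ring.
have c0 : 0 <= mix_var psi b0 b1.
  have T0 : T 0 by rewrite /= in_itv/= lexx ler01.
  have := covar_ge0 P (mix_process Z b0 b1 0); rewrite cE//.
  by rewrite subrr normr0 mulr0 expR0 mulr1.
exists ((6 * mix_var psi b0 b1 ^+ 2 * theta psi ^+ 4 + 8 * mix_var psi b0 b1 ^+ 2 * theta psi ^+ 2) / e ^+ 2).
  by rewrite divr_ge0 ?exprn_ge0 ?(ltW e0)// addr_ge0// mulr_ge0 ?exprn_ge0 ?(ltW th0)// mulr_ge0// sqr_ge0.
move=> m m0; apply: (quad_var_deviation gH) => //.
  by move=> s; exact: mix_process_span.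
move=> s t s01 t01; rewrite !clampE//; apply: cE; by rewrite /= in_itv.
Qed.

Lemma mix_var_orthogonal (b0 b1 : R) :
  mix_var psi1 b0 b1 * theta psi1 <> mix_var psi2 b0 b1 * theta psi2 ->
  measures_orthogonal (restrict_sigma (G := G) P1) (restrict_sigma (G := G) P2).
Proof.
move=> neq; pose x s := mix_process Z b0 b1 (clamp s).
pose q1 := 2 * mix_var psi1 b0 b1 * theta psi1.
pose q2 := 2 * mix_var psi2 b0 b1 * theta psi2.
have q12 : 0 < `|q1 - q2| / 2.
  rewrite divr_gt0// normr_gt0 subr_eq0; apply/eqP => q12; apply: neq.
  by move: q12; rewrite /q1 /q2; lra.
(* Half the distance between the two limits: no value lies within less than [e] of both. *)
set e := `|q1 - q2| / 2 in q12.
have [C1 C10 b1_] := @dev_bound psi1 P1 hpsi1 hP1 b0 b1 e q12.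
have [C2 C20 b2_] := @dev_bound psi2 P2 hpsi2 hP2 b0 b1 e q12.
(* The mesh [1 / 2 ^ n.+1] makes the Chebyshev bounds summable, in the form expected by
   [lim_sup_orthogonal]. *)
pose F n := [set w | e <= `|quad_var x (2 ^ n.+1) w - q1|].
have mG := @process_generators_measurable T.
have mx s : measurable_fun [set: g_sigma_algebraType G] (x s : g_sigma_algebraType G -> R).
  apply: measurable_funD; apply: measurable_funM => //; exact: process_generators_component.
have mq n : measurable_fun [set: g_sigma_algebraType G] (quad_var x n : g_sigma_algebraType G -> R).
  apply: measurable_sum => k; apply: measurable_funX; exact: measurable_funB.
have mF n : measurable (F n : set (g_sigma_algebraType G)).
  have := @measurable_fun_ler _ (g_sigma_algebraType G) R setT (cst e) (fun w => `|quad_var x (2 ^ n.+1) w - q1|).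
  have mr : measurable_fun [set: g_sigma_algebraType G]
      (fun w : g_sigma_algebraType G => `|quad_var x (2 ^ n.+1) w - q1|).
    by apply: measurableT_comp => //; exact: measurable_funB.
  move=> /(_ (measurable_cst _) mr) h; have := h measurableT [set true] I.
  by rewrite setTI; congr measurable; apply/seteqP; split.
have mFO n : measurable (F n : set Omega) by apply: (sub_sigma_measurable mG); exact: mF.
have pow0 n : (0 < 2 ^ n.+1)%N by rewrite expn_gt0.
pose C := C1 + C2.
have C0 : 0 <= C by exact: addr_ge0.
have mono (c : R) n : c <= C -> ((c / (2 ^ n.+1)%:R)%:E <= (C / (2 ^ n.+1)%:R)%:E)%E.
  by move=> cC; rewrite lee_fin ler_wpM2r// invr_ge0.
have F1 n : (P1 (F n) <= (C / (2 ^ n.+1)%:R)%:E)%E.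
  by apply: le_trans (b1_ _ (pow0 n)) (mono _ _ _); rewrite lerDl.
have F2 n : (P2 (~` F n) <= (C / (2 ^ n.+1)%:R)%:E)%E.
  apply: le_trans (le_trans (b2_ _ (pow0 n)) (mono _ _ _)); last by rewrite lerDr.
  have mr : measurable_fun [set: Omega]
      (fun w : Omega => `|quad_var x (2 ^ n.+1) w - q2|).
    apply: measurableT_comp => //; apply: measurable_funB => //.
    exact: (measurable_sub_sigma mG (mq _)).
  apply: le_measure; rewrite ?inE; first exact: measurableC.
    have := @measurable_fun_ler _ Omega R setT (cst e) _ (measurable_cst _) mr measurableT [set true] I.
    by rewrite setTI; congr measurable; apply/seteqP; split.
  move=> w /= /negP; rewrite -ltNge => h.
  have {}h : `|quad_var x (2 ^ n.+1) w - q1| < e by [].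
  suff : e <= `|quad_var x (2 ^ n.+1) w - q2| by [].
  have : `|q1 - q2| <= `|quad_var x (2 ^ n.+1) w - q1| + `|quad_var x (2 ^ n.+1) w - q2|.
    have -> : q1 - q2 = (quad_var x (2 ^ n.+1) w - q2) - (quad_var x (2 ^ n.+1) w - q1) by ring.
    by rewrite [leRHS]addrC; exact: ler_normB.
  rewrite -/q1 /e in h *; lra.
have [E1 E2] := lim_sup_orthogonal C0 mFO F1 F2.
exists (lim_sup_set F); split => //.
by apply: bigcapT_measurable => k; apply: bigcup_measurable => j _; exact: mF.
Qed.

(** The combinations [(1, 0)], [(0, 1)] and [(1, 1)] suffice. The first two fix both
    [sigma_i ^+ 2 * theta]; since the [sigma_i] are positive, taking a square root also fixes
    [sigma_1 * sigma_2 * theta], and the cross term of the third then yields [rho]. *)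
Lemma mix_var_separates :
  ~ ((forall i : 'I_2, sigma psi1 i ^+ 2 * theta psi1 = sigma psi2 i ^+ 2 * theta psi2) /\
     rho psi1 = rho psi2) ->
  exists b0 b1, mix_var psi1 b0 b1 * theta psi1 <> mix_var psi2 b0 b1 * theta psi2.
Proof.
move=> nsame; apply: contrapT => h.
have {}h b0 b1 : mix_var psi1 b0 b1 * theta psi1 = mix_var psi2 b0 b1 * theta psi2.
  by apply: contrapT => n; apply: h; exists b0, b1.
have h0 : sigma psi1 ord0 ^+ 2 * theta psi1 = sigma psi2 ord0 ^+ 2 * theta psi2.
  by have := h 1 0; rewrite /mix_var !expr1n !expr0n/= !mulr0 !mul0r !addr0 !mul1r.
have h1 : sigma psi1 ord_max ^+ 2 * theta psi1 = sigma psi2 ord_max ^+ 2 * theta psi2.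
  by have := h 0 1; rewrite /mix_var !expr1n !expr0n/= !mulr0 !mul0r !add0r !mul1r.
have h2 := h 1 1; rewrite /mix_var in h2.
have [s1 _ th1] := hpsi1; have [s2 _ th2] := hpsi2.
have e : sigma psi1 ord0 * sigma psi1 ord_max * theta psi1 = sigma psi2 ord0 * sigma psi2 ord_max * theta psi2.
  apply/eqP; rewrite -(@eqrXn2 _ 2)// ?mulr_ge0 ?ltW//; apply/eqP.
  transitivity ((sigma psi1 ord0 ^+ 2 * theta psi1) * (sigma psi1 ord_max ^+ 2 * theta psi1)); first by ring.
  by rewrite h0 h1; ring.
apply: nsame; split.
  move=> i; have [->|->] : i = ord0 \/ i = ord_max.
    by case: i => [[|[|//]] ?]; [left|right]; apply/val_inj.
  - exact: h0.
  - exact: h1.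
have p : 0 < sigma psi2 ord0 * sigma psi2 ord_max * theta psi2 by rewrite !mulr_gt0.
apply: (mulfI (lt0r_neq0 p)).
rewrite -{1}e.
have : sigma psi1 ord0 * sigma psi1 ord_max * theta psi1 * rho psi1 =
   2^-1 * ((1 ^+ 2 * sigma psi1 ord0 ^+ 2 + 2 * 1 * 1 * (sigma psi1 ord0 * sigma psi1 ord_max * rho psi1) +
      1 ^+ 2 * sigma psi1 ord_max ^+ 2) * theta psi1 - sigma psi1 ord0 ^+ 2 * theta psi1
      - sigma psi1 ord_max ^+ 2 * theta psi1) by field.
by move=> ->; rewrite h2 h0 h1; field.
Qed.

End orthogonality.

(** * Ornstein-Uhlenbeck transitions *)

Section ou_kl.
Context {R : realType}.
Implicit Types v w c th D : R.

(** With [x = v2 ^+ 2 / v1 ^+ 2], the bound [ln x <= x - 1] leaves [x + x^-1 - 2], quadratic in the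
    difference of the variances. Here [w] is the extra second moment due to a wrong regression
    coefficient. *)
Lemma gauss_kl_le (v1 v2 w : R) : 0 < v1 -> 0 < v2 ->
  ln v2 - ln v1 - 2^-1 + (v1 ^+ 2 + w) / (v2 ^+ 2 *+ 2) <=
  2^-1 * ((v1 ^+ 2 - v2 ^+ 2) ^+ 2 / (v1 ^+ 2 * v2 ^+ 2) + w / v2 ^+ 2).
Proof.
move=> v10 v20.
have p1 : 0 < v1 ^+ 2 by rewrite exprn_gt0.
have p2 : 0 < v2 ^+ 2 by rewrite exprn_gt0.
have lnle : ln v2 - ln v1 <= 2^-1 * (v2 ^+ 2 / v1 ^+ 2 - 1).
  have : ln (v2 ^+ 2 / v1 ^+ 2) <= v2 ^+ 2 / v1 ^+ 2 - 1.
    have := expR_ge1Dx (ln (v2 ^+ 2 / v1 ^+ 2)); rewrite lnK ?posrE ?divr_gt0//; lra.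
  rewrite ln_div ?posrE// !lnXn// -(mulr_natl (ln v1)) -(mulr_natl (ln v2)); lra.
apply: (@le_trans _ _ (2^-1 * (v2 ^+ 2 / v1 ^+ 2 - 1) - 2^-1 + (v1 ^+ 2 + w) / (v2 ^+ 2 *+ 2))); first lra.
rewrite le_eqVlt; apply/orP; left; apply/eqP; field.
by rewrite !gt_eqF.
Qed.

Lemma expRN_dist (x y : R) : 0 <= x -> 0 <= y -> (expR (- x) - expR (- y)) ^+ 2 <= (x - y) ^+ 2.
Proof.
wlog xy : x y / x <= y => [h x0 y0|x0 y0].
  have [xy|yx] := leP x y; first exact: h.
  by rewrite -sqrrN opprB -[leRHS]sqrrN opprB; apply: h => //; exact: ltW.
rewrite -[leRHS]sqrrN opprB lerXn2r ?nnegrE ?subr_ge0 ?ler_expR ?lerN2//.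
have -> : expR (- y) = expR (- x) * expR (- (y - x)) by rewrite -expRD; congr expR; ring.
have e1 : expR (- x) <= 1 by rewrite expR_le1 oppr_le0.
have e0 := expR_ge0 (- x).
have := expR_ge1Dx (- (y - x)).
have e2 : expR (- (y - x)) <= 1 by rewrite expR_le1 oppr_le0 subr_ge0.
move: (expR (- x)) (expR (- (y - x))) e0 e1 e2 => a b a0 a1 b1 b2.
apply: (@le_trans _ _ (1 - b)); last lra.
by rewrite -[X in X - _]mulr1 -mulrBr ler_piMl// subr_ge0.
Qed.

(** This is the one-step variance divided by [c * th]: it equals [2 * D] up to O(D^2), a leading
    term free of [th]. With [x = 2 * th * D], all three bounds follow from [x - x^2 <= x / (1 + x)
    <= 1 - expR (- x) <= x]. *)
Let ou_incr_bounds th D : 0 < th -> 0 < D -> D <= 1 ->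
  [/\ (1 - expR (- th * D) ^+ 2) / th <= 2 * D,
      2 * D - 4 * th * D ^+ 2 <= (1 - expR (- th * D) ^+ 2) / th &
      2 * D / (1 + 2 * th) <= (1 - expR (- th * D) ^+ 2) / th].
Proof.
move=> th0 D0 D1.
have -> : expR (- th * D) ^+ 2 = expR (- (2 * th * D)).
  by rewrite -expRM_natl; congr expR; ring.
set x := 2 * th * D; have x0 : 0 < x by rewrite !mulr_gt0.
have xth : x <= 2 * th by rewrite /x ler_piMr// mulr_ge0// ltW.
have e1 := expR_ge1Dx (- x).
have e2 : expR (- x) <= (1 + x)^-1.
  by rewrite expRN lef_pV2 ?posrE ?expR_gt0 ?addr_gt0//; exact: expR_ge1Dx.
have inv1 : (1 + x)^-1 = 1 - x / (1 + x) by field; rewrite gt_eqF// addr_gt0.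
have xx : x - x ^+ 2 <= x / (1 + x).
  rewrite ler_pdivlMr ?addr_gt0//.
  have -> : (x - x ^+ 2) * (1 + x) = x - x ^+ 3 by ring.
  by rewrite gerBl exprn_ge0// ltW.
split.
- by rewrite ler_pdivrMr//; rewrite /x in e1; lra.
- rewrite ler_pdivlMr//; apply: (@le_trans _ _ (x - x ^+ 2)); last by lra.
  by rewrite /x le_eqVlt; apply/orP; left; apply/eqP; ring.
- rewrite ler_pdivlMr//; apply: (@le_trans _ _ (x / (1 + x))); last by lra.
  have -> : 2 * D / (1 + 2 * th) * th = x / (1 + 2 * th) by rewrite /x; field; rewrite gt_eqF// addr_gt0// mulr_gt0.
  by rewrite ler_wpM2l ?(ltW x0)// lef_pV2 ?posrE ?addr_gt0 ?mulr_gt0// lerD2l.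
Qed.

(** Half the sum of the coefficients of [D] in the variance and regression terms of [ou_kl_le], with
    [th1 + th2] replacing either rate wherever an upper bound allows it. *)
Definition ou_rate (th1 th2 : R) : R :=
  2 * (th1 + th2) ^+ 2 * (1 + 2 * (th1 + th2)) ^+ 2 +
  (th1 + th2) ^+ 2 * (1 + 2 * (th1 + th2)) / (4 * th1).

Lemma ou_rate_ge0 th1 th2 : 0 < th1 -> 0 < th2 -> 0 <= ou_rate th1 th2.
Proof.
move=> t1 t2; have t12 : 0 < th1 + th2 by rewrite addr_gt0.
have t3 : 0 < 1 + 2 * (th1 + th2) by rewrite addr_gt0// mulr_gt0.
by apply: addr_ge0; [rewrite !mulr_ge0 ?exprn_ge0 ?ltW|rewrite divr_ge0 ?mulr_ge0 ?exprn_ge0 ?ltW].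
Qed.

(** Since [c1 * th1 = c2 * th2 = k], the variances are [k * f1] and [k * f2], where [f1 - f2] is
    O(D^2) and both factors are at least of order [D]. The coefficients differ by O(D), and the
    square of this is divided by a variance of order [D]. *)
Lemma ou_kl_le c1 c2 th1 th2 D v1 v2 : 0 < c1 -> 0 < c2 -> 0 < th1 -> 0 < th2 ->
    c1 * th1 = c2 * th2 -> 0 < D -> D <= 1 -> 0 < v1 -> 0 < v2 ->
    v1 ^+ 2 = c1 * (1 - expR (- th1 * D) ^+ 2) ->
    v2 ^+ 2 = c2 * (1 - expR (- th2 * D) ^+ 2) ->
  ln v2 - ln v1 - 2^-1 +
    (v1 ^+ 2 + c1 * (expR (- th1 * D) - expR (- th2 * D)) ^+ 2) / (v2 ^+ 2 *+ 2)
  <= ou_rate th1 th2 * D.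
Proof.
move=> c10 c20 t1 t2 cth D0 D1 v10 v20 v1E v2E.
apply: le_trans (gauss_kl_le _ v10 v20) _.
have [u1 l1 m1] := ou_incr_bounds t1 D0 D1.
have [u2 l2 m2] := ou_incr_bounds t2 D0 D1.
pose k := c1 * th1; have k0 : 0 < k by rewrite mulr_gt0.
set f1 := (1 - expR (- th1 * D) ^+ 2) / th1 in u1 l1 m1.
set f2 := (1 - expR (- th2 * D) ^+ 2) / th2 in u2 l2 m2.
have v1f : v1 ^+ 2 = k * f1 by rewrite v1E /k /f1; field; rewrite gt_eqF.
have v2f : v2 ^+ 2 = k * f2 by rewrite v2E /k cth /f2; field; rewrite gt_eqF.
clearbody f1 f2.
(* Dominates both rates and their difference, so that a single lower bound [L] serves [f1] and
   [f2]. *)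
set t := th1 + th2.
have t0 : 0 < t by rewrite addr_gt0.
set L := 2 * D / (1 + 2 * t).
have q0 : 0 < 1 + 2 * t by rewrite addr_gt0// mulr_gt0.
have L0 : 0 < L by rewrite divr_gt0// mulr_gt0.
have Lle th : 0 < th -> th <= t -> L <= 2 * D / (1 + 2 * th).
  move=> th0 tht; rewrite /L ler_wpM2l ?mulr_ge0 ?(ltW D0)//.
  by rewrite lef_pV2 ?posrE ?addr_gt0 ?mulr_gt0// lerD2l ler_wpM2l.
have L1 : L <= f1 by apply: le_trans m1; apply: Lle => //; rewrite lerDl ltW.
have L2 : L <= f2 by apply: le_trans m2; apply: Lle => //; rewrite lerDr ltW.
have f10 := lt_le_trans L0 L1; have f20 := lt_le_trans L0 L2.
have D2 : D ^+ 2 <= D by rewrite expr2 ler_piMl// ltW.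
have D20 : 0 <= D ^+ 2 by rewrite sqr_ge0.
have diff : (f1 - f2) ^+ 2 <= (4 * t * D ^+ 2) ^+ 2.
  have d1 : th1 * D ^+ 2 <= t * D ^+ 2 by rewrite ler_wpM2r// lerDl ltW.
  have d2 : th2 * D ^+ 2 <= t * D ^+ 2 by rewrite ler_wpM2r// lerDr ltW.
  rewrite -[(f1 - f2) ^+ 2]ger0_norm ?sqr_ge0// normrX lerXn2r ?nnegrE//.
    by rewrite !mulr_ge0// ltW.
  by rewrite ler_norml; apply/andP; split; rewrite -!mulrA in l1 l2 *; lra.
have first_ : (v1 ^+ 2 - v2 ^+ 2) ^+ 2 / (v1 ^+ 2 * v2 ^+ 2) <= 4 * t ^+ 2 * (1 + 2 * t) ^+ 2 * D.
  rewrite v1f v2f.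
  have -> : (k * f1 - k * f2) ^+ 2 / (k * f1 * (k * f2)) = (f1 - f2) ^+ 2 / (f1 * f2).
    by field; rewrite !gt_eqF.
  apply: (@le_trans _ _ ((4 * t * D ^+ 2) ^+ 2 / (L * L))).
    apply: ler_pM; [exact: sqr_ge0|by rewrite invr_ge0 mulr_ge0 ?ltW|exact: diff|].
    rewrite lef_pV2 ?posrE ?(mulr_gt0 L0 L0) ?(mulr_gt0 f10 f20)//.
    by apply: ler_pM => //; exact: ltW.
  have -> : (4 * t * D ^+ 2) ^+ 2 / (L * L) = 4 * t ^+ 2 * (1 + 2 * t) ^+ 2 * D ^+ 2.
    by rewrite /L; field; rewrite !gt_eqF.
  by apply: ler_wpM2l => //; apply: mulr_ge0; [apply: mulr_ge0 => //|]; exact: sqr_ge0.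
have second_ : c1 * (expR (- th1 * D) - expR (- th2 * D)) ^+ 2 / v2 ^+ 2 <=
    t ^+ 2 * (1 + 2 * t) / (2 * th1) * D.
  rewrite v2f !mulNr.
  have e1 := @expRN_dist (th1 * D) (th2 * D).
  have {e1} : (expR (- (th1 * D)) - expR (- (th2 * D))) ^+ 2 <= (t * D) ^+ 2.
    apply: le_trans (e1 _ _) _; [by rewrite mulr_ge0 ?ltW..|].
    rewrite -mulrBl -[X in X <= _]ger0_norm ?sqr_ge0// normrX lerXn2r ?nnegrE//.
      by rewrite mulr_ge0 ?ltW.
    rewrite normrM (gtr0_norm D0) ler_wpM2r ?(ltW D0)// /t.
    by rewrite ler_norml; apply/andP; split; lra.
  move: (_ ^+ 2) => E EtD.
  have -> : c1 * E / (k * f2) = E / (th1 * f2) by rewrite /k; field; rewrite !gt_eqF.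
  apply: (@le_trans _ _ ((t * D) ^+ 2 / (th1 * L))).
    have E0 : 0 <= (t * D) ^+ 2 by exact: sqr_ge0.
    apply: (@le_trans _ _ ((t * D) ^+ 2 / (th1 * f2))).
      by rewrite ler_wpM2r// invr_ge0 mulr_ge0// ltW.
    rewrite ler_wpM2l// lef_pV2 ?posrE ?(mulr_gt0 t1 L0) ?(mulr_gt0 t1 f20)//.
    by rewrite ler_wpM2l// ltW.
  rewrite le_eqVlt; apply/orP; left; apply/eqP.
  by rewrite /L; field; rewrite !gt_eqF.
have -> : ou_rate th1 th2 * D = 2^-1 * (4 * t ^+ 2 * (1 + 2 * t) ^+ 2 * D + t ^+ 2 * (1 + 2 * t) / (2 * th1) * D).
  by rewrite /ou_rate -/t; field; rewrite gt_eqF.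
by rewrite ler_wpM2l// lerD.
Qed.

End ou_kl.

(** * Grid-independent likelihood bound for a pair of Ornstein-Uhlenbeck processes *)

Section ou_pair.
Context d (Omega : measurableType d) (R : realType).
Variables (P1 P2 : probability Omega R) (H : set (Omega -> R)).
Hypothesis gH1 : gaussian_space P1 H.
Hypothesis gH2 : gaussian_space P2 H.
Variables (W : bool -> R -> Omega -> R) (c1 c2 : bool -> R) (th1 th2 : R).
Hypothesis HW : forall i s, 0 <= s <= 1 -> H (W i s).
Hypothesis cov1 : forall i j s t, 0 <= s <= 1 -> 0 <= t <= 1 ->
  covar P1 (W i s) (W j t) = (i == j)%:R * (c1 i * expR (- th1 * `|s - t|)).
Hypothesis cov2 : forall i j s t, 0 <= s <= 1 -> 0 <= t <= 1 ->
  covar P2 (W i s) (W j t) = (i == j)%:R * (c2 i * expR (- th2 * `|s - t|)).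
Hypothesis c10 : forall i, 0 < c1 i.
Hypothesis c20 : forall i, 0 < c2 i.
Hypothesis th10 : 0 < th1.
Hypothesis th20 : 0 < th2.
Hypothesis cth : forall i, c1 i * th1 = c2 i * th2.
Variables (t : nat -> R) (M : nat).
Hypothesis t01 : forall k, (k <= M)%N -> 0 <= t k <= 1.
Hypothesis tlt : forall j k, (j < k <= M)%N -> t j < t k.

Let N := M.+1.*2.
(* Visits both components at each time of the grid, so that the same component at
   the previous time is two steps back. *)
Definition ou_grid k : Omega -> R := W (odd k) (t k./2).
Local Notation Y := ou_grid.
(** The first two indices have no earlier value of their component: predictor and coefficient are 0
    there, and [v] is then the stationary deviation. *)
Let X k : Omega -> R := if k is k'.+2 then Y k' else cst 0.
Let D k := t k./2.+1 - t k./2.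
Let a (th : R) k : R := if k is k'.+2 then expR (- th * D k') else 0.
Let v (c : bool -> R) th k := Num.sqrt (c (odd k) * (1 - a th k ^+ 2)).

Let halfN k : (k < N)%N -> (k./2 <= M)%N.
Proof. by rewrite /N => kN; rewrite leq_half_double -ltnS -doubleS. Qed.

Let t01N k : (k < N)%N -> 0 <= t k./2 <= 1.
Proof. by move=> kN; apply: t01; exact: halfN. Qed.

Let HY k : (k < N)%N -> H (Y k).
Proof. by move=> kN; apply: HW; exact: t01N. Qed.

Let HX k : (k < N)%N -> H (X k).
Proof.
case: k => [|[|k]] kN /=; last by apply: HY; exact: ltnW (ltnW kN).
- have := gaussian_spaceZ gH1 0 (HY kN).
  by congr H; apply/funext => w; rewrite mul0r.
- have := gaussian_spaceZ gH1 0 (HY kN).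
  by congr H; apply/funext => w; rewrite mul0r.
Qed.

Let DN k : (k.+2 < N)%N -> 0 < D k /\ D k <= 1.
Proof.
move=> kN; have h := halfN kN; rewrite /D; rewrite /= in h.
have lt_ : t k./2 < t k./2.+1 by apply: tlt; rewrite ltnSn.
have := t01 h; have := t01 (ltnW h) => /andP[a0 a1] /andP[b0 b1].
by split; lra.
Qed.

Section one_law.
Variables (P : probability Omega R) (c : bool -> R) (th : R).
Hypothesis gH : gaussian_space P H.
Hypothesis cov : forall i j s t, 0 <= s <= 1 -> 0 <= t <= 1 ->
  covar P (W i s) (W j t) = (i == j)%:R * (c i * expR (- th * `|s - t|)).
Hypothesis c0 : forall i, 0 < c i.
Hypothesis th0 : 0 < th.

Let covYY j k : (j < N)%N -> (k < N)%N -> (j./2 <= k./2)%N ->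
  covar P (Y j) (Y k) = (odd j == odd k)%:R * (c (odd j) * expR (- th * (t k./2 - t j./2))).
Proof.
move=> jN kN jk; rewrite cov ?t01N//; congr (_ * (_ * expR (_ * _))).
rewrite distrC ger0_norm// subr_ge0.
move: jk; rewrite leq_eqVlt => /predU1P[->//|jk].
by rewrite ltW// tlt// jk halfN.
Qed.

Let covarr f g h b : H f -> H g -> H h ->
  covar P f (fun w => g w - b * h w) = covar P f g - b * covar P f h.
Proof.
move=> Hf Hg Hh; have := covar_linl gH 1 (- b) Hg Hh Hf.
rewrite mul1r mulNr (covarC P g f) (covarC P h f) => <-.
by rewrite covarC; congr (covar P _ f); apply/funext => w; rewrite mul1r mulNr.
Qed.

Let covar0r f : covar P f (cst 0) = 0.
Proof.
rewrite /covar (@eq_Rintegral _ _ _ _ _ (cst 0)) ?Rintegral_cst ?mul0r// => w _.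
by rewrite mulr0.
Qed.

(** Markov property: for the same component, the exponential covariance factors through the
    predictor's time and the coefficient is exactly that factor. Different components are
    uncorrelated; this includes [j = k.-1]. *)
Lemma ou_grid_ortho k j : (k < N)%N -> (j < k)%N ->
  covar P (Y j) (fun w => Y k w - a th k * X k w) = 0.
Proof.
move=> kN jk; have jN := ltn_trans jk kN.
rewrite (covarr _ (HY jN) (HY kN) (HX kN)).
case: k kN jk => [//|[|k]] kN jk /=.
  rewrite mul0r subr0; move: jk; rewrite ltnS leqn0 => /eqP j0.
  by rewrite j0 covYY//= mul0r.
have kN1 := ltnW kN; have kN' := ltnW kN1.
have hk : (j./2 <= k./2.+1)%N by have := half_leq (ltnW jk).
have [jk'|jk'] := leqP j k; last first.
  have -> : j = k.+1 by apply/eqP; rewrite eqn_leq jk' -ltnS jk.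
  rewrite covYY//=; last by rewrite -ltnS uphalf_half; case: (odd k); rewrite ?ltnS ?leqnn.
  by rewrite covarC covYY//= ?uphalf_half ?leq_addl//; case: (odd k); rewrite /= !mul0r mulr0 subr0.
have hk' := half_leq jk'.
rewrite (covYY jN kN hk) (covYY jN kN' hk') /= negbK.
have [_|] := eqVneq (odd j) (odd k); last by rewrite !mul0r mulr0 subr0.
rewrite !mul1r mulrCA -expRD /D.
rewrite [X in c _ * expR X - _](_ : _ = - th * (t k./2.+1 - t k./2) + - th * (t k./2 - t j./2)); last by ring.
by rewrite subrr.
Qed.

(** The coefficient [b] is free because the expected log-ratio also needs, under the first law, the
    residual formed with the second law's coefficient. *)
Lemma ou_grid_sqr k (b : R) : (k < N)%N ->
  covar P (fun w => Y k w - b * X k w) (fun w => Y k w - b * X k w) =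
  if k is k'.+2 then c (odd k) * (1 - 2 * b * a th k + b ^+ 2) else c (odd k).
Proof.
move=> kN.
have Hk : H (fun w => Y k w - b * X k w).
  have := gaussian_space_lin gH 1 (- b) (HY kN) (HX kN).
  by congr H; apply/funext => w; rewrite mul1r mulNr.
rewrite (covarr _ Hk (HY kN) (HX kN)) !(covarC _ (fun w => _ - _)).
rewrite !(covarr _ _ (HY kN) (HX kN)); [|exact: HX|exact: HY].
have YY j : (j < N)%N -> covar P (Y j) (Y j) = c (odd j).
  by move=> jN; rewrite covYY// eqxx mul1r subrr mulr0 expR0 mulr1.
case: k kN {Hk} => [|[|k]] kN.
- by rewrite /= !covar0r YY// (covarC P (cst 0)) covar0r !(mulr0, subr0).
- by rewrite /= !covar0r YY// (covarC P (cst 0)) covar0r !(mulr0, subr0).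
have kN' := ltnW (ltnW kN).
rewrite /= (covarC P (Y k.+2)) !YY// (covYY kN' kN (leqnSn _))/=.
by rewrite negbK eqxx mul1r /D; ring.
Qed.

Lemma ou_grid_sd k : (k < N)%N -> 0 < v c th k /\ v c th k ^+ 2 = c (odd k) * (1 - a th k ^+ 2).
Proof.
move=> kN; have p : 0 < c (odd k) * (1 - a th k ^+ 2).
  rewrite mulr_gt0// subr_gt0.
  case: k kN => [|[|k]] kN /=; rewrite ?expr0n//=.
  have [D0 D1] := DN kN.
  by rewrite exprn_ilt1// ?expR_ge0// expR_lt1 mulNr oppr_lt0 mulr_gt0.
by rewrite /v sqrtr_gt0 sqr_sqrtr ?ltW.
Qed.

End one_law.

(** The first summand is the cost of the two initial values, the second the rate for two components
    over a total time of at most 1; neither involves the grid. *)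
Definition ou_pair_kl : R :=
  2 * (2^-1 * ((th1 - th2) ^+ 2 / (th1 * th2))) + 2 * ou_rate th1 th2.

Let K0 : R := 2^-1 * ((th1 - th2) ^+ 2 / (th1 * th2)).
Let K k : R := if k is k'.+2 then ou_rate th1 th2 * D k' else K0.

(** For each component the steps [D] telescope to [t M - t 0], which is at most 1. *)
Let sumK : \sum_(0 <= k < N) K k <= ou_pair_kl.
Proof.
have E m : \sum_(0 <= k < m.+1.*2) K k = 2 * K0 + 2 * ou_rate th1 th2 * (t m - t 0).
  elim: m => [|m IH]; first by rewrite !big_nat_recr//= big_geq//=; ring.
  rewrite doubleS big_nat_recr// big_nat_recr// IH /= /D doubleK -[m.*2.+1]addn1 halfD odd_double doubleK /= add0n addn0; ring.
rewrite /N E /ou_pair_kl lerD2l ler_piMr//.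
  by rewrite mulr_ge0// ou_rate_ge0.
by have := t01 (leqnn M); have := t01 (leq0n M); move=> /andP[? ?] /andP[? ?]; lra.
Qed.

Lemma ou_pair_bound (m : R) A : 0 < m -> <<s cylinder Y N >> A ->
  (P1 A <= (expR m)%:E * P2 A + ((ou_pair_kl + 1) / m)%:E)%E.
Proof.
move=> m0 GA.
have mX k : (k < N)%N -> measurable_fun [set: g_sigma_algebraType (cylinder Y k)]
    (X k : g_sigma_algebraType (cylinder Y k) -> R).
  case: k => [|[|k]] kN /=; [exact: measurable_cst|exact: measurable_cst|].
  exact: (@cylinder_measurable_fun _ _ _ Y k k.+2 (leqnSn _)).
have v1 k (kN : (k < N)%N) := ou_grid_sd c10 th10 kN.
have v2 k (kN : (k < N)%N) := ou_grid_sd c20 th20 kN.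
have var_ (P : probability Omega R) c th : gaussian_space P H ->
    (forall i j s t, 0 <= s <= 1 -> 0 <= t <= 1 ->
       covar P (W i s) (W j t) = (i == j)%:R * (c i * expR (- th * `|s - t|))) ->
    (forall i, 0 < c i) -> 0 < th ->
    forall k, (k < N)%N -> covar P (fun w => Y k w - a th k * X k w) (fun w => Y k w - a th k * X k w) = v c th k ^+ 2.
  move=> gH cov c0 th0 k kN; have [_ ->] := ou_grid_sd c0 th0 kN.
  rewrite (ou_grid_sqr gH cov)//; case: k kN => [|[|k]] kN.
  - by rewrite /= expr0n subr0 mulr1.
  - by rewrite /= expr0n subr0 mulr1.
  - by congr (_ * _); ring.
have KL k : (k < N)%N -> ln (v c2 th2 k) - ln (v c1 th1 k) - 2^-1 +
    covar P1 (fun w => Y k w - a th2 k * X k w) (fun w => Y k w - a th2 k * X k w) / (v c2 th2 k ^+ 2 *+ 2) <= K k.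
  move=> kN; have [p1 e1] := v1 k kN; have [p2 e2] := v2 k kN.
  rewrite (ou_grid_sqr gH1 cov1)//.
  (* Both variances are stationary here, and [cth] gives [c1 / c2 = th2 / th1], which turns the
     variance term into [K0]. *)
  have base : a th1 k = 0 -> a th2 k = 0 -> ln (v c2 th2 k) - ln (v c1 th1 k) - 2^-1 + c1 (odd k) / (v c2 th2 k ^+ 2 *+ 2) <= K0.
    move=> a1 a2; rewrite a1 a2 !expr0n/= !subr0 !mulr1 in e1 e2.
    have := gauss_kl_le 0 p1 p2; rewrite e1 e2 mul0r !addr0 => /le_trans; apply.
    rewrite le_eqVlt; apply/orP; left; apply/eqP; rewrite /K0; congr (_ * _).
    have := cth (odd k); move: (c10 (odd k)) (c20 (odd k)) => q1 q2 e.
    have -> : c1 (odd k) = c2 (odd k) * th2 / th1 by rewrite -e; field; rewrite gt_eqF.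
    by field; rewrite !gt_eqF.
  case: k kN p1 e1 p2 e2 base => [|[|k]] kN p1 e1 p2 e2 base; [exact: base|exact: base|].
  have [D0 D1] := DN kN.
  (* With [a1], [a2] the two coefficients, the second residual has variance
     [c1 * (1 - 2 * a2 * a1 + a2 ^+ 2)] under the first law, that is
     [v1 ^+ 2 + c1 * (a1 - a2) ^+ 2]. *)
  have := ou_kl_le (c10 _) (c20 _) th10 th20 (cth _) D0 D1 p1 p2 e1 e2.
  apply: le_trans; rewrite e1 /=.
  by rewrite le_eqVlt; apply/orP; left; apply/eqP; congr (_ + _ / _); ring.
have := @likelihood_chain_le _ _ _ P1 P2 H gH1 gH2 Y X (a th1) (a th2) (v c1 th1) (v c2 th2) N
  HY HX mX (fun k kN => (v1 k kN).1) (fun k kN => (v2 k kN).1)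
  (fun k j kN jk => ou_grid_ortho gH1 cov1 kN jk)
  (fun k j kN jk => ou_grid_ortho gH2 cov2 kN jk)
  (var_ P1 c1 th1 gH1 cov1 c10 th10) (var_ P2 c2 th2 gH2 cov2 c20 th20) K KL m A m0 GA.
move/le_trans; apply; apply: leeD => //.
by rewrite lee_fin ler_wpM2r ?invr_ge0 ?(ltW m0)// lerD2r.
Qed.

End ou_pair.

(** * Mutual absolute continuity *)

Section equivalence.
Context d (Omega : measurableType d) (R : realType).
Variables (Z : R -> {mfun Omega >-> 2.-tuple R}).
Local Notation T := (`[0, 1]%classic : set R).

(* With [r] the regression coefficient, the component [true] is uncorrelated with
   the component [false]. *)
Definition residual_process (r : R) (i : bool) (s : R) : Omega -> R :=
  if i then mix_process Z (- r) 1 s else mix_process Z 1 0 s.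

Definition residual_var (psi : parameter R) (i : bool) : R :=
  if i then sigma psi ord_max ^+ 2 * (1 - rho psi ^+ 2) else sigma psi ord0 ^+ 2.

(** The coefficient [r] is tied to [psi] by an equation and not defined from it, because the same
    [r] must serve both laws. *)
Lemma covar_residual_process (D : set R) psi (P : probability Omega R) r i j s t :
    bivariate_law D Z psi P -> r * sigma psi ord0 = rho psi * sigma psi ord_max ->
    D s -> D t ->
  covar P (residual_process r i s) (residual_process r j t) =
  (i == j)%:R * (residual_var psi i * expR (- theta psi * `|s - t|)).
Proof.
move=> hP hr Ds Dt; case: i; case: j; rewrite /residual_process (covar_mix_process hP)// /=.
- rewrite [RHS]mul1r; congr (_ * _).
  transitivity ((r * sigma psi ord0) ^+ 2 -
    2 * (r * sigma psi ord0) * sigma psi ord_max * rho psi + sigma psi ord_max ^+ 2); first by ring.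
  by rewrite hr; ring.
- rewrite [RHS]mul0r; transitivity (sigma psi ord0 * (sigma psi ord_max * rho psi - r * sigma psi ord0) *
    expR (- theta psi * `|s - t|)); first by ring.
  by rewrite hr; ring.
- rewrite [RHS]mul0r; transitivity (sigma psi ord0 * (sigma psi ord_max * rho psi - r * sigma psi ord0) *
    expR (- theta psi * `|s - t|)); first by ring.
  by rewrite hr; ring.
- by ring.
Qed.

Lemma residual_var_gt0 psi i : admissible psi -> 0 < residual_var psi i.
Proof.
move=> [s0 r1 _]; case: i => /=; last exact: exprn_gt0.
by rewrite mulr_gt0 ?exprn_gt0// subr_gt0 -real_normK ?num_real// exprn_ilt1.
Qed.

Definition finite_dim_algebra : set (set Omega) :=
  [set A | exists2 S : seq R, (forall s, s \in S -> 0 <= s <= 1) &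
    <<s process_generators [set` S] Z >> A].

Lemma finite_dim_measurable : finite_dim_algebra `<=` measurable.
Proof. by move=> A [S _]; apply: sub_sigma_measurable; exact: process_generators_measurable. Qed.

Lemma finite_dim0 : finite_dim_algebra set0.
Proof.
exists [::] => //.
exact: (@measurable0 _ (g_sigma_algebraType (process_generators [set` [::]] Z))).
Qed.

Lemma finite_dimC A : finite_dim_algebra A -> finite_dim_algebra (~` A).
Proof.
move=> [S S01 SA]; exists S => //.
exact: (@measurableC _ (g_sigma_algebraType (process_generators [set` S] Z))).
Qed.

Lemma process_generators_subset (D D' : set R) : D `<=` D' ->
  <<s process_generators D Z >> `<=` <<s process_generators D' Z >>.
Proof. by move=> DD'; apply: sub_smallest2r => //; exact: bigcup_subset. Qed.

Lemma finite_dimU A B : finite_dim_algebra A -> finite_dim_algebra B ->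
  finite_dim_algebra (A `|` B).
Proof.
move=> [S S01 SA] [S' S01' SB]; exists (S ++ S').
  by move=> s; rewrite mem_cat => /orP[/S01|/S01'].
apply: (@measurableU _ (g_sigma_algebraType (process_generators [set` S ++ S'] Z))).
  by apply: process_generators_subset SA => s /= sS; rewrite mem_cat sS.
by apply: process_generators_subset SB => s /= sS; rewrite mem_cat sS orbT.
Qed.

Lemma process_generators_finite_dim :
  <<s process_generators T Z >> `<=` <<s finite_dim_algebra >>.
Proof.
apply: sub_smallest2r; first exact: smallest_sigma_algebra.
move=> A [s Ts ZA]; exists [:: s].
  by move=> u; rewrite inE => /eqP ->; move: Ts; rewrite /= in_itv.
by apply: sub_sigma_algebra; exists s => //=; rewrite inE.
Qed.

(** Sorting without repetition makes the times strictly increasing; 0 is added so that the grid is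
    never empty. The residual coordinates generate the same events at these times, because the
    change of coordinates is invertible. *)
Lemma finite_dim_grid (r : R) (S : seq R) : (forall s, s \in S -> 0 <= s <= 1) ->
  exists (t : nat -> R) (M : nat),
  [/\ forall k, (k <= M)%N -> 0 <= t k <= 1,
      forall j k, (j < k <= M)%N -> t j < t k &
      <<s process_generators [set` S] Z >> `<=`
      <<s cylinder (ou_grid (residual_process r) t) M.+1.*2 >>].
Proof.
move=> S01; pose S0 := sort <=%R (undup (0 :: S)).
have memS0 s : (s \in S0) = (s \in 0 :: S) by rewrite mem_sort mem_undup.
have S0pos : (0 < size S0)%N by rewrite lt0n size_eq0; apply/eqP => e; have := memS0 0; rewrite e in_nil inE eqxx.
have M1 : (size S0).-1.+1 = size S0 by rewrite prednK.
exists (nth 0 S0), (size S0).-1; split.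
- move=> k kM; have : nth 0 S0 k \in S0 by rewrite mem_nth// -M1.
  by rewrite memS0 inE => /predU1P[->|/S01//]; rewrite lexx ler01.
- move=> j k /andP[jk kM]; have kS : (k < size S0)%N by rewrite -M1.
  rewrite (lt_sorted_ltn_nth 0)// ?inE//; last exact: ltn_trans kS.
  by rewrite sort_lt_sorted undup_uniq.
rewrite M1; set Y := ou_grid _ _; set n := (size S0).*2.
apply: smallest_sub; first exact: smallest_sigma_algebra.
move=> A [s sS [B mB <-]].
have sS0 : s \in S0 by rewrite memS0 inE sS orbT.
pose l := index s S0.
have ln : (l.*2.+1 < n)%N by rewrite /n -doubleS leq_double index_mem.
have Y0 : component Z ord0 s = Y l.*2.
  apply/funext => w; rewrite /Y /ou_grid odd_double doubleK nth_index//= /mix_process.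
  by rewrite mul1r mul0r addr0.
(* Inverts the residual transformation: the second component is its residual plus [r] times the
   first component. *)
have Y1 : component Z ord_max s = fun w => Y l.*2.+1 w + r * Y l.*2 w.
  apply/funext => w; rewrite /Y /ou_grid /= odd_double/= doubleK uphalf_double nth_index//= /mix_process.
  by ring.
suff : measurable_fun [set: g_sigma_algebraType (cylinder Y n)]
    (Z s : g_sigma_algebraType (cylinder Y n) -> 2.-tuple R) by apply.
apply/measurable_fun_tnthP => i.
have m0 : measurable_fun [set: g_sigma_algebraType (cylinder Y n)]
    (Y l.*2 : g_sigma_algebraType (cylinder Y n) -> R).
  by apply: cylinder_measurable_fun; exact: ltnW.
have [->|->] : i = ord0 \/ i = ord_max.
  by case: i => [[|[|//]] ?]; [left|right]; apply/val_inj.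
- by rewrite (_ : _ \o _ = Y l.*2).
- rewrite (_ : _ \o _ = fun w => Y l.*2.+1 w + r * Y l.*2 w)//.
  by apply: measurable_funD; [exact: cylinder_measurable_fun|exact: measurable_funM].
Qed.

Lemma same_null (psi1 psi2 : parameter R) (P1 P2 : probability Omega R) :
    admissible psi1 -> admissible psi2 ->
    bivariate_law T Z psi1 P1 -> bivariate_law T Z psi2 P2 ->
    (forall i : 'I_2, sigma psi1 i ^+ 2 * theta psi1 = sigma psi2 i ^+ 2 * theta psi2) ->
    rho psi1 = rho psi2 ->
  forall A, <<s process_generators T Z >> A -> P2 A = 0%E -> P1 A = 0%E.
Proof.
move=> h1 h2 hP1 hP2 kap rr A GA.
have [s1 _ th1] := h1; have [s2 _ th2] := h2.
apply: (null_of_algebra_bound finite_dim_measurable finite_dim0 finite_dimC finite_dimU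
  (C := ou_pair_kl (theta psi1) (theta psi2) + 1)); last exact: process_generators_finite_dim.
move=> m B m0 [S S01 SB].
pose r := rho psi1 * sigma psi1 ord_max / sigma psi1 ord0.
have hr1 : r * sigma psi1 ord0 = rho psi1 * sigma psi1 ord_max by rewrite mulfVK// gt_eqF.
have hr2 : r * sigma psi2 ord0 = rho psi2 * sigma psi2 ord_max.
  (* The ratio of the two deviations is common to both laws: [kap] determines its square, and
     positivity its sign. *)
  have e : sigma psi1 ord_max * sigma psi2 ord0 = sigma psi2 ord_max * sigma psi1 ord0.
    apply/eqP; rewrite -(@eqrXn2 _ 2)// ?mulr_ge0 ?ltW//; apply/eqP.
    apply: (mulIf (lt0r_neq0 th1)); apply: (mulIf (lt0r_neq0 th2)).
    transitivity ((sigma psi1 ord_max ^+ 2 * theta psi1) * (sigma psi2 ord0 ^+ 2 * theta psi2)); first by ring.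
    by rewrite (kap ord_max) -(kap ord0); ring.
  rewrite /r rr -mulrA -mulrA; congr (_ * _).
  by rewrite mulrCA e; field; rewrite gt_eqF.
have [t [M [t01 tlt sub]]] := finite_dim_grid r S01.
have T01 s : 0 <= s <= 1 -> T s by rewrite /= in_itv.
apply: (@ou_pair_bound _ _ _ P1 P2 _ (process_span_gaussian hP1) (process_span_gaussian hP2)
  (residual_process r) (residual_var psi1) (residual_var psi2) _ _ _ _ _ _ _ th1 th2 _
  t M t01 tlt m B m0 (sub B SB)).
- by move=> i s /T01 Ts; case: i; exact: mix_process_span.
- by move=> i j s u /T01 Ts /T01 Tu; exact: covar_residual_process hP1 hr1 Ts Tu.
- by move=> i j s u /T01 Ts /T01 Tu; exact: covar_residual_process hP2 hr2 Ts Tu.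
- by move=> i; exact: residual_var_gt0.
- by move=> i; exact: residual_var_gt0.
- by move=> [] /=; rewrite ?kap// mulrAC kap rr mulrAC.
Qed.

End equivalence.

Theorem lemma2p1 (R : realType) (d : measure_display) (Omega : measurableType d)
    (Z : R -> {mfun Omega >-> 2.-tuple R})
    (psi1 psi2 : parameter R) (P1 P2 : probability Omega R)
    (hpsi1 : admissible psi1) (hpsi2 : admissible psi2)
    (hP1 : bivariate_law `[0, 1] Z psi1 P1)
    (hP2 : bivariate_law `[0, 1] Z psi2 P2) :
  let same := (forall i : 'I_2,
      sigma psi1 i ^+ 2 * theta psi1 = sigma psi2 i ^+ 2 * theta psi2) /\
    rho psi1 = rho psi2 in
  let G := process_generators `[0, 1] Z in
  let Q1 := restrict_sigma (G := G) P1 in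
  let Q2 := restrict_sigma (G := G) P2 in
  (measures_equivalent Q1 Q2 <-> same) /\
  (~ same -> measures_orthogonal Q1 Q2).
Proof.
move=> same G Q1 Q2.
have orth : ~ same -> measures_orthogonal Q1 Q2.
  move=> /(mix_var_separates hpsi1 hpsi2)[b0 [b1 neq]].
  exact (mix_var_orthogonal hpsi1 hpsi2 hP1 hP2 neq).
split => //; split.
(* Equivalence excludes orthogonality: a separating set would be null for the second law together
   with its complement. *)
- move=> [dom12 dom21]; apply: contrapT => /orth[A [mA A1 A2]].
  have mAO : measurable (A : set Omega).
    by apply: (sub_sigma_measurable (@process_generators_measurable _ _ _ Z `[0, 1])).
  have P2A : P2 A = 0%E.
    (* Domination speaks of every measurable subset of [A], hence the appeal to monotonicity. *)
    apply: (dom21 A) => // B mB BA; apply/eqP; rewrite eq_le measure_ge0 andbT.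
    rewrite -A1; apply: (le_measure P1); rewrite ?inE//.
    exact: (sub_sigma_measurable (@process_generators_measurable _ _ _ Z `[0, 1])).
  have := probability_setC P2 mAO; rewrite [LHS]A2 P2A sube0 => /eqP.
  by rewrite eq_sym onee_eq0.
- move=> [kap rr]; have null := same_null hpsi1 hpsi2 hP1 hP2 kap rr.
  have null' := same_null hpsi2 hpsi1 hP2 hP1 (fun i => esym (kap i)) (esym rr).
  split=> A A0 B mB BA; [apply: null => //; exact: A0|apply: null' => //; exact: A0].
Qed.
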